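(* Let $g^{\alpha\beta}$ and $G$ be as in the context, and suppose that $G(\omega)\ge0$ for all $\omega\in\mathbb{S}^1$. Then for all $A\in C_c^\infty(\mathbb{R}\times\mathbb{S}^1)$ the Cauchy problem $$\partial_s(\mu U_q)=0,\qquad \partial_s\mu=\tfrac12G(\omega)\mu^2UU_q,\qquad \lim_{q\to\infty}U(s,q,\omega)=0,\qquad (\mu,U_q)|_{s=0}=(-2,A),$$ for $(\mu,U)(s,q,\omega)$, $(q,\omega)\in\mathbb{R}\times\mathbb{S}^1$, has a global solution for all $s\ge0$. Moreover, for every integer $N\ge1$ there are constants $C_N,C_N'$ (possibly depending on $A$) such that the solution satisfies $$|\mu|+|\mu|^{-1}+\sum_{1\le a+b+c\le N}|\partial_s^a\partial_q^b\partial_\omega^c\mu|+\sum_{a+b+c\le N}|\partial_s^a\partial_q^b\partial_\omega^cU|\le C_N'e^{C_Ns}$$ for all $s\ge0$ and $(q,\omega)\in\mathbb{R}\times\mathbb{S}^1$. Consequently the equation $g^{\alpha\beta}(u)\partial_\alpha\partial_\beta u=0$ in $\mathbb{R}^{1+2}$ satisfies the geometric weak null condition.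
   Context: Coefficients: $g^{\alpha\beta}=g^{\beta\alpha}$ ($\alpha,\beta\in\{0,1,2\}$) are smooth functions of $u\in\mathbb{R}$ with $g^{00}\equiv-1$ and $g^{\alpha\beta}(u)=m^{\alpha\beta}+g_0^{\alpha\beta}u^2+O(|u|^3)$ for $|u|\le1$, $(m^{\alpha\beta})=\mathrm{diag}(-1,1,1)$, $g_0^{\alpha\beta}$ real constants. For $\omega\in\mathbb{S}^1$, $\widehat\omega=(-1,\omega)$ and $G(\omega):=g_0^{\alpha\beta}\widehat\omega_\alpha\widehat\omega_\beta$. $\partial_\omega=\omega_1\partial_{\omega_2}-\omega_2\partial_{\omega_1}$ is the angular derivative on $\mathbb{S}^1$. Geometric weak null condition for this equation: for any initial data with $\mu|_{s=0}\equiv-2$ and $U|_{s=0}\in C_c^\infty(\mathbb{R}\times\mathbb{S}^1)$, the geometric reduced system $\partial_s(\mu U_q)=0$, $\partial_s\mu=\frac12G(\omega)\mu^2UU_q$ has a global solution $(\mu,U)$ for all $s\ge0$ with $\lim_{q\to\infty}U(s,q,\omega)=0$ for all $(s,\omega)$ and satisfying, for all $N\ge1$, the displayed exponential bounds of the claim, with constants that may depend on the data. *)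

(* Defs.v *)
From Stdlib Require Import Reals Arith Lra.
From Coquelicot Require Import Coquelicot.
Open Scope R_scope.

(** * The unit circle and functions on R x R x S^1 *)

(** Functions on S^1 are represented by functions on R^2 whose values off the
    unit circle are never consulted. *)
Definition circle (w : R * R) : Prop := fst w ^ 2 + snd w ^ 2 = 1.

Definition rot (t : R) (w : R * R) : R * R :=
  (fst w * cos t - snd w * sin t, fst w * sin t + snd w * cos t).

Lemma circle_rot (t : R) (w : R * R) : circle w -> circle (rot t w).
Proof.
  unfold circle, rot; simpl; intros H.
  pose proof (sin2_cos2 t) as E; unfold Rsqr in E.
  transitivity ((fst w * (fst w * 1) + snd w * (snd w * 1))
                * (sin t * sin t + cos t * cos t)); [ring|].
  rewrite H, E; ring.
Qed.

Definition ds (f : R -> R -> R * R -> R) (s q : R) (w : R * R) : R :=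
  Derive (fun s' => f s' q w) s.

Definition dq (f : R -> R -> R * R -> R) (s q : R) (w : R * R) : R :=
  Derive (fun q' => f s q' w) q.

(** The derivative along the flow [rot] of the vector field
    w_1 d/dw_2 - w_2 d/dw_1, which is tangent to S^1. *)
Definition dw (f : R -> R -> R * R -> R) (s q : R) (w : R * R) : R :=
  Derive (fun t => f s q (rot t w)) 0.

(** If [f] is the restriction of a function [F] differentiable on R^2, [dw]
    is indeed w_1 dF/dw_2 - w_2 dF/dw_1. *)
Lemma is_derive_rot (F : R -> R -> R) (w : R * R) (l1 l2 : R) :
  differentiable_pt_lim F (fst w) (snd w) l1 l2 ->
  is_derive (fun t => F (fst (rot t w)) (snd (rot t w))) 0
    (fst w * l2 - snd w * l1).
Proof.
  intros H; apply is_derive_Reals.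
  replace (fst w * l2 - snd w * l1) with (l1 * (- snd w) + l2 * fst w) by ring.
  apply (derivable_pt_lim_comp_2d F (fun t => fst (rot t w))
           (fun t => snd (rot t w))).
  - unfold rot; simpl; rewrite cos_0, sin_0.
    replace (fst w * 1 - snd w * 0) with (fst w) by ring.
    replace (fst w * 0 + snd w * 1) with (snd w) by ring.
    exact H.
  - apply is_derive_Reals; unfold rot; simpl; auto_derive; [exact I|].
    rewrite sin_0, cos_0; ring.
  - apply is_derive_Reals; unfold rot; simpl; auto_derive; [exact I|].
    rewrite sin_0, cos_0; ring.
Qed.

(** d_s^a d_q^b d_w^c f *)
Definition dmix (a b c : nat) (f : R -> R -> R * R -> R) :
    R -> R -> R * R -> R :=
  Nat.iter a ds (Nat.iter b dq (Nat.iter c dw f)).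

Definition jointly_continuous (J : R -> Prop) (f : R -> R -> R * R -> R) :
    Prop :=
  continuous_on (fun p : R * R * (R * R) => J (fst (fst p)) /\ circle (snd p))
    (fun p => f (fst (fst p)) (snd (fst p)) (snd p)).

Definition has_partials (J : R -> Prop) (f : R -> R -> R * R -> R) : Prop :=
  forall s q w, J s -> circle w ->
    ex_derive (fun s' => f s' q w) s /\
    ex_derive (fun q' => f s q' w) q /\
    ex_derive (fun t => f s q (rot t w)) 0.

(** [f] is C^n on J x R x S^1, for [J] open in R. *)
Fixpoint Ck (J : R -> Prop) (n : nat) (f : R -> R -> R * R -> R) : Prop :=
  jointly_continuous J f /\
  match n with
  | O => True
  | S n' => has_partials J f /\
            Ck J n' (ds f) /\ Ck J n' (dq f) /\ Ck J n' (dw f)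
  end.

Definition smooth_on (J : R -> Prop) (f : R -> R -> R * R -> R) : Prop :=
  forall n, Ck J n f.

(** Smoothness up to the boundary s = 0, in the sense of extendability to a
    neighbourhood; so the two-sided s-derivatives at s = 0 are the one-sided
    derivatives of the restriction of [f] to s >= 0. *)
Definition smooth_half (f : R -> R -> R * R -> R) : Prop :=
  exists eps, 0 < eps /\ smooth_on (fun s => - eps < s) f.

(** C_c^infty(R x S^1); a function of (q, w) is regarded as a function of
    (s, q, w) independent of s. *)
Definition Cc_infty (A : R -> R * R -> R) : Prop :=
  smooth_on (fun _ => True) (fun _ => A) /\
  exists r, forall q w, circle w -> r < Rabs q -> A q w = 0.

(** * The wave equation g^{ab}(u) d_a d_b u = 0 *)

Definition mink (a b : nat) : R :=
  if Nat.eqb a b then (if Nat.eqb a 0 then -1 else 1) else 0.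

(** Indices range over {0, 1, 2}. *)
Record wave_equation := {
  g : nat -> nat -> R -> R;
  g0 : nat -> nat -> R;
  g_sym : forall a b u, (a <= 2)%nat -> (b <= 2)%nat -> g a b u = g b a u;
  g_smooth : forall a b, (a <= 2)%nat -> (b <= 2)%nat ->
    forall n u, ex_derive_n (g a b) n u;
  g_00 : forall u, g 0 0 u = -1;
  g_expansion : forall a b, (a <= 2)%nat -> (b <= 2)%nat ->
    exists C, forall u, Rabs u <= 1 ->
      Rabs (g a b u - (mink a b + g0 a b * u ^ 2)) <= C * Rabs u ^ 3
}.

Definition what (w : R * R) (a : nat) : R :=
  match a with O => -1 | S O => fst w | _ => snd w end.

Definition G (E : wave_equation) (w : R * R) : R :=
  sum_f_R0 (fun a => sum_f_R0 (fun b => g0 E a b * what w a * what w b) 2) 2.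

(** * The geometric reduced system *)

Definition reduced_system (E : wave_equation) (mu U : R -> R -> R * R -> R) :
    Prop :=
  forall s q w, 0 <= s -> circle w ->
    ds (fun s q w => mu s q w * dq U s q w) s q w = 0 /\
    ds mu s q w = 1 / 2 * G E w * mu s q w ^ 2 * U s q w * dq U s q w.

Definition global_solution (E : wave_equation) (mu U : R -> R -> R * R -> R) :
    Prop :=
  smooth_half mu /\ smooth_half U /\ reduced_system E mu U /\
  forall s w, 0 <= s -> circle w -> is_lim (fun q => U s q w) p_infty 0.

(** Sum of [F a b c] over lo <= a + b + c <= hi. *)
Definition sum_orders (lo hi : nat) (F : nat -> nat -> nat -> R) : R :=
  sum_f_R0 (fun a => sum_f_R0 (fun b => sum_f_R0 (fun c =>
    if andb (Nat.leb lo (a + b + c)) (Nat.leb (a + b + c) hi)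
    then F a b c else 0) hi) hi) hi.

(** [mu s q w <> 0] is part of the meaning of the bound on |mu|^{-1}, as [/ 0]
    is an unspecified real. *)
Definition exponential_bounds (mu U : R -> R -> R * R -> R) : Prop :=
  forall N : nat, (1 <= N)%nat -> exists C C' : R,
    forall s q w, 0 <= s -> circle w ->
      mu s q w <> 0 /\
      Rabs (mu s q w) + / Rabs (mu s q w)
      + sum_orders 1 N (fun a b c => Rabs (dmix a b c mu s q w))
      + sum_orders 0 N (fun a b c => Rabs (dmix a b c U s q w))
      <= C' * exp (C * s).

Definition geometric_weak_null (E : wave_equation) : Prop :=
  forall U0, Cc_infty U0 ->
    exists mu U,
      global_solution E mu U /\
      (forall q w, circle w -> mu 0 q w = -2 /\ U 0 q w = U0 q w) /\
      exponential_bounds mu U.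

(* Main.v *)
Require Import Defs.
From Stdlib Require Import Reals Lra Lia.
From Coquelicot Require Import Coquelicot.
Open Scope R_scope.

(** Since [mu * U_q = -2 A] is conserved, [mu = -2 exp (- G A V)] and
    [U_q = A exp (G A V)], where [V] is the integral of [U] in [s] from 0; hence
    [V = - int_0^s int_q^oo A exp (G A V)]. The identity
    [d/ds exp (G A V) = (G / 2) d/dq (U ^ 2)] and [G >= 0] show that
    [int_q^oo (exp (G A V) - 1) dq <= 0] for [s >= 0], so [U] is bounded by the
    size of the data. To get existence without a continuation argument, [U] is
    replaced by [clip M U] in [V_s = U]: the conservation law survives with
    [U ^ 2 / 2] replaced by a nonnegative primitive of [clip M], and the bound on
    [U] shows that the clip is inactive. The angular derivatives of [V] solve
    linear equations with kernel [- G A^2 exp (G A V)], whose integral in [q] is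
    bounded uniformly in [s], so Gronwall gives bounds exponential in [s]. *)

(** * Real integrals and quadratic remainders *)

(** The kernel has to be measured in its $q$-integral: pointwise, exp(GAV) is only known to be at
    most exponential in s, and Gronwall with that bound would give double exponentials. Smoothness
    up to s = 0 is formulated as extendability, so the equation is solved on s > -eps. For s < 0 the
    sign argument gives nothing, and eps is chosen so small that exp(GAV) stays at most 2 there. The
    angle is a real parameter t, and the fixed point is constructed for each t separately.
    Regularity in t is therefore recovered afterwards. Increments of V are shown to be O(|h|), the
    linearised equation is solved on its own, and its solution Y is identified with the t-derivative
    of V because V(t+h) - V(t) - hY(t) solves a linear equation whose source is O(h^2). Each round
    gains one order: V of order n makes the coefficients of the equation for Y of order n, hence Y
    is of order n and V of order n+1. *)

Lemma RInt_sub (f g : R -> R) a b :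
  ex_RInt f a b -> ex_RInt g a b ->
  RInt (fun x => f x - g x) a b = RInt f a b - RInt g a b.
Proof. intros; exact (RInt_minus f g a b H H0). Qed.

Lemma RInt_scal_l (f : R -> R) a b k :
  ex_RInt f a b -> RInt (fun x => k * f x) a b = k * RInt f a b.
Proof. intros; exact (RInt_scal f a b k H). Qed.

Lemma RInt_split (f : R -> R) a b c :
  ex_RInt f a b -> ex_RInt f b c -> RInt f a c = RInt f a b + RInt f b c.
Proof. intros; symmetry; exact (RInt_Chasles f a b c H H0). Qed.

Lemma RInt_cst (k a b : R) : RInt (fun _ => k) a b = k * (b - a).
Proof. rewrite RInt_const; apply Rmult_comm. Qed.

Lemma RInt_null (f : R -> R) a b :
  (forall x, Rmin a b < x < Rmax a b -> f x = 0) -> RInt f a b = 0.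
Proof.
  intros H; rewrite (RInt_ext f (fun _ => 0)) by exact H.
  rewrite RInt_cst; apply Rmult_0_l.
Qed.

Lemma RInt_bound_const (f : R -> R) a b M :
  ex_RInt f a b ->
  (forall x, Rmin a b <= x <= Rmax a b -> Rabs (f x) <= M) ->
  Rabs (RInt f a b) <= M * Rabs (b - a).
Proof.
  intros He Hb; rewrite Rmult_comm.
  apply (norm_RInt_le_const_abs f a b (RInt f a b) M Hb).
  apply (RInt_correct f a b He).
Qed.

Lemma continuous_of_lipschitz (f : R -> R) x B d :
  0 < d -> (forall y, Rabs (y - x) < d -> Rabs (f y - f x) <= B * Rabs (y - x)) ->
  continuous f x.
Proof.
  intros Hd H; apply continuity_pt_filterlim.
  intros e He.
  (* The sign of [B] is unknown and [B] may vanish; [B'] is a positive majorant by which one can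
     divide. *)
  set (B' := Rabs B + 1).
  assert (HB : 0 < B') by (unfold B'; pose proof (Rabs_pos B); lra).
  exists (Rmin d (e / B')); split.
  - apply Rmin_pos; [lra | apply Rdiv_lt_0_compat; lra].
  - intros y [_ Hy]; simpl in *; unfold Rdist in *.
    pose proof (Rmin_l d (e / B')); pose proof (Rmin_r d (e / B')).
    eapply Rle_lt_trans; [apply H; lra |].
    apply Rle_lt_trans with (B' * Rabs (y - x)).
    + apply Rmult_le_compat_r; [apply Rabs_pos |].
      unfold B'; pose proof (Rle_abs B); lra.
    + apply Rlt_le_trans with (B' * (e / B')).
      * apply Rmult_lt_compat_l; lra.
      * right; field; lra.
Qed.

(** The quadratic form of the remainder is the one that survives integration and Gronwall estimates,
    since it comes with an explicit constant instead of a modulus of continuity. *)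
Lemma is_derive_of_quadratic (f : R -> R) x l B d :
  0 < d ->
  (forall h, Rabs h < d -> Rabs (f (x + h) - f x - h * l) <= B * h ^ 2) ->
  is_derive f x l.
Proof.
  intros Hd H; apply is_derive_Reals; intros e He.
  set (B' := Rabs B + 1).
  assert (HB : 0 < B') by (unfold B'; pose proof (Rabs_pos B); lra).
  assert (Hp : 0 < Rmin d (e / B')).
  { apply Rmin_pos; [lra | apply Rdiv_lt_0_compat; lra]. }
  exists (mkposreal _ Hp); intros h Hh0 Hh; simpl in Hh.
  pose proof (Rmin_l d (e / B')); pose proof (Rmin_r d (e / B')).
  replace ((f (x + h) - f x) / h - l) with ((f (x + h) - f x - h * l) / h)
    by (field; exact Hh0).
  unfold Rdiv; rewrite Rabs_mult, Rabs_inv.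
  pose proof (Rabs_pos_lt h Hh0) as Hha.
  apply Rmult_lt_reg_r with (Rabs h); [exact Hha |].
  rewrite Rmult_assoc, Rinv_l, Rmult_1_r by lra.
  eapply Rle_lt_trans; [apply H; lra |].
  rewrite <- (pow2_abs h).
  apply Rle_lt_trans with (B' * Rabs h * Rabs h).
  - replace (B' * Rabs h * Rabs h) with (B' * Rabs h ^ 2) by ring.
    apply Rmult_le_compat_r; [apply pow2_ge_0 |].
    unfold B'; pose proof (Rle_abs B); lra.
  - apply Rmult_lt_compat_r; [exact Hha |].
    apply Rlt_le_trans with (B' * (e / B')).
    + apply Rmult_lt_compat_l; lra.
    + right; field; lra.
Qed.

Lemma lipschitz_of_derive (u u' : R -> R) C :
  (forall x, is_derive u x (u' x)) -> (forall x, Rabs (u' x) <= C) ->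
  forall x y, Rabs (u x - u y) <= C * Rabs (x - y).
Proof.
  intros D B x y.
  destruct (MVT_gen u y x u') as [z [_ E]].
  - intros; apply D.
  - intros z _; apply continuity_pt_filterlim, (ex_derive_continuous u).
    exists (u' z); apply D.
  - rewrite E, Rabs_mult; apply Rmult_le_compat_r; [apply Rabs_pos | apply B].
Qed.

(** Differentiation under the integral sign: a remainder bounded by [B * h ^ 2] uniformly in the
    integration variable integrates to one bounded by [B * Rabs (b - a) * h ^ 2]. *)
Lemma is_derive_RInt_of_quadratic (f : R -> R -> R) (g : R -> R) a b x B d :
  0 < d ->
  (forall h, Rabs h < d -> ex_RInt (f (x + h)) a b) -> ex_RInt g a b ->
  (forall h y, Rabs h < d -> Rmin a b <= y <= Rmax a b ->
    Rabs (f (x + h) y - f x y - h * g y) <= B * h ^ 2) ->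
  is_derive (fun x => RInt (f x) a b) x (RInt g a b).
Proof.
  intros Hd Hf Hg H.
  apply (is_derive_of_quadratic _ x _ (B * Rabs (b - a)) d Hd).
  intros h Hh.
  assert (H0 : ex_RInt (f x) a b).
  { replace x with (x + 0) by ring; apply Hf; rewrite Rabs_R0; exact Hd. }
  pose proof (Hf h Hh) as H1.
  assert (H2 : ex_RInt (fun y => h * g y) a b)
    by exact (ex_RInt_scal g a b h Hg).
  assert (H3 : ex_RInt (fun y => f (x + h) y - f x y) a b)
    by exact (ex_RInt_minus _ _ a b H1 H0).
  rewrite <- (RInt_scal_l g) by exact Hg.
  rewrite <- (RInt_sub (f (x + h)) (f x)) by assumption.
  rewrite <- (RInt_sub _ (fun y => h * g y)) by assumption.
  replace (B * Rabs (b - a) * h ^ 2) with (B * h ^ 2 * Rabs (b - a)) by ring.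
  apply RInt_bound_const.
  - exact (ex_RInt_minus _ _ a b H3 H2).
  - intros y Hy; apply H; assumption.
Qed.

(** The gain of [/ lam] under time integration is what makes the weight exp(lam|s|) contract for
    large [lam]. Both signs of [s] occur, because solutions extend slightly into the past. *)
Lemma RInt_exp_bound (z : R -> R) s c lam :
  0 < lam -> ex_RInt z 0 s ->
  (forall t, Rmin 0 s <= t <= Rmax 0 s -> Rabs (z t) <= c * exp (lam * Rabs t)) ->
  Rabs (RInt z 0 s) <= c / lam * exp (lam * Rabs s).
Proof.
  intros Hl He Hb.
  assert (Hc : 0 <= c).
  { pose proof (Hb 0) as H0.
    rewrite Rabs_R0, Rmult_0_r, exp_0, Rmult_1_r in H0.
    eapply Rle_trans; [apply Rabs_pos | apply H0].
    unfold Rmin, Rmax; destruct (Rle_dec 0 s); lra. }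
  assert (Hcl : 0 <= c / lam) by (apply Rdiv_le_0_compat; lra).
  destruct (Rle_dec 0 s) as [Hs | Hs].
  - rewrite (Rabs_right s) by lra.
    assert (Hi : is_RInt (fun t => c * exp (lam * t)) 0 s
                  (c / lam * exp (lam * s) - c / lam * exp (lam * 0))).
    { apply (is_RInt_derive (fun t => c / lam * exp (lam * t))
               (fun t => c * exp (lam * t))).
      - intros t _; auto_derive; [exact I | field; lra].
      - intros t _; apply (ex_derive_continuous (fun t => c * exp (lam * t))).
        auto_derive; exact I. }
    eapply Rle_trans.
    + refine (norm_RInt_le z _ 0 s (RInt z 0 s) _ Hs _ (RInt_correct z 0 s He) Hi).
      intros t Ht; pose proof (Hb t) as H'.
      rewrite (Rabs_right t) in H' by lra; apply H'.
      unfold Rmin, Rmax; destruct (Rle_dec 0 s); lra.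
    + rewrite Rmult_0_r, exp_0; lra.
  - assert (Hs' : s <= 0) by lra.
    rewrite (Rabs_left s) by lra.
    assert (Hi : is_RInt (fun t => c * exp (lam * - t)) s 0
                  (- c / lam * exp (lam * - 0) - - c / lam * exp (lam * - s))).
    { apply (is_RInt_derive (fun t => - c / lam * exp (lam * - t))
               (fun t => c * exp (lam * - t))).
      - intros t _; auto_derive; [exact I | field; lra].
      - intros t _; apply (ex_derive_continuous (fun t => c * exp (lam * - t))).
        auto_derive; exact I. }
    pose proof (ex_RInt_swap z 0 s He) as He'.
    rewrite <- (opp_RInt_swap z s 0) by exact He'.
    change (opp (RInt z s 0)) with (- RInt z s 0).
    rewrite Rabs_Ropp.
    eapply Rle_trans.
    + refine (norm_RInt_le z _ s 0 (RInt z s 0) _ Hs' _ (RInt_correct z s 0 He') Hi).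
      intros t Ht; pose proof (Hb t) as H'.
      rewrite (Rabs_left1 t) in H' by lra; apply H'.
      unfold Rmin, Rmax; destruct (Rle_dec 0 s); lra.
    + rewrite Ropp_0, Rmult_0_r, exp_0; unfold Rdiv in *; lra.
Qed.

(** Only the integral of the majorant matters, so it may be pointwise huge. With the kernel as
    majorant, this is how a bound on the $q$-integral enters all later estimates. *)
Lemma tail_RInt_bound (f g : R -> R) r c q :
  0 < r -> (forall x, continuous f x) ->
  (forall x, r < Rabs x -> f x = 0) ->
  ex_RInt g (- r) r -> (forall x, Rabs x <= r -> Rabs (f x) <= g x) ->
  RInt g (- r) r <= c -> Rabs (RInt f q r) <= c.
Proof.
  intros Hr Hc Hs Hg Hb Hi.
  assert (Ef : forall a b, ex_RInt f a b).
  { intros a b; apply (ex_RInt_continuous f); intros; apply Hc. }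
  assert (Hg0 : forall x, - r < x < r -> 0 <= g x).
  { intros x Hx; eapply Rle_trans; [apply Rabs_pos | apply Hb].
    apply Rabs_le; lra. }
  assert (Hc0 : 0 <= c).
  { eapply Rle_trans; [apply RInt_ge_0 | apply Hi]; [lra | exact Hg | exact Hg0]. }
  destruct (Rle_dec q r) as [Hq | Hq].
  2:{ rewrite RInt_null; [rewrite Rabs_R0; exact Hc0 |].
      intros x; unfold Rmin, Rmax; destruct (Rle_dec q r); intros Hx; [lra |].
      apply Hs; rewrite Rabs_right; lra. }
  (* A lower endpoint below [- r] reduces to [p = - r], as [f] vanishes in between. *)
  assert (Main : forall p, - r <= p <= r -> Rabs (RInt f p r) <= c).
  { intros p Hp.
    assert (Eg : ex_RInt g p r) by (apply (ex_RInt_Chasles_2 g (- r)); assumption).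
    assert (Eg' : ex_RInt g (- r) p)
      by (apply (ex_RInt_Chasles_1 g (- r) p r); assumption).
    eapply Rle_trans; [apply abs_RInt_le; [lra | apply Ef] |].
    eapply Rle_trans; [| apply Hi].
    rewrite (RInt_split g (- r) p r Eg' Eg).
    assert (0 <= RInt g (- r) p).
    { apply RInt_ge_0; [lra | exact Eg' | intros; apply Hg0; lra]. }
    enough (RInt (fun t => Rabs (f t)) p r <= RInt g p r) by lra.
    apply RInt_le; [lra | | exact Eg | intros; apply Hb, Rabs_le; lra].
    apply (ex_RInt_norm f); apply Ef. }
  destruct (Rle_dec (- r) q) as [Hq' | Hq']; [apply Main; lra |].
  rewrite (RInt_split f q (- r) r) by apply Ef.
  rewrite (RInt_null f q (- r)), Rplus_0_l; [apply Main; lra |].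
  intros x; unfold Rmin, Rmax; destruct (Rle_dec q (- r)); intros Hx; [| lra].
  apply Hs; rewrite Rabs_left; lra.
Qed.

Lemma tail_RInt_bound_const (f : R -> R) r m q :
  0 < r -> (forall x, continuous f x) ->
  (forall x, r < Rabs x -> f x = 0) ->
  (forall x, Rabs x <= r -> Rabs (f x) <= m) ->
  Rabs (RInt f q r) <= 2 * r * m.
Proof.
  intros Hr Hc Hs Hb.
  apply (tail_RInt_bound f (fun _ => m)); auto.
  - apply (ex_RInt_const (- r) r m).
  - rewrite RInt_cst; lra.
Qed.

(** Ends the arguments that halve a crude initial bound again and again, without forming the
    supremum that a weighted norm would require. *)
Lemma le_of_half_pow a b c :
  (forall n, a <= b * (1 / 2) ^ n + c) -> a <= c.
Proof.
  intros H.
  assert (L : is_lim_seq (fun n => b * (1 / 2) ^ n + c) (b * 0 + c)).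
  { apply is_lim_seq_plus'; [| apply is_lim_seq_const].
    apply (is_lim_seq_scal_l _ b 0).
    apply is_lim_seq_geom; rewrite Rabs_right; lra. }
  replace c with (b * 0 + c) by ring.
  apply (is_lim_seq_le (fun _ => a) (fun n => b * (1 / 2) ^ n + c)
           (Finite a) (Finite (b * 0 + c)) H (is_lim_seq_const a) L).
Qed.

(** * Locally bounded and Lipschitz functions of (s, q) *)

Section Tame.

Variable eps : R.
Hypothesis Heps : 0 < eps.

Definition tame_on (S B : R) (Z : R -> R -> R) : Prop :=
  forall s s' q q', - eps < s -> - eps < s' -> Rabs s <= S -> Rabs s' <= S ->
    Rabs (Z s q) <= B /\
    Rabs (Z s q - Z s' q') <= B * (Rabs (s - s') + Rabs (q - q')).

(** A qualitative class, with no control on how [B] depends on [S]. It supplies integrability and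
    finite starting bounds for iterations; growth in s is tracked separately by [edom]. *)
Definition tame (Z : R -> R -> R) : Prop :=
  forall S, exists B, 0 <= B /\ tame_on S B Z.

Lemma between_0 s t :
  - eps < s -> Rmin 0 s <= t <= Rmax 0 s -> - eps < t /\ Rabs t <= Rabs s.
Proof.
  intros Hs; unfold Rmin, Rmax; destruct (Rle_dec 0 s); intros Ht; split; try lra.
  - rewrite !Rabs_right; lra.
  - rewrite !Rabs_left1; lra.
Qed.

Lemma tame_continuous_q Z s q : tame Z -> - eps < s -> continuous (Z s) q.
Proof.
  intros HZ Hs; destruct (HZ (Rabs s)) as [B [HB H]].
  apply (continuous_of_lipschitz _ q B 1); [lra |]; intros y _.
  destruct (H s s y q) as [_ H']; try lra.
  replace (s - s) with 0 in H' by ring; rewrite Rabs_R0, Rplus_0_l in H'; exact H'.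
Qed.

Lemma tame_continuous_s Z s q :
  tame Z -> - eps < s -> continuous (fun t => Z t q) s.
Proof.
  intros HZ Hs; destruct (HZ (Rabs s + 1)) as [B [HB H]].
  assert (Hp : 0 < Rmin 1 (eps + s)) by (apply Rmin_pos; lra).
  apply (continuous_of_lipschitz _ s B (Rmin 1 (eps + s))); [exact Hp |].
  intros y Hy.
  pose proof (Rmin_l 1 (eps + s)); pose proof (Rmin_r 1 (eps + s)).
  pose proof (Rabs_triang (y - s) s) as Ht.
  replace (y - s + s) with y in Ht by ring.
  assert (- eps < y).
  { pose proof (Rle_abs (- (y - s))) as Hn; rewrite Rabs_Ropp in Hn; lra. }
  destruct (H y s q q) as [_ H']; try lra.
  replace (q - q) with 0 in H' by ring; rewrite Rabs_R0, Rplus_0_r in H'; exact H'.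
Qed.

Lemma tame_ex_RInt_q Z s a b : tame Z -> - eps < s -> ex_RInt (Z s) a b.
Proof.
  intros HZ Hs; apply (ex_RInt_continuous (Z s)); intros.
  apply tame_continuous_q; assumption.
Qed.

Lemma tame_ex_RInt_s Z s q : tame Z -> - eps < s -> ex_RInt (fun t => Z t q) 0 s.
Proof.
  intros HZ Hs; apply (ex_RInt_continuous (fun t => Z t q)); intros t Ht.
  apply tame_continuous_s; [assumption |]; apply (between_0 s t Hs Ht).
Qed.

Lemma tame_const k : tame (fun _ _ => k).
Proof.
  intros S; exists (Rabs k); split; [apply Rabs_pos |].
  intros s s' q q' _ _ _ _; split; [lra |].
  replace (k - k) with 0 by ring; rewrite Rabs_R0.
  apply Rmult_le_pos; [apply Rabs_pos |].
  pose proof (Rabs_pos (s - s')); pose proof (Rabs_pos (q - q')); lra.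
Qed.

Lemma tame_minus Y Z : tame Y -> tame Z -> tame (fun s q => Y s q - Z s q).
Proof.
  intros HY HZ S; destruct (HY S) as [A [HA H1]]; destruct (HZ S) as [B [HB H2]].
  exists (A + B); split; [lra |]; intros s s' q q' h1 h2 h3 h4.
  destruct (H1 s s' q q' h1 h2 h3 h4) as [a1 a2].
  destruct (H2 s s' q q' h1 h2 h3 h4) as [b1 b2].
  split.
  - unfold Rminus; eapply Rle_trans; [apply Rabs_triang |].
    rewrite Rabs_Ropp; lra.
  - replace (Y s q - Z s q - (Y s' q' - Z s' q'))
      with ((Y s q - Y s' q') - (Z s q - Z s' q')) by ring.
    unfold Rminus at 1; eapply Rle_trans; [apply Rabs_triang |].
    rewrite Rabs_Ropp; lra.
Qed.

Lemma tame_scal k Z : tame Z -> tame (fun s q => k * Z s q).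
Proof.
  intros HZ S; destruct (HZ S) as [B [HB H]].
  pose proof (Rabs_pos k) as Hk.
  exists (Rabs k * B); split; [apply Rmult_le_pos; assumption |].
  intros s s' q q' h1 h2 h3 h4; destruct (H s s' q q' h1 h2 h3 h4) as [a b].
  split.
  - rewrite Rabs_mult; apply Rmult_le_compat_l; assumption.
  - rewrite <- Rmult_minus_distr_l, Rabs_mult, Rmult_assoc.
    apply Rmult_le_compat_l; assumption.
Qed.

Lemma tame_mult Y Z : tame Y -> tame Z -> tame (fun s q => Y s q * Z s q).
Proof.
  intros HY HZ S; destruct (HY S) as [A [HA H1]]; destruct (HZ S) as [B [HB H2]].
  pose proof (Rmult_le_pos _ _ HA HB) as HAB.
  exists (2 * (A * B)); split; [lra |]; intros s s' q q' h1 h2 h3 h4.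
  destruct (H1 s s' q q' h1 h2 h3 h4) as [a1 a2].
  destruct (H2 s s' q q' h1 h2 h3 h4) as [_ b2].
  destruct (H2 s s q q h1 h1 h3 h3) as [b1 _].
  destruct (H1 s' s' q' q' h2 h2 h4 h4) as [a1' _].
  split.
  - rewrite Rabs_mult; apply Rle_trans with (A * B); [| lra].
    apply Rmult_le_compat; try apply Rabs_pos; assumption.
  - set (d := Rabs (s - s') + Rabs (q - q')) in *.
    replace (Y s q * Z s q - Y s' q' * Z s' q')
      with ((Y s q - Y s' q') * Z s q + Y s' q' * (Z s q - Z s' q')) by ring.
    eapply Rle_trans; [apply Rabs_triang |]; rewrite !Rabs_mult.
    replace (2 * (A * B) * d) with (A * d * B + A * (B * d)) by ring.
    apply Rplus_le_compat; apply Rmult_le_compat; try apply Rabs_pos; assumption.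
Qed.

Lemma tame_plus Y Z : tame Y -> tame Z -> tame (fun s q => Y s q + Z s q).
Proof.
  intros HY HZ S.
  destruct (tame_minus Y _ HY (tame_scal (-1) Z HZ) S) as [B [HB H]].
  exists B; split; [exact HB |]; intros s s' q q' h1 h2 h3 h4.
  destruct (H s s' q q' h1 h2 h3 h4) as [a b].
  replace (Y s q + Z s q) with (Y s q - -1 * Z s q) by ring.
  replace (Y s' q' + Z s' q') with (Y s' q' - -1 * Z s' q') by ring.
  split; assumption.
Qed.

Variable r : R.
Hypothesis Hr : 0 < r.

Definition supported (Z : R -> R -> R) : Prop :=
  forall s q, - eps < s -> r < Rabs q -> Z s q = 0.

(** For [supported] integrands the endpoint [r] stands for infinity, and the value is 0 for q > r as
    well. *)
Definition qint (Z : R -> R -> R) (s q : R) : R := RInt (Z s) q r.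

Definition sint (Z : R -> R -> R) (s q : R) : R := RInt (fun t => Z t q) 0 s.

Lemma qint_bound Z s q m :
  tame Z -> supported Z -> - eps < s ->
  (forall x, Rabs x <= r -> Rabs (Z s x) <= m) -> Rabs (qint Z s q) <= 2 * r * m.
Proof.
  intros HZ HS Hs Hb; apply tail_RInt_bound_const; auto.
  intros; apply tame_continuous_q; assumption.
Qed.

Lemma qint_minus Y Z s q :
  tame Y -> tame Z -> - eps < s ->
  qint (fun s q => Y s q - Z s q) s q = qint Y s q - qint Z s q.
Proof.
  intros HY HZ Hs; apply (RInt_sub (Y s) (Z s)); apply tame_ex_RInt_q; assumption.
Qed.

Lemma sint_minus Y Z s q :
  tame Y -> tame Z -> - eps < s ->
  sint (fun s q => Y s q - Z s q) s q = sint Y s q - sint Z s q.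
Proof.
  intros HY HZ Hs; apply (RInt_sub (fun t => Y t q) (fun t => Z t q));
    apply tame_ex_RInt_s; assumption.
Qed.

Lemma tame_on_qint S B Z :
  0 <= B -> tame Z -> supported Z -> tame_on S B Z ->
  tame_on S (2 * r * B + B) (qint Z).
Proof.
  intros HB HZ HS H s s' q q' h1 h2 h3 h4.
  assert (0 <= 2 * r * B) by (apply Rmult_le_pos; lra).
  split.
  - apply Rle_trans with (2 * r * B); [| lra].
    apply qint_bound; auto.
    intros x _; apply (H s s x x); assumption.
  - replace (qint Z s q - qint Z s' q')
      with ((qint Z s q - qint Z s' q) + (qint Z s' q - qint Z s' q')) by ring.
    eapply Rle_trans; [apply Rabs_triang |].
    assert (E1 : Rabs (qint Z s q - qint Z s' q) <= 2 * r * B * Rabs (s - s')).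
    { unfold qint; rewrite <- RInt_sub by (apply tame_ex_RInt_q; assumption).
      rewrite (Rmult_assoc (2 * r)).
      apply (tail_RInt_bound_const (fun x => Z s x - Z s' x)); [exact Hr | | |].
      - intros x; apply (continuous_minus (Z s) (Z s'));
          apply tame_continuous_q; assumption.
      - intros x Hx; rewrite !HS by assumption; ring.
      - intros x _; destruct (H s s' x x h1 h2 h3 h4) as [_ H'].
        replace (x - x) with 0 in H' by ring.
        rewrite Rabs_R0, Rplus_0_r in H'; exact H'. }
    assert (E2 : Rabs (qint Z s' q - qint Z s' q') <= B * Rabs (q - q')).
    { unfold qint.
      rewrite (RInt_split (Z s') q q' r) by (apply tame_ex_RInt_q; assumption).
      rewrite Rplus_minus_r.
      rewrite (Rabs_minus_sym q q'); apply RInt_bound_const.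
      - apply tame_ex_RInt_q; assumption.
      - intros x _; apply (H s' s' x x); assumption. }
    pose proof (Rabs_pos (s - s')); pose proof (Rabs_pos (q - q')).
    assert (0 <= B * Rabs (s - s')) by (apply Rmult_le_pos; lra).
    assert (0 <= 2 * r * B * Rabs (q - q')) by (apply Rmult_le_pos; lra).
    lra.
Qed.

Lemma tame_qint Z : tame Z -> supported Z -> tame (qint Z).
Proof.
  intros HZ HS S; destruct (HZ S) as [B [HB H]].
  exists (2 * r * B + B); split; [| apply tame_on_qint; assumption].
  assert (0 <= 2 * r * B) by (apply Rmult_le_pos; lra); lra.
Qed.

Lemma sint_diff_s Z s s' q B :
  tame Z -> - eps < s -> - eps < s' ->
  (forall t, - eps < t -> Rabs t <= Rmax (Rabs s) (Rabs s') -> Rabs (Z t q) <= B) ->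
  Rabs (sint Z s q - sint Z s' q) <= B * Rabs (s - s').
Proof.
  intros HZ Hs Hs' HB.
  assert (E : ex_RInt (fun t => Z t q) s' s).
  { apply (ex_RInt_Chasles (fun t => Z t q) s' 0 s);
      [apply ex_RInt_swap |]; apply tame_ex_RInt_s; assumption. }
  unfold sint.
  rewrite (RInt_split (fun t => Z t q) 0 s' s) by
    (try apply tame_ex_RInt_s; assumption).
  rewrite Rplus_minus_l.
  apply RInt_bound_const; [exact E |].
  intros t Ht; apply HB.
  - revert Ht; unfold Rmin, Rmax; destruct (Rle_dec s' s); lra.
  - revert Ht; unfold Rmin, Rmax at 1; destruct (Rle_dec s' s); intros Ht.
    + rewrite Rmax_comm; apply RmaxAbs; lra.
    + apply RmaxAbs; lra.
Qed.

Lemma sint_bound Z s q B :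
  tame Z -> - eps < s ->
  (forall t, - eps < t -> Rabs t <= Rabs s -> Rabs (Z t q) <= B) ->
  Rabs (sint Z s q) <= B * Rabs s.
Proof.
  intros HZ Hs HB.
  replace (Rabs s) with (Rabs (s - 0)) by (f_equal; ring).
  unfold sint; apply RInt_bound_const; [apply tame_ex_RInt_s; assumption |].
  intros t Ht; apply HB; apply (between_0 s t Hs Ht).
Qed.

Lemma tame_on_sint S B Z :
  0 <= S -> 0 <= B -> tame Z -> tame_on S B Z -> tame_on S (B * S + B) (sint Z).
Proof.
  intros HS0 HB HZ H s s' q q' h1 h2 h3 h4.
  pose proof (Rmult_le_pos _ _ HB HS0).
  split.
  - apply Rle_trans with (B * Rabs s).
    + apply sint_bound; [assumption | assumption |].
      intros t Ht Ht'; apply (H t t q q); lra.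
    + pose proof (Rmult_le_compat_l B _ _ HB h3); lra.
  - replace (sint Z s q - sint Z s' q')
      with ((sint Z s q - sint Z s' q) + (sint Z s' q - sint Z s' q')) by ring.
    eapply Rle_trans; [apply Rabs_triang |].
    assert (E1 : Rabs (sint Z s q - sint Z s' q) <= B * Rabs (s - s')).
    { apply sint_diff_s; auto.
      intros t Ht Ht'; apply (H t t q q); auto;
        eapply Rle_trans; try apply Ht'; apply Rmax_lub; assumption. }
    assert (E2 : Rabs (sint Z s' q - sint Z s' q') <= B * S * Rabs (q - q')).
    { unfold sint; rewrite <- RInt_sub by (apply tame_ex_RInt_s; assumption).
      apply Rle_trans with (B * Rabs (q - q') * Rabs (s' - 0)).
      - apply RInt_bound_const.
        + apply (ex_RInt_minus (fun t => Z t q) (fun t => Z t q'));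
            apply tame_ex_RInt_s; assumption.
        + intros t Ht; destruct (between_0 s' t h2 Ht) as [t1 t2].
          destruct (H t t q q') as [_ H']; try lra.
          replace (t - t) with 0 in H' by ring.
          rewrite Rabs_R0, Rplus_0_l in H'; exact H'.
      - rewrite Rminus_0_r.
        replace (B * S * Rabs (q - q')) with (B * Rabs (q - q') * S) by ring.
        apply Rmult_le_compat_l; [| assumption].
        apply Rmult_le_pos; [assumption | apply Rabs_pos]. }
    pose proof (Rabs_pos (s - s')); pose proof (Rabs_pos (q - q')).
    assert (0 <= B * Rabs (q - q')) by (apply Rmult_le_pos; lra).
    assert (0 <= B * S * Rabs (s - s')) by (apply Rmult_le_pos; lra).
    lra.
Qed.

Lemma tame_sint Z : tame Z -> tame (sint Z).
Proof.
  intros HZ S; destruct (HZ (Rabs S)) as [B [HB H]].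
  pose proof (Rabs_pos S).
  exists (B * Rabs S + B); split.
  - assert (0 <= B * Rabs S) by (apply Rmult_le_pos; lra); lra.
  - pose proof (tame_on_sint (Rabs S) B Z H0 HB HZ H) as H1.
    intros s s' q q' h1 h2 h3 h4; pose proof (Rle_abs S).
    apply H1; lra.
Qed.

Lemma tame_comp (c : R -> R) Z :
  c 0 = 0 -> (forall x y, Rabs (c x - c y) <= Rabs (x - y)) ->
  tame Z -> tame (fun s q => c (Z s q)).
Proof.
  intros c0 cL HZ S; destruct (HZ S) as [B [HB H]].
  exists B; split; [assumption |]; intros s s' q q' h1 h2 h3 h4.
  destruct (H s s' q q' h1 h2 h3 h4) as [a b]; split.
  - specialize (cL (Z s q) 0); rewrite c0, !Rminus_0_r in cL; lra.
  - eapply Rle_trans; [apply cL | exact b].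
Qed.

End Tame.

(** * Picard iteration *)

Lemma sint_exp_bound eps Z s q c lam :
  0 < eps -> tame eps Z -> - eps < s -> 0 < lam ->
  (forall t, - eps < t -> Rabs t <= Rabs s ->
    Rabs (Z t q) <= c * exp (lam * Rabs t)) ->
  Rabs (sint Z s q) <= c / lam * exp (lam * Rabs s).
Proof.
  intros Heps HZ Hs Hl Hb; apply RInt_exp_bound; [exact Hl | |].
  - apply (tame_ex_RInt_s eps); assumption.
  - intros t Ht; apply Hb; apply (between_0 eps Heps s t Hs Ht).
Qed.

Lemma exp_ge_1 x : 0 <= x -> 1 <= exp x.
Proof. intros Hx; pose proof (exp_ineq1_le x); lra. Qed.

Lemma exp_le x y : x <= y -> exp x <= exp y.
Proof.
  intros [H | H]; [left; apply exp_increasing; exact H | rewrite H; apply Rle_refl].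
Qed.

Section Picard.

Variables (eps r : R) (c : R -> R) (F : R -> R -> R -> R).
Hypothesis Heps : 0 < eps.
Hypothesis Hr : 0 < r.
Hypothesis c_0 : c 0 = 0.
Hypothesis c_lip : forall x y, Rabs (c x - c y) <= Rabs (x - y).
Hypothesis F_lip : forall S, exists K, 0 <= K /\
  forall s s' q q' x x', - eps < s -> - eps < s' -> Rabs s <= S -> Rabs s' <= S ->
    Rabs (F s q 0) <= K /\
    Rabs (F s q x - F s' q' x')
      <= K * (1 + Rabs x) * (Rabs (s - s') + Rabs (q - q')) + K * Rabs (x - x').
Hypothesis F_supp : forall s q x, - eps < s -> r < Rabs q -> F s q x = 0.

(** Integral form of X_s = c(int_q^oo F(s, x, X) dx) with X = 0 at s = 0. The map [c] is a clip for
    the nonlinear potential and the identity for the linear problems; the growth allowed in [F_lip]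
    covers both. *)
Definition picard_step (X : R -> R -> R) : R -> R -> R :=
  sint (fun s q => c (qint r (fun s q => F s q (X s q)) s q)).

Definition picard_iter (n : nat) : R -> R -> R :=
  Nat.iter n picard_step (fun _ _ => 0).

Definition picard_sol (s q : R) : R := Lim_seq (fun n => picard_iter n s q).

Lemma tame_F X : tame eps X -> tame eps (fun s q => F s q (X s q)).
Proof.
  intros HX S; destruct (HX S) as [B [HB H1]]; destruct (F_lip S) as [K [HK H2]].
  assert (HKB : 0 <= K * B) by (apply Rmult_le_pos; assumption).
  exists (K * (1 + B) + K * B); split; [lra |].
  intros s s' q q' h1 h2 h3 h4.
  destruct (H1 s s' q q' h1 h2 h3 h4) as [a1 a2].
  pose proof (Rabs_pos (s - s')); pose proof (Rabs_pos (q - q')).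
  split.
  - destruct (H2 s s q q (X s q) 0 h1 h1 h3 h3) as [b1 b2].
    replace (s - s) with 0 in b2 by ring; replace (q - q) with 0 in b2 by ring.
    rewrite Rabs_R0, Rplus_0_l, Rmult_0_r, Rplus_0_l, Rminus_0_r in b2.
    pose proof (Rmult_le_compat_l K _ _ HK a1).
    replace (F s q (X s q)) with ((F s q (X s q) - F s q 0) + F s q 0) by ring.
    eapply Rle_trans; [apply Rabs_triang |]; lra.
  - destruct (H2 s s' q q' (X s q) (X s' q') h1 h2 h3 h4) as [_ b2].
    eapply Rle_trans; [apply b2 |].
    rewrite Rmult_plus_distr_r; apply Rplus_le_compat.
    + apply Rmult_le_compat_r; [lra |].
      apply Rmult_le_compat_l; lra.
    + rewrite Rmult_assoc; apply Rmult_le_compat_l; assumption.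
Qed.

Lemma supported_F X : supported eps r (fun s q => F s q (X s q)).
Proof. intros s q Hs Hq; apply F_supp; assumption. Qed.

Lemma tame_rate X :
  tame eps X -> tame eps (fun s q => c (qint r (fun s q => F s q (X s q)) s q)).
Proof.
  intros HX; apply tame_comp; [exact c_0 | exact c_lip |].
  apply tame_qint; auto; [apply tame_F, HX | apply supported_F].
Qed.

Lemma tame_picard_step X : tame eps X -> tame eps (picard_step X).
Proof. intros HX; apply tame_sint; [exact Heps | apply tame_rate, HX]. Qed.

Lemma tame_picard_iter n : tame eps (picard_iter n).
Proof.
  induction n; [apply tame_const | apply tame_picard_step, IHn].
Qed.

Lemma c_abs x : Rabs (c x) <= Rabs x.
Proof. pose proof (c_lip x 0) as H; rewrite c_0, !Rminus_0_r in H; exact H. Qed.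

Section Bounded_time.

Variables (S K : R).
Hypothesis HK : 0 <= K.
Hypothesis HF : forall s s' q q' x x',
  - eps < s -> - eps < s' -> Rabs s <= S -> Rabs s' <= S ->
    Rabs (F s q 0) <= K /\
    Rabs (F s q x - F s' q' x')
      <= K * (1 + Rabs x) * (Rabs (s - s') + Rabs (q - q')) + K * Rabs (x - x').

(* The contraction factor 1/2 below holds in the norm with weight
   [exp (- lam |s|)]. *)
Let lam := 4 * r * K + 1.

Lemma lam_pos : 0 < lam.
Proof.
  assert (0 <= r * K) by (apply Rmult_le_pos; lra); unfold lam; lra.
Qed.

Lemma F_lip_x s q x y :
  - eps < s -> Rabs s <= S -> Rabs (F s q x - F s q y) <= K * Rabs (x - y).
Proof.
  intros Hs HS; destruct (HF s s q q x y Hs Hs HS HS) as [_ H].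
  replace (s - s) with 0 in H by ring; replace (q - q) with 0 in H by ring.
  rewrite Rabs_R0, Rplus_0_l, Rmult_0_r, Rplus_0_l in H; exact H.
Qed.

Lemma F_growth s q x :
  - eps < s -> Rabs s <= S -> Rabs (F s q x) <= K * (1 + Rabs x).
Proof.
  intros Hs HS; pose proof (F_lip_x s q x 0 Hs HS) as H1.
  destruct (HF s s q q x x Hs Hs HS HS) as [H2 _]; rewrite Rminus_0_r in H1.
  replace (F s q x) with ((F s q x - F s q 0) + F s q 0) by ring.
  eapply Rle_trans; [apply Rabs_triang |]; lra.
Qed.

(** The bound reproduces itself: 1 + |X| is at most 2 exp(lam|t|), so the rate is at most 4rK
    exp(lam|t|), and time integration divides by [lam], which exceeds 4rK. *)
Lemma picard_iter_bound n s q :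
  - eps < s -> Rabs s <= S -> Rabs (picard_iter n s q) <= exp (lam * Rabs s).
Proof.
  pose proof lam_pos as Hl.
  revert s q; induction n; intros s q Hs HS.
  - simpl; rewrite Rabs_R0; left; apply exp_pos.
  - simpl; unfold picard_step at 1.
    eapply Rle_trans; [apply (sint_exp_bound eps _ s q (4 * r * K) lam) |]; auto.
    + apply tame_rate, tame_picard_iter.
    + intros t Ht Ht'; eapply Rle_trans; [apply c_abs |].
      assert (1 <= exp (lam * Rabs t)).
      { apply exp_ge_1, Rmult_le_pos; [lra | apply Rabs_pos]. }
      replace (4 * r * K * exp (lam * Rabs t))
        with (2 * r * (2 * K * exp (lam * Rabs t))) by ring.
      apply (qint_bound eps); auto;
        [apply tame_F, tame_picard_iter | apply supported_F |].
      intros x _; eapply Rle_trans; [apply F_growth; lra |].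
      replace (2 * K * exp (lam * Rabs t)) with (K * (2 * exp (lam * Rabs t))) by ring.
      apply Rmult_le_compat_l; [exact HK |].
      pose proof (IHn t x Ht); lra.
    + rewrite <- (Rmult_1_l (exp (lam * Rabs s))) at 2.
      apply Rmult_le_compat_r; [left; apply exp_pos |].
      apply Rmult_le_reg_r with lam; [exact Hl |].
      unfold Rdiv; rewrite Rmult_assoc, Rinv_l by lra.
      unfold lam; lra.
Qed.

(** The $q$-integral costs 2r, the nonlinearity costs K, the weighted time integral gains 1/lam, and
    2rK/lam is at most 1/2. *)
Lemma picard_step_contracts X Y N :
  tame eps X -> tame eps Y ->
  (forall s q, - eps < s -> Rabs s <= S ->
    Rabs (X s q - Y s q) <= N * exp (lam * Rabs s)) ->
  forall s q, - eps < s -> Rabs s <= S ->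
    Rabs (picard_step X s q - picard_step Y s q) <= N * (1 / 2) * exp (lam * Rabs s).
Proof.
  intros HX HY HN s q Hs HS; pose proof lam_pos as Hl.
  assert (HN0 : 0 <= N).
  { apply Rmult_le_reg_r with (exp (lam * Rabs s)); [apply exp_pos |].
    rewrite Rmult_0_l; eapply Rle_trans; [apply Rabs_pos |].
    apply (HN s q); assumption. }
  unfold picard_step.
  rewrite <- (sint_minus eps) by (try apply tame_rate; assumption).
  eapply Rle_trans; [apply (sint_exp_bound eps _ s q (2 * r * K * N) lam) |]; auto.
  - apply (tame_minus eps); apply tame_rate; assumption.
  - intros t Ht Ht'; eapply Rle_trans; [apply c_lip |].
    rewrite <- (qint_minus eps) by (try apply tame_F; assumption).
    replace (2 * r * K * N * exp (lam * Rabs t))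
      with (2 * r * (K * (N * exp (lam * Rabs t)))) by ring.
    apply (qint_bound eps); auto.
    + apply (tame_minus eps); apply tame_F; assumption.
    + intros a b Ha Hb; rewrite !F_supp by assumption; ring.
    + intros x _; eapply Rle_trans; [apply F_lip_x; lra |].
      apply Rmult_le_compat_l; [exact HK | apply HN; lra].
  - apply Rmult_le_compat_r; [left; apply exp_pos |].
    apply Rmult_le_reg_r with lam; [exact Hl |].
    unfold Rdiv; rewrite Rmult_assoc, Rinv_l by lra.
    unfold lam.
    replace (N * (1 * / 2) * (4 * r * K + 1)) with (2 * r * K * N + N / 2) by field.
    lra.
Qed.

Lemma picard_iter_cauchy n k s q :
  - eps < s -> Rabs s <= S ->
  Rabs (picard_iter (n + k) s q - picard_iter n s q)
    <= (1 / 2) ^ n * exp (lam * Rabs s).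
Proof.
  revert s q; induction n; intros s q Hs HS.
  - simpl; rewrite Rminus_0_r, Rmult_1_l; apply picard_iter_bound; assumption.
  - simpl; rewrite (Rmult_comm (1 / 2)).
    apply picard_step_contracts; try apply tame_picard_iter; assumption.
Qed.

End Bounded_time.

Lemma picard_sol_is_lim s q :
  - eps < s -> is_lim_seq (fun n => picard_iter n s q) (picard_sol s q).
Proof.
  intros Hs; apply Lim_seq_correct', ex_lim_seq_cauchy_corr.
  destruct (F_lip (Rabs s)) as [K [HK HF]].
  intros e.
  assert (He : 0 < e / exp ((4 * r * K + 1) * Rabs s)).
  { apply Rdiv_lt_0_compat; [apply cond_pos | apply exp_pos]. }
  destruct (pow_lt_1_zero (1 / 2)) with (y := e / exp ((4 * r * K + 1) * Rabs s) / 2)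
    as [N HN]; [rewrite Rabs_right; lra | lra |].
  exists N.
  assert (Main : forall n, (N <= n)%nat ->
    Rabs (picard_iter n s q - picard_iter N s q) < e / 2).
  { intros n Hn; replace n with (N + (n - N))%nat by lia.
    eapply Rle_lt_trans; [apply (picard_iter_cauchy (Rabs s) K); auto; lra |].
    pose proof (HN N (Nat.le_refl N)) as H.
    rewrite Rabs_right in H by (apply Rle_ge, pow_le; lra).
    apply Rmult_lt_reg_r with (/ exp ((4 * r * K + 1) * Rabs s)).
    - apply Rinv_0_lt_compat, exp_pos.
    - rewrite Rmult_assoc, Rinv_r, Rmult_1_r by (apply Rgt_not_eq, exp_pos).
      unfold Rdiv in *; lra. }
  intros n m Hn Hm; pose proof (Main n Hn); pose proof (Main m Hm).
  replace (picard_iter n s q - picard_iter m s q)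
    with ((picard_iter n s q - picard_iter N s q)
      - (picard_iter m s q - picard_iter N s q)) by ring.
  unfold Rminus at 1; eapply Rle_lt_trans; [apply Rabs_triang |].
  rewrite Rabs_Ropp; lra.
Qed.

Lemma Rabs_is_lim_le u v l m B :
  is_lim_seq u (Finite l) -> is_lim_seq v (Finite m) ->
  (forall n : nat, Rabs (u n - v n) <= B) -> Rabs (l - m) <= B.
Proof.
  intros Hu Hv H.
  apply (is_lim_seq_le (fun n => Rabs (u n - v n)) (fun _ => B)
    (Finite (Rabs (l - m))) (Finite B) H); [| apply is_lim_seq_const].
  apply (is_lim_seq_abs _ (Finite (l - m))), is_lim_seq_minus'; assumption.
Qed.

(** The Lipschitz constants of the iterates must not depend on [n]. They are not inherited from the
    previous iterate: moving [s] or [q] moves an endpoint of one of the two integrals, so the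
    uniform sup bound on the integrand suffices. *)
Lemma tame_picard_sol : tame eps picard_sol.
Proof.
  intros S; destruct (F_lip (Rabs S)) as [K [HK HF]].
  set (lam := 4 * r * K + 1); set (B0 := exp (lam * Rabs S)).
  pose proof (exp_pos (lam * Rabs S)) as HB0; fold B0 in HB0.
  assert (Hl : 0 < lam) by exact (lam_pos K HK).
  pose proof (Rabs_pos S) as HS0.
  set (B1 := K * (1 + B0)).
  assert (HB1 : 0 <= B1) by (apply Rmult_le_pos; lra).
  set (B2 := 2 * r * B1).
  assert (HB2 : 0 <= B2) by (apply Rmult_le_pos; lra).
  assert (HB3 : 0 <= Rabs S * B1) by (apply Rmult_le_pos; lra).
  assert (Hb : forall n s q, - eps < s -> Rabs s <= Rabs S ->
    Rabs (picard_iter n s q) <= B0).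
  { intros n s q Hs HS.
    eapply Rle_trans; [apply (picard_iter_bound (Rabs S) K); assumption |].
    apply exp_le, Rmult_le_compat_l; fold lam; lra. }
  exists (B0 + B2 + Rabs S * B1); split; [lra |].
  assert (Main : forall n, tame_on eps (Rabs S) (B0 + B2 + Rabs S * B1) (picard_iter n)).
  { intros n s s' q q' h1 h2 h3 h4.
    pose proof (Rabs_pos (s - s')) as Ps; pose proof (Rabs_pos (q - q')) as Pq.
    assert (P1 : 0 <= (B0 + B2 + Rabs S * B1) * (Rabs (s - s') + Rabs (q - q'))).
    { apply Rmult_le_pos; lra. }
    split; [pose proof (Hb n s q h1 h3); lra |].
    destruct n; [simpl; rewrite Rminus_0_r, Rabs_R0; exact P1 |].
    pose proof (tame_picard_iter n) as Tn.
    pose proof (tame_rate _ Tn) as Tr.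
    assert (HFb : forall t x, - eps < t -> Rabs t <= Rabs S ->
      Rabs (F t x (picard_iter n t x)) <= B1).
    { intros t x Ht HtS; eapply Rle_trans; [apply (F_growth (Rabs S) K); auto |].
      apply Rmult_le_compat_l; [exact HK |]; pose proof (Hb n t x Ht HtS); lra. }
    simpl; unfold picard_step.
    set (Z := fun s q => c (qint r (fun s q => F s q (picard_iter n s q)) s q)).
    change (tame eps Z) in Tr.
    replace (sint Z s q - sint Z s' q')
      with ((sint Z s q - sint Z s' q) + (sint Z s' q - sint Z s' q')) by ring.
    eapply Rle_trans; [apply Rabs_triang |].
    assert (E1 : Rabs (sint Z s q - sint Z s' q) <= B2 * Rabs (s - s')).
    { apply (sint_diff_s eps); auto.
      intros t Ht Ht'; unfold Z; eapply Rle_trans; [apply c_abs |].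
      unfold B2; apply (qint_bound eps); auto;
        [apply tame_F, Tn | apply supported_F |].
      intros x _; apply HFb; [exact Ht |].
      eapply Rle_trans; [apply Ht' | apply Rmax_lub; assumption]. }
    assert (E2 : Rabs (sint Z s' q - sint Z s' q') <= Rabs S * B1 * Rabs (q - q')).
    { unfold sint; rewrite <- RInt_sub by (apply (tame_ex_RInt_s eps); assumption).
      apply Rle_trans with (B1 * Rabs (q - q') * Rabs (s' - 0)).
      - apply RInt_bound_const.
        + apply (ex_RInt_minus (fun t => Z t q) (fun t => Z t q'));
            apply (tame_ex_RInt_s eps); assumption.
        + intros t Ht; destruct (between_0 eps Heps s' t h2 Ht) as [t1 t2].
          unfold Z; eapply Rle_trans; [apply c_lip |].
          unfold qint.
          rewrite (RInt_split (fun x => F t x (picard_iter n t x)) q q' r)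
            by (apply (tame_ex_RInt_q eps (fun s q => F s q (picard_iter n s q)));
                try apply tame_F; assumption).
          rewrite Rplus_minus_r, (Rabs_minus_sym q q').
          apply RInt_bound_const.
          * apply (tame_ex_RInt_q eps (fun s q => F s q (picard_iter n s q)));
              try apply tame_F; assumption.
          * intros x _; apply HFb; lra.
      - rewrite Rminus_0_r.
        replace (Rabs S * B1 * Rabs (q - q')) with (B1 * Rabs (q - q') * Rabs S) by ring.
        apply Rmult_le_compat_l; [apply Rmult_le_pos; assumption | exact h4]. }
    assert (0 <= B0 * Rabs (s - s')) by (apply Rmult_le_pos; lra).
    assert (0 <= B0 * Rabs (q - q')) by (apply Rmult_le_pos; lra).
    assert (0 <= B2 * Rabs (q - q')) by (apply Rmult_le_pos; lra).
    assert (0 <= Rabs S * B1 * Rabs (s - s')) by (apply Rmult_le_pos; lra).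
    lra. }
  intros s s' q q' h1 h2 h3 h4; pose proof (Rle_abs S).
  split.
  - replace (picard_sol s q) with (picard_sol s q - 0) by ring.
    apply (Rabs_is_lim_le (fun n => picard_iter n s q) (fun _ => 0));
      [apply picard_sol_is_lim, h1 | apply is_lim_seq_const |].
    intros n; rewrite Rminus_0_r; apply (Main n s s q q); lra.
  - apply (Rabs_is_lim_le (fun n => picard_iter n s q) (fun n => picard_iter n s' q'));
      [apply picard_sol_is_lim, h1 | apply picard_sol_is_lim, h2 |].
    intros n; apply (Main n s s' q q'); lra.
Qed.

(** Both sides are compared with iterate n+1: the left by convergence, the right by the contraction
    applied to the distance from iterate n. *)
Lemma picard_sol_fixed s q : - eps < s -> picard_sol s q = picard_step picard_sol s q.
Proof.
  intros Hs; destruct (F_lip (Rabs s)) as [K [HK HF]].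
  set (lam := 4 * r * K + 1).
  assert (Hc : forall n t x, - eps < t -> Rabs t <= Rabs s ->
    Rabs (picard_sol t x - picard_iter n t x) <= (1 / 2) ^ n * exp (lam * Rabs t)).
  { intros n t x Ht Ht'.
    apply (Rabs_is_lim_le (fun k => picard_iter (n + k) t x)
      (fun _ => picard_iter n t x)); [| apply is_lim_seq_const |].
    - pose proof (picard_sol_is_lim t x Ht) as H.
      apply (is_lim_seq_incr_n _ n) in H.
      apply (is_lim_seq_ext (fun k => picard_iter (k + n) t x)); [| exact H].
      intros k; rewrite Nat.add_comm; reflexivity.
    - intros k; apply (picard_iter_cauchy (Rabs s) K); assumption. }
  apply Rminus_diag_uniq.
  assert (Rabs (picard_sol s q - picard_step picard_sol s q) <= 0).
  { apply (le_of_half_pow _ (2 * exp (lam * Rabs s))); intros n.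
    replace (picard_sol s q - picard_step picard_sol s q)
      with ((picard_sol s q - picard_iter (Datatypes.S n) s q)
        - (picard_step picard_sol s q - picard_iter (Datatypes.S n) s q)) by ring.
    unfold Rminus at 1; eapply Rle_trans; [apply Rabs_triang |]; rewrite Rabs_Ropp.
    pose proof (Hc (Datatypes.S n) s q Hs (Rle_refl _)) as H1.
    pose proof (picard_step_contracts (Rabs s) K HK HF picard_sol (picard_iter n)
      ((1 / 2) ^ n) tame_picard_sol (tame_picard_iter n) (Hc n) s q Hs (Rle_refl _)) as H2.
    change (picard_step (picard_iter n)) with (picard_iter (Datatypes.S n)) in H2.
    fold lam in H2.
    simpl pow in H1.
    assert (0 <= (1 / 2) ^ n * exp (lam * Rabs s)).
    { apply Rmult_le_pos; [apply pow_le; lra | left; apply exp_pos]. }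
    lra. }
  pose proof (Rabs_pos (picard_sol s q - picard_step picard_sol s q)).
  destruct (Req_dec (picard_sol s q - picard_step picard_sol s q) 0) as [E | E];
    [exact E | apply Rabs_pos_lt in E; lra].
Qed.

End Picard.

(** * Exponentially weighted domination *)

(* [edom P w d g]: on [P], [g = O(d)] up to a factor exponential in the weight
   [w]; [g] ranges over functions on any index type, so that values, increments
   and Taylor remainders are all handled by the same calculus. *)
Definition edom {T : Type} (P : T -> Prop) (w d g : T -> R) : Prop :=
  exists C, 0 <= C /\ forall t, P t ->
    0 <= w t /\ 0 <= d t /\ Rabs (g t) <= C * exp (C * w t) * d t.

Lemma Cexp_le C D x : 0 <= C -> C <= D -> 0 <= x -> C * exp (C * x) <= D * exp (D * x).
Proof.
  intros HC HD Hx; apply Rmult_le_compat; [exact HC | left; apply exp_pos | exact HD |].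
  apply exp_le, Rmult_le_compat_r; assumption.
Qed.

Lemma Cexp_pos C x : 0 <= C -> 0 <= C * exp (C * x).
Proof. intros; apply Rmult_le_pos; [assumption | left; apply exp_pos]. Qed.

Lemma le_Cexp C x : 0 <= C -> 0 <= x -> C <= C * exp (C * x).
Proof.
  intros HC Hx; rewrite <- (Rmult_1_r C) at 1; apply Rmult_le_compat_l; [exact HC |].
  apply exp_ge_1, Rmult_le_pos; assumption.
Qed.

Section Edom.

Context {T : Type}.
Implicit Types (P : T -> Prop) (w d g : T -> R).

Lemma edom_le P w d d' g g' :
  edom P w d g -> (forall t, P t -> Rabs (g' t) <= Rabs (g t) /\ d t <= d' t) ->
  edom P w d' g'.
Proof.
  intros [C [HC H]] Hg; exists C; split; [exact HC |]; intros t Ht.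
  destruct (H t Ht) as [a [b e]]; destruct (Hg t Ht) as [h1 h2].
  repeat split; [exact a | lra |].
  eapply Rle_trans; [apply h1 |]; eapply Rle_trans; [apply e |].
  apply Rmult_le_compat_l; [apply Cexp_pos, HC | exact h2].
Qed.

Lemma edom_ext P w d g g' :
  edom P w d g -> (forall t, P t -> g' t = g t) -> edom P w d g'.
Proof.
  intros H E; apply (edom_le P w d d g g' H); intros t Ht.
  rewrite (E t Ht); split; apply Rle_refl.
Qed.

Lemma edom_plus P w d g g' :
  edom P w d g -> edom P w d g' -> edom P w d (fun t => g t + g' t).
Proof.
  intros [C [HC H]] [D [HD H']]; exists (C + D); split; [lra |]; intros t Ht.
  destruct (H t Ht) as [a [b e]]; destruct (H' t Ht) as [_ [_ e']].
  repeat split; [exact a | exact b |].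
  eapply Rle_trans; [apply Rabs_triang |].
  rewrite (Rmult_plus_distr_r C), Rmult_plus_distr_r.
  apply Rplus_le_compat.
  - eapply Rle_trans; [apply e |]; apply Rmult_le_compat_r; [exact b |].
    apply Rmult_le_compat_l; [exact HC |]; apply exp_le.
    apply Rmult_le_compat_r; lra.
  - eapply Rle_trans; [apply e' |]; apply Rmult_le_compat_r; [exact b |].
    apply Rmult_le_compat_l; [exact HD |]; apply exp_le.
    apply Rmult_le_compat_r; lra.
Qed.

Lemma edom_mult P w d d' g g' :
  edom P w d g -> edom P w d' g' ->
  edom P w (fun t => d t * d' t) (fun t => g t * g' t).
Proof.
  intros [C [HC H]] [D [HD H']].
  pose proof (Rmult_le_pos C D HC HD) as HCD.
  exists (C * D + C + D); split; [lra |]; intros t Ht.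
  destruct (H t Ht) as [a [b e]]; destruct (H' t Ht) as [_ [b' e']].
  repeat split; [exact a | apply Rmult_le_pos; assumption |].
  rewrite Rabs_mult.
  apply Rle_trans with (C * exp (C * w t) * d t * (D * exp (D * w t) * d' t)).
  { apply Rmult_le_compat; try apply Rabs_pos; assumption. }
  replace (C * exp (C * w t) * d t * (D * exp (D * w t) * d' t))
    with (C * D * (exp (C * w t) * exp (D * w t)) * (d t * d' t)) by ring.
  apply Rmult_le_compat_r; [apply Rmult_le_pos; assumption |].
  rewrite <- exp_plus; apply Rmult_le_compat;
    [lra | left; apply exp_pos | lra |].
  apply exp_le; rewrite <- Rmult_plus_distr_r; apply Rmult_le_compat_r; lra.
Qed.

Lemma edom_scal P w d g k : edom P w d g -> edom P w d (fun t => k * g t).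
Proof.
  intros [C [HC H]]; pose proof (Rabs_pos k) as Hk.
  exists ((Rabs k + 1) * C); split; [apply Rmult_le_pos; lra |]; intros t Ht.
  destruct (H t Ht) as [a [b e]]; repeat split; [exact a | exact b |].
  rewrite Rabs_mult.
  assert (HkC : 0 <= Rabs k * C) by (apply Rmult_le_pos; lra).
  apply Rle_trans with (Rabs k * (C * exp (C * w t) * d t)).
  { apply Rmult_le_compat_l; assumption. }
  rewrite <- !Rmult_assoc; apply Rmult_le_compat_r; [exact b |].
  apply Rmult_le_compat; [lra | left; apply exp_pos | lra |].
  apply exp_le, Rmult_le_compat_r; lra.
Qed.

Lemma edom_const P w k : (forall t, P t -> 0 <= w t) -> edom P w (fun _ => 1) (fun _ => k).
Proof.
  intros H; exists (Rabs k); split; [apply Rabs_pos |]; intros t Ht.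
  pose proof (H t Ht) as Hw; repeat split; [exact Hw | lra |].
  rewrite Rmult_1_r; apply le_Cexp; [apply Rabs_pos | exact Hw].
Qed.

Lemma edom_abs P w d g : edom P w d g -> edom P w d (fun t => Rabs (g t)).
Proof.
  intros H; apply (edom_le _ _ _ _ _ _ H); intros t _.
  rewrite Rabs_Rabsolu; split; apply Rle_refl.
Qed.

Lemma edom_unit P w d g : edom P w (fun t => 1 * d t) g -> edom P w d g.
Proof.
  intros H; apply (edom_le _ _ _ _ _ _ H); intros t _.
  rewrite Rmult_1_l; split; apply Rle_refl.
Qed.

Lemma edom_unit_r P w d g : edom P w (fun t => d t * 1) g -> edom P w d g.
Proof.
  intros H; apply (edom_le _ _ _ _ _ _ H); intros t _.
  rewrite Rmult_1_r; split; apply Rle_refl.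
Qed.

Lemma edom_pull {T' : Type} P w d g (P' : T' -> Prop) (w' : T' -> R) (phi : T' -> T) :
  edom P w d g ->
  (forall t, P' t -> P (phi t) /\ 0 <= w' t /\ w (phi t) <= 2 * w' t) ->
  edom P' w' (fun t => d (phi t)) (fun t => g (phi t)).
Proof.
  intros [C [HC H]] Hphi; exists (2 * C); split; [lra |]; intros t Ht.
  destruct (Hphi t Ht) as [p [a1 a2]]; destruct (H _ p) as [a [b e]].
  repeat split; [exact a1 | exact b |].
  eapply Rle_trans; [apply e |]; apply Rmult_le_compat_r; [exact b |].
  apply Rmult_le_compat; [exact HC | left; apply exp_pos | lra |].
  apply exp_le; replace (2 * C * w' t) with (C * (2 * w' t)) by ring.
  apply Rmult_le_compat_l; assumption.
Qed.

End Edom.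

(** Mean value inequality with the maximum of the two exponentials replaced by their sum, because
    the sum can be integrated in q term by term with the mass bound. *)
Lemma exp_diff_bound a b : Rabs (exp a - exp b) <= (exp a + exp b) * Rabs (a - b).
Proof.
  assert (Main : forall x y, y <= x -> Rabs (exp x - exp y) <= (exp x + exp y) * Rabs (x - y)).
  { intros x y H; rewrite !Rabs_right; try (apply Rle_ge; pose proof (exp_le _ _ H); lra).
    pose proof (exp_ineq1_le (y - x)) as E.
    assert (E2 : exp y = exp x * exp (y - x)) by (rewrite <- exp_plus; f_equal; ring).
    pose proof (exp_pos x); pose proof (exp_pos y).
    assert (exp x * (1 + (y - x)) <= exp x * exp (y - x))
      by (apply Rmult_le_compat_l; lra).
    assert (0 <= exp y * (x - y)) by (apply Rmult_le_pos; lra).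
    lra. }
  destruct (Rle_dec b a); [apply Main; assumption |].
  rewrite Rabs_minus_sym, (Rabs_minus_sym a), Rplus_comm; apply Main; lra.
Qed.

Lemma exp_taylor2_bound a b :
  Rabs (exp a - exp b - exp b * (a - b)) <= (exp a + exp b) * (a - b) ^ 2.
Proof.
  assert (E : 0 <= exp a - exp b - exp b * (a - b)).
  { pose proof (exp_ineq1_le (a - b)) as H.
    assert (E2 : exp a = exp b * exp (a - b)) by (rewrite <- exp_plus; f_equal; ring).
    rewrite E2; pose proof (exp_pos b).
    assert (exp b * (1 + (a - b)) <= exp b * exp (a - b))
      by (apply Rmult_le_compat_l; lra).
    lra. }
  rewrite Rabs_right by lra.
  (* by convexity, e^a - e^b <= e^a (a - b), so the remainder is at most
     (e^a - e^b) (a - b) *)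
  assert (H1 : exp a - exp b <= exp a * (a - b)).
  { pose proof (exp_ineq1_le (b - a)) as H.
    assert (E2 : exp b = exp a * exp (b - a)) by (rewrite <- exp_plus; f_equal; ring).
    pose proof (exp_pos a).
    assert (exp a * (1 + (b - a)) <= exp a * exp (b - a))
      by (apply Rmult_le_compat_l; lra).
    lra. }
  apply Rle_trans with (Rabs ((exp a - exp b) * (a - b))).
  - eapply Rle_trans; [| apply Rle_abs].
    replace ((exp a - exp b) * (a - b))
      with (exp a * (a - b) - exp b * (a - b)) by ring; lra.
  - rewrite Rabs_mult, <- (pow2_abs (a - b)).
    replace ((exp a + exp b) * Rabs (a - b) ^ 2)
      with ((exp a + exp b) * Rabs (a - b) * Rabs (a - b)) by ring.
    apply Rmult_le_compat_r; [apply Rabs_pos | apply exp_diff_bound].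
Qed.

(** * Functions whose derivatives grow at most exponentially *)

Section Exp_smooth.

Variable eps : R.

Definition at3 (f : R -> R -> R -> R) (p : R * R * R) : R :=
  f (fst (fst p)) (snd (fst p)) (snd p).

Definition admissible (p : R * R * R) : Prop := - eps < fst (fst p).

Definition age (p : R * R * R) : R := Rabs (fst (fst p)).

Definition dist3 (x : (R * R * R) * (R * R * R)) : R :=
  Rabs (fst (fst (fst x)) - fst (fst (snd x)))
  + Rabs (snd (fst (fst x)) - snd (fst (snd x)))
  + Rabs (snd (fst x) - snd (snd x)).

Definition admissible2 (x : (R * R * R) * (R * R * R)) : Prop :=
  admissible (fst x) /\ admissible (snd x).

Definition age2 (x : (R * R * R) * (R * R * R)) : R := age (fst x) + age (snd x).

Definition exp_bounded (f : R -> R -> R -> R) : Prop :=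
  edom admissible age (fun _ => 1) (at3 f).

Definition exp_lip (f : R -> R -> R -> R) : Prop :=
  exp_bounded f /\
  edom admissible2 age2 dist3 (fun x => at3 f (fst x) - at3 f (snd x)).

(* The Lipschitz bounds make all remainders under integral signs quadratic, so
   that no compactness in [q] or the angle is needed. *)
Fixpoint exp_smooth (n : nat) (f : R -> R -> R -> R) : Prop :=
  exp_lip f /\
  match n with
  | O => True
  | S n' => exists f1 f2 f3 : R -> R -> R -> R,
      (forall s q t, - eps < s ->
        is_derive (fun s => f s q t) s (f1 s q t) /\
        is_derive (fun q => f s q t) q (f2 s q t) /\
        is_derive (fun t => f s q t) t (f3 s q t)) /\
      exp_smooth n' f1 /\ exp_smooth n' f2 /\ exp_smooth n' f3
  end.

Lemma age_pos p : 0 <= age p.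
Proof. apply Rabs_pos. Qed.

Lemma dist3_pos x : 0 <= dist3 x.
Proof.
  unfold dist3; repeat apply Rplus_le_le_0_compat; apply Rabs_pos.
Qed.

Lemma exp_bounded_left f :
  exp_bounded f -> edom admissible2 age2 (fun _ => 1) (fun x => at3 f (fst x)).
Proof.
  intros H; apply (edom_pull admissible age (fun _ => 1) (at3 f) _ _ fst H).
  intros x [h1 h2]; pose proof (age_pos (fst x)); pose proof (age_pos (snd x)).
  unfold age2; split; [exact h1 | lra].
Qed.

Lemma exp_bounded_right f :
  exp_bounded f -> edom admissible2 age2 (fun _ => 1) (fun x => at3 f (snd x)).
Proof.
  intros H; apply (edom_pull admissible age (fun _ => 1) (at3 f) _ _ snd H).
  intros x [h1 h2]; pose proof (age_pos (fst x)); pose proof (age_pos (snd x)).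
  unfold age2; split; [exact h2 | lra].
Qed.

Lemma exp_bounded_mult f g :
  exp_bounded f -> exp_bounded g -> exp_bounded (fun s q t => f s q t * g s q t).
Proof.
  intros Hf Hg; apply (edom_unit admissible age (fun _ => 1)).
  exact (edom_mult _ _ _ _ _ _ Hf Hg).
Qed.

Lemma exp_lip_plus f g :
  exp_lip f -> exp_lip g -> exp_lip (fun s q t => f s q t + g s q t).
Proof.
  intros [f1 f2] [g1 g2]; split; [exact (edom_plus _ _ _ _ _ f1 g1) |].
  apply (edom_ext _ _ _ _ _ (edom_plus _ _ _ _ _ f2 g2)).
  intros x _; unfold at3; ring.
Qed.

Lemma exp_lip_mult f g :
  exp_lip f -> exp_lip g -> exp_lip (fun s q t => f s q t * g s q t).
Proof.
  intros [f1 f2] [g1 g2]; split; [apply exp_bounded_mult; assumption |].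
  apply (edom_ext _ _ _ (fun x => at3 f (fst x) * (at3 g (fst x) - at3 g (snd x))
    + at3 g (snd x) * (at3 f (fst x) - at3 f (snd x)))).
  - apply edom_plus; apply edom_unit; apply edom_mult; try assumption.
    + apply exp_bounded_left; exact f1.
    + apply exp_bounded_right; exact g1.
  - intros x _; unfold at3; ring.
Qed.

Lemma exp_lip_const k : exp_lip (fun _ _ _ => k).
Proof.
  split.
  - apply edom_const; intros; apply age_pos.
  - exists 0; split; [lra |]; intros x _; repeat split.
    + unfold age2; pose proof (age_pos (fst x)); pose proof (age_pos (snd x)); lra.
    + apply dist3_pos.
    + unfold at3; rewrite Rminus_diag, Rabs_R0; lra.
Qed.

Lemma exp_lip_ext f g :
  (forall s q t, - eps < s -> g s q t = f s q t) -> exp_lip f -> exp_lip g.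
Proof.
  intros E [f1 f2]; split.
  - apply (edom_ext _ _ _ _ _ f1); intros p Hp; apply E, Hp.
  - apply (edom_ext _ _ _ _ _ f2); intros x [Hx Hy]; unfold at3.
    rewrite !E by assumption; reflexivity.
Qed.

(** A bound on [f] alone would make exp(f) doubly exponential, so the bound on exp(f) is a
    hypothesis of its own; for the potential it comes from linear growth of V in s. *)
Lemma exp_lip_exp f :
  exp_bounded (fun s q t => exp (f s q t)) -> exp_lip f ->
  exp_lip (fun s q t => exp (f s q t)).
Proof.
  intros He [f1 f2]; split; [exact He |].
  apply (edom_le _ _ dist3 _ (fun x => (exp (at3 f (fst x)) + exp (at3 f (snd x)))
    * (at3 f (fst x) - at3 f (snd x)))).
  - apply edom_unit, edom_mult; [| exact f2].
    apply edom_plus; [exact (exp_bounded_left _ He) | exact (exp_bounded_right _ He)].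
  - intros x _; split; [| apply Rle_refl].
    rewrite Rabs_mult, (Rabs_right (_ + _)); [apply exp_diff_bound |].
    pose proof (exp_pos (at3 f (fst x))); pose proof (exp_pos (at3 f (snd x))); lra.
Qed.

Lemma exp_lip_bounds f :
  exp_lip f -> exists C, 0 <= C /\ forall s q t s' q' t', - eps < s -> - eps < s' ->
    Rabs (f s q t) <= C * exp (C * Rabs s) /\
    Rabs (f s q t - f s' q' t') <= C * exp (C * (Rabs s + Rabs s'))
      * (Rabs (s - s') + Rabs (q - q') + Rabs (t - t')).
Proof.
  intros [[C [HC H1]] [D [HD H2]]]; exists (C + D); split; [lra |].
  intros s q t s' q' t' Hs Hs'.
  destruct (H1 (s, q, t) Hs) as [_ [_ a]].
  destruct (H2 ((s, q, t), (s', q', t')) (conj Hs Hs')) as [_ [e b]].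
  pose proof (Rabs_pos s); pose proof (Rabs_pos s').
  split.
  - eapply Rle_trans; [apply a |]; rewrite Rmult_1_r; apply Cexp_le; unfold age; lra.
  - eapply Rle_trans; [apply b |]; apply Rmult_le_compat_r; [exact e |].
    apply Cexp_le; try lra; unfold age2, age; simpl; lra.
Qed.

(** One variable is moved at a time: first [s], then [q] and the angle at the fixed time [s']. Only
    the first increment involves two different times in its weight. *)
Lemma exp_lip_intro f :
  (exists C, 0 <= C /\ forall s q t, - eps < s -> Rabs (f s q t) <= C * exp (C * Rabs s)) ->
  (exists C, 0 <= C /\ forall s s' q t, - eps < s -> - eps < s' ->
    Rabs (f s q t - f s' q t) <= C * exp (C * (Rabs s + Rabs s')) * Rabs (s - s')) ->
  (exists C, 0 <= C /\ forall s q q' t, - eps < s ->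
    Rabs (f s q t - f s q' t) <= C * exp (C * Rabs s) * Rabs (q - q')) ->
  (exists C, 0 <= C /\ forall s q t t', - eps < s ->
    Rabs (f s q t - f s q t') <= C * exp (C * Rabs s) * Rabs (t - t')) ->
  exp_lip f.
Proof.
  intros [C0 [P0 H0]] [C1 [P1 H1]] [C2 [P2 H2]] [C3 [P3 H3]]; split.
  - exists C0; split; [exact P0 |]; intros [[s q] t] Hs.
    rewrite Rmult_1_r; split; [apply age_pos | split; [lra |]].
    apply H0, Hs.
  - exists (C1 + C2 + C3); split; [lra |].
    intros [[[s q] t] [[s' q'] t']] [Hs Hs'].
    unfold age2, dist3, at3, age; unfold admissible in Hs, Hs'; simpl in *.
    pose proof (Rabs_pos s) as A1; pose proof (Rabs_pos s') as A2.
    pose proof (Rabs_pos (s - s')) as A3; pose proof (Rabs_pos (q - q')) as A4.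
    pose proof (Rabs_pos (t - t')) as A5.
    split; [lra | split; [lra |]].
    set (E := (C1 + C2 + C3) * exp ((C1 + C2 + C3) * (Rabs s + Rabs s'))).
    assert (B : forall C x, 0 <= C <= C1 + C2 + C3 -> 0 <= x <= Rabs s + Rabs s' ->
      forall y, 0 <= y -> C * exp (C * x) * y <= E * y).
    { intros C x HC Hx y Hy; apply Rmult_le_compat_r; [exact Hy |].
      eapply Rle_trans; [apply (Cexp_le C (C1 + C2 + C3)); lra |].
      unfold E; apply Rmult_le_compat_l; [lra |].
      apply exp_le, Rmult_le_compat_l; lra. }
    replace (f s q t - f s' q' t') with ((f s q t - f s' q t)
      + (f s' q t - f s' q' t) + (f s' q' t - f s' q' t')) by ring.
    eapply Rle_trans; [apply Rabs_triang |].
    eapply Rle_trans; [apply Rplus_le_compat_r, Rabs_triang |].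
    rewrite !Rmult_plus_distr_l; repeat apply Rplus_le_compat.
    + eapply Rle_trans; [apply H1; assumption | apply B; lra].
    + eapply Rle_trans; [apply H2; assumption | apply B; lra].
    + eapply Rle_trans; [apply H3; assumption | apply B; lra].
Qed.

Lemma exp_smooth_lip n f : exp_smooth n f -> exp_lip f.
Proof. destruct n; intros H; apply H. Qed.

Lemma exp_smooth_pred n f : exp_smooth (S n) f -> exp_smooth n f.
Proof.
  revert f; induction n; intros f [H0 [f1 [f2 [f3 [Hd [H1 [H2 H3]]]]]]].
  - split; [exact H0 | exact I].
  - split; [exact H0 |]; exists f1, f2, f3; auto.
Qed.

Lemma locally_future s : - eps < s -> locally s (fun s' => - eps < s').
Proof. intros Hs; apply (open_gt (- eps) s Hs). Qed.

Lemma exp_smooth_ext n f g :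
  (forall s q t, - eps < s -> g s q t = f s q t) -> exp_smooth n f -> exp_smooth n g.
Proof.
  intros E; destruct n; intros [H0 H]; (split; [exact (exp_lip_ext f g E H0) |]).
  - exact I.
  - destruct H as [f1 [f2 [f3 [Hd H]]]]; exists f1, f2, f3; split; [| exact H].
    intros s q t Hs; destruct (Hd s q t Hs) as [a [b c]]; split; [| split].
    + refine (is_derive_ext_loc (fun s => f s q t) (fun s => g s q t) s _ _ a).
      apply (filter_imp (fun s' => - eps < s')); [| exact (locally_future s Hs)].
      intros; symmetry; apply E; assumption.
    + apply (is_derive_ext (fun q => f s q t) (fun q => g s q t)); [| exact b].
      intros; symmetry; apply E; assumption.
    + apply (is_derive_ext (fun t => f s q t) (fun t => g s q t)); [| exact c].
      intros; symmetry; apply E; assumption.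
Qed.

Lemma exp_smooth_plus n f g :
  exp_smooth n f -> exp_smooth n g -> exp_smooth n (fun s q t => f s q t + g s q t).
Proof.
  revert f g; induction n; intros f g [f0 Hf] [g0 Hg];
    (split; [exact (exp_lip_plus f g f0 g0) |]); [exact I |].
  destruct Hf as [f1 [f2 [f3 [Df [F1 [F2 F3]]]]]].
  destruct Hg as [g1 [g2 [g3 [Dg [G1 [G2 G3]]]]]].
  exists (fun s q t => f1 s q t + g1 s q t), (fun s q t => f2 s q t + g2 s q t),
    (fun s q t => f3 s q t + g3 s q t).
  split; [| repeat split; apply IHn; assumption].
  intros s q t Hs; destruct (Df s q t Hs) as [a1 [a2 a3]]; destruct (Dg s q t Hs) as [b1 [b2 b3]].
  split; [| split].
  - apply (is_derive_plus (fun s => f s q t) (fun s => g s q t)); assumption.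
  - apply (is_derive_plus (fun q => f s q t) (fun q => g s q t)); assumption.
  - apply (is_derive_plus (fun t => f s q t) (fun t => g s q t)); assumption.
Qed.

Lemma is_derive_prod (u v : R -> R) x u' v' :
  is_derive u x u' -> is_derive v x v' ->
  is_derive (fun x => u x * v x) x (u' * v x + u x * v').
Proof.
  intros Hu Hv; apply (is_derive_mult u v x u' v' Hu Hv); intros; apply Rmult_comm.
Qed.

Lemma exp_smooth_mult n f g :
  exp_smooth n f -> exp_smooth n g -> exp_smooth n (fun s q t => f s q t * g s q t).
Proof.
  revert f g; induction n; intros f g Hf Hg;
    (split; [apply exp_lip_mult; [apply Hf | apply Hg] |]); [exact I |].
  pose proof (exp_smooth_pred n f Hf) as Pf; pose proof (exp_smooth_pred n g Hg) as Pg.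
  destruct Hf as [f0 [f1 [f2 [f3 [Df [F1 [F2 F3]]]]]]].
  destruct Hg as [g0 [g1 [g2 [g3 [Dg [G1 [G2 G3]]]]]]].
  exists (fun s q t => f1 s q t * g s q t + f s q t * g1 s q t),
    (fun s q t => f2 s q t * g s q t + f s q t * g2 s q t),
    (fun s q t => f3 s q t * g s q t + f s q t * g3 s q t).
  split; [| repeat split; apply exp_smooth_plus; apply IHn; assumption].
  intros s q t Hs.
  destruct (Df s q t Hs) as [a1 [a2 a3]]; destruct (Dg s q t Hs) as [b1 [b2 b3]].
  split; [| split].
  - apply (is_derive_prod (fun s => f s q t) (fun s => g s q t)); assumption.
  - apply (is_derive_prod (fun q => f s q t) (fun q => g s q t)); assumption.
  - apply (is_derive_prod (fun t => f s q t) (fun t => g s q t)); assumption.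
Qed.

Lemma exp_smooth_const n k : exp_smooth n (fun _ _ _ => k).
Proof.
  revert k; induction n; intros k; (split; [apply exp_lip_const |]); [exact I |].
  exists (fun _ _ _ => 0), (fun _ _ _ => 0), (fun _ _ _ => 0).
  split; [| repeat split; apply IHn].
  intros s q t Hs; split; [| split]; apply (is_derive_const (V := R_NormedModule) k).
Qed.

Lemma exp_smooth_exp n f :
  exp_bounded (fun s q t => exp (f s q t)) -> exp_smooth n f ->
  exp_smooth n (fun s q t => exp (f s q t)).
Proof.
  intros Hb; revert Hb; induction n; intros Hb Hf;
    (split; [apply exp_lip_exp; [exact Hb | apply Hf] |]); [exact I |].
  pose proof (IHn Hb (exp_smooth_pred n f Hf)) as He.
  destruct Hf as [f0 [f1 [f2 [f3 [Df [F1 [F2 F3]]]]]]].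
  exists (fun s q t => f1 s q t * exp (f s q t)), (fun s q t => f2 s q t * exp (f s q t)),
    (fun s q t => f3 s q t * exp (f s q t)).
  split; [| repeat split; apply exp_smooth_mult; assumption].
  assert (D : forall (u : R -> R) x u', is_derive u x u' ->
    is_derive (fun x => exp (u x)) x (u' * exp (u x))).
  { intros u x u' Hu; apply (is_derive_comp exp u x (exp (u x)) u'); [| exact Hu].
    apply is_derive_Reals, derivable_pt_lim_exp. }
  intros s q t Hs; destruct (Df s q t Hs) as [a1 [a2 a3]]; split; [| split].
  - apply (D (fun s => f s q t)), a1.
  - apply (D (fun q => f s q t)), a2.
  - apply (D (fun t => f s q t)), a3.
Qed.

Lemma exp_lip_tame f t : exp_lip f -> tame eps (fun s q => f s q t).
Proof.
  intros Hf S; destruct (exp_lip_bounds f Hf) as [C [HC H]].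
  exists (C * exp (C * (2 * Rabs S))); split; [apply Cexp_pos, HC |].
  intros s s' q q' h1 h2 h3 h4; pose proof (Rle_abs S); pose proof (Rabs_pos S).
  destruct (H s q t s' q' t h1 h2) as [a b].
  rewrite Rminus_diag, Rabs_R0, Rplus_0_r in b; split.
  - eapply Rle_trans; [apply a |]; apply Rmult_le_compat_l; [exact HC |].
    apply exp_le, Rmult_le_compat_l; lra.
  - eapply Rle_trans; [apply b |]; apply Rmult_le_compat_r.
    + pose proof (Rabs_pos (s - s')); pose proof (Rabs_pos (q - q')); lra.
    + apply Rmult_le_compat_l; [exact HC |]; apply exp_le, Rmult_le_compat_l; lra.
Qed.

End Exp_smooth.

(** By the mean value theorem the remainder is h(u'(c) - u'(x)) with c between x and x + h. The
    hypothesis concerns only points within |h| of [x], so it can be met near the end -eps of the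
    time interval. *)
Lemma quadratic_of_lipschitz_derive (u u' : R -> R) x h B :
  (forall y, Rabs (y - x) <= Rabs h ->
    is_derive u y (u' y) /\ Rabs (u' y - u' x) <= B * Rabs (y - x)) ->
  Rabs (u (x + h) - u x - h * u' x) <= B * h ^ 2.
Proof.
  intros H.
  assert (Hin : forall y, Rmin x (x + h) <= y <= Rmax x (x + h) ->
    Rabs (y - x) <= Rabs h).
  { intros y; unfold Rmin, Rmax; destruct (Rle_dec x (x + h)); intros Hy.
    - rewrite !Rabs_right; lra.
    - rewrite !Rabs_left1; lra. }
  destruct (MVT_gen u x (x + h) u') as [c [Hc E]].
  - intros y Hy; apply H, Hin; lra.
  - intros y Hy; apply continuity_pt_filterlim.
    apply (ex_derive_continuous u); exists (u' y); apply H, Hin, Hy.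
  - rewrite E; replace (u' c * (x + h - x) - h * u' x) with (h * (u' c - u' x)) by ring.
    pose proof (Hin c Hc) as Hch.
    destruct (H c Hch) as [_ L].
    assert (HB : 0 <= B * Rabs h).
    { destruct (H (x + h)) as [_ L']; replace (x + h - x) with h in * by ring.
      - apply Rle_refl.
      - eapply Rle_trans; [apply Rabs_pos | exact L']. }
    rewrite Rabs_mult, <- (pow2_abs h).
    replace (B * Rabs h ^ 2) with (Rabs h * (B * Rabs h)) by ring.
    apply Rmult_le_compat_l; [apply Rabs_pos |].
    eapply Rle_trans; [apply L |].
    destruct (Rle_dec 0 B).
    + apply Rmult_le_compat_l; assumption.
    + pose proof (Rabs_pos h); pose proof (Rabs_pos (c - x)).
      assert (0 <= - B * Rabs (c - x)) by (apply Rmult_le_pos; lra); lra.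
Qed.

Lemma near_time eps s h y :
  Rabs h < Rmin 1 (eps + s) -> Rabs (y - s) <= Rabs h ->
  - eps < y /\ Rabs y <= Rabs s + 1.
Proof.
  intros Hh Hy.
  pose proof (Rmin_l 1 (eps + s)); pose proof (Rmin_r 1 (eps + s)); split.
  - pose proof (Rle_abs (- (y - s))) as Hn; rewrite Rabs_Ropp in Hn; lra.
  - replace y with ((y - s) + s) by ring.
    eapply Rle_trans; [apply Rabs_triang |]; lra.
Qed.

(** * Integration in s and in q preserves smoothness with exponential bounds *)

Section Integrals.

Variables eps r : R.
Hypothesis Heps : 0 < eps.
Hypothesis Hr : 0 < r.

Definition sint3 (f : R -> R -> R -> R) (s q t : R) : R :=
  sint (fun s q => f s q t) s q.

Definition qint3 (f : R -> R -> R -> R) (s q t : R) : R :=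
  qint r (fun s q => f s q t) s q.

Definition supported3 (f : R -> R -> R -> R) : Prop :=
  forall s q t, - eps < s -> r < Rabs q -> f s q t = 0.

Lemma sint_difference Y Z s q q' B :
  tame eps Y -> tame eps Z -> - eps < s ->
  (forall t, - eps < t -> Rabs t <= Rabs s -> Rabs (Y t q - Z t q') <= B) ->
  Rabs (sint Y s q - sint Z s q') <= B * Rabs s.
Proof.
  intros HY HZ Hs HB; unfold sint.
  rewrite <- RInt_sub by (apply (tame_ex_RInt_s eps); assumption).
  replace (Rabs s) with (Rabs (s - 0)) by (f_equal; ring).
  apply RInt_bound_const.
  - apply (ex_RInt_minus (fun t => Y t q) (fun t => Z t q'));
      apply (tame_ex_RInt_s eps); assumption.
  - intros t Ht; destruct (between_0 eps Heps s t Hs Ht); apply HB; assumption.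
Qed.

Lemma qint_difference Y Z s s' q m :
  tame eps Y -> tame eps Z -> supported eps r Y -> supported eps r Z ->
  - eps < s -> - eps < s' ->
  (forall x, Rabs x <= r -> Rabs (Y s x - Z s' x) <= m) ->
  Rabs (qint r Y s q - qint r Z s' q) <= 2 * r * m.
Proof.
  intros HY HZ SY SZ Hs Hs' Hm; unfold qint.
  rewrite <- RInt_sub by (apply (tame_ex_RInt_q eps); assumption).
  apply (tail_RInt_bound_const (fun x => Y s x - Z s' x)); [exact Hr | | | exact Hm].
  - intros x; apply (continuous_minus (Y s) (Z s'));
      apply (tame_continuous_q eps); assumption.
  - intros x Hx; rewrite SY, SZ by assumption; ring.
Qed.

(** The factor [x] lost to a time integral is absorbed by x <= exp x, at the price of a rate larger
    by one. *)
Lemma Cexp_time C x : 0 <= C -> 0 <= x ->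
  C * exp (C * x) * x <= (C + 1) * exp ((C + 1) * x).
Proof.
  intros HC Hx.
  replace ((C + 1) * x) with (C * x + x) by ring; rewrite exp_plus.
  rewrite <- Rmult_assoc; apply Rmult_le_compat; try lra.
  - apply Cexp_pos, HC.
  - apply Rmult_le_compat_r; [left; apply exp_pos | lra].
  - pose proof (exp_ineq1_le x); lra.
Qed.

Lemma Cexp_scal k C x : 0 <= k -> 0 <= C -> 0 <= x ->
  k * (C * exp (C * x)) <= (k + 1) * C * exp ((k + 1) * C * x).
Proof.
  intros Hk HC Hx.
  assert (0 <= k * C) by (apply Rmult_le_pos; assumption).
  rewrite <- Rmult_assoc; apply Rmult_le_compat; try lra.
  - left; apply exp_pos.
  - apply exp_le, Rmult_le_compat_r; lra.
Qed.

Lemma exp_lip_sint3 f : exp_lip eps f -> exp_lip eps (sint3 f).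
Proof.
  intros Hf; pose proof (fun t => exp_lip_tame eps f t Hf) as Tf.
  destruct (exp_lip_bounds eps f Hf) as [C [HC H]].
  assert (D : forall s d, 0 <= d ->
    C * exp (C * (2 * Rabs s)) * d * Rabs s
      <= (2 * C + 1) * exp ((2 * C + 1) * Rabs s) * d).
  { intros s d Hd; pose proof (Rabs_pos s).
    rewrite (Rmult_assoc _ d), (Rmult_comm d), <- Rmult_assoc.
    apply Rmult_le_compat_r; [exact Hd |].
    eapply Rle_trans; [| apply Cexp_time; lra].
    apply Rmult_le_compat_r; [lra |].
    replace (C * (2 * Rabs s)) with (2 * C * Rabs s) by ring.
    apply Rmult_le_compat_r; [left; apply exp_pos | lra]. }
  apply exp_lip_intro.
  - exists (C + 1); split; [lra |]; intros s q t Hs; pose proof (Rabs_pos s).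
    eapply Rle_trans; [| apply (Cexp_time C); lra].
    apply (sint_bound eps); auto.
    intros u Hu Hu'; destruct (H u q t u q t Hu Hu) as [a _].
    eapply Rle_trans; [apply a |]; apply Rmult_le_compat_l; [exact HC |].
    apply exp_le, Rmult_le_compat_l; assumption.
  - exists C; split; [exact HC |]; intros s s' q t Hs Hs'.
    apply (sint_diff_s eps); auto.
    intros u Hu Hu'; destruct (H u q t u q t Hu Hu) as [a _].
    eapply Rle_trans; [apply a |]; apply Rmult_le_compat_l; [exact HC |].
    apply exp_le, Rmult_le_compat_l; [exact HC |].
    eapply Rle_trans; [apply Hu' |].
    pose proof (Rabs_pos s); pose proof (Rabs_pos s'); apply Rmax_lub; lra.
  - exists (2 * C + 1); split; [lra |]; intros s q q' t Hs.
    eapply Rle_trans; [| apply D, Rabs_pos].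
    apply sint_difference; auto.
    intros u Hu Hu'; destruct (H u q t u q' t Hu Hu) as [_ a].
    rewrite !Rminus_diag, Rabs_R0, Rplus_0_l, Rplus_0_r in a.
    eapply Rle_trans; [apply a |]; apply Rmult_le_compat_r; [apply Rabs_pos |].
    apply Rmult_le_compat_l; [exact HC |]; apply exp_le, Rmult_le_compat_l; lra.
  - exists (2 * C + 1); split; [lra |]; intros s q t t' Hs.
    eapply Rle_trans; [| apply D, Rabs_pos].
    apply (sint_difference (fun s q => f s q t) (fun s q => f s q t')); auto.
    intros u Hu Hu'; destruct (H u q t u q t' Hu Hu) as [_ a].
    rewrite !Rminus_diag, Rabs_R0, !Rplus_0_l in a.
    eapply Rle_trans; [apply a |]; apply Rmult_le_compat_r; [apply Rabs_pos |].
    apply Rmult_le_compat_l; [exact HC |]; apply exp_le, Rmult_le_compat_l; lra.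
Qed.

Lemma exp_lip_qint3 f : exp_lip eps f -> supported3 f -> exp_lip eps (qint3 f).
Proof.
  intros Hf HS; pose proof (fun t => exp_lip_tame eps f t Hf) as Tf.
  assert (Sf : forall t, supported eps r (fun s q => f s q t)).
  { intros t s q; apply HS. }
  destruct (exp_lip_bounds eps f Hf) as [C [HC H]].
  assert (P : 0 <= (2 * r + 1) * C) by (apply Rmult_le_pos; lra).
  apply exp_lip_intro.
  - exists ((2 * r + 1) * C); split; [exact P |]; intros s q t Hs; pose proof (Rabs_pos s).
    eapply Rle_trans; [| apply Cexp_scal; lra].
    apply (qint_bound eps); auto.
    intros x _; apply (H s x t s x t Hs Hs).
  - exists ((2 * r + 1) * C); split; [exact P |]; intros s s' q t Hs Hs'.
    pose proof (Rabs_pos s); pose proof (Rabs_pos s').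
    apply Rle_trans with (2 * r * (C * exp (C * (Rabs s + Rabs s')) * Rabs (s - s'))).
    + apply qint_difference; auto.
      intros x _; destruct (H s x t s' x t Hs Hs') as [_ a].
      rewrite !Rminus_diag, Rabs_R0, !Rplus_0_r in a; exact a.
    + rewrite <- Rmult_assoc; apply Rmult_le_compat_r; [apply Rabs_pos |].
      apply Cexp_scal; lra.
  - exists C; split; [exact HC |]; intros s q q' t Hs.
    unfold qint3, qint.
    rewrite (RInt_split (fun q => f s q t) q q' r)
      by (apply (tame_ex_RInt_q eps (fun s q => f s q t)); auto).
    rewrite Rplus_minus_r, (Rabs_minus_sym q q'); apply RInt_bound_const.
    + apply (tame_ex_RInt_q eps (fun s q => f s q t)); auto.
    + intros x _; apply (H s x t s x t Hs Hs).
  - exists ((2 * r + 1) * (2 * C)); split; [lra |]; intros s q t t' Hs.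
    pose proof (Rabs_pos s).
    apply Rle_trans with (2 * r * (C * exp (C * (Rabs s + Rabs s)) * Rabs (t - t'))).
    + apply (qint_difference (fun s q => f s q t) (fun s q => f s q t')); auto.
      intros x _; destruct (H s x t s x t' Hs Hs) as [_ a].
      rewrite !Rminus_diag, Rabs_R0, !Rplus_0_l in a; exact a.
    + rewrite <- Rmult_assoc; apply Rmult_le_compat_r; [apply Rabs_pos |].
      eapply Rle_trans; [| apply Cexp_scal; lra].
      apply Rmult_le_compat_l; [lra |].
      replace (C * (Rabs s + Rabs s)) with (2 * C * Rabs s) by ring.
      apply Rmult_le_compat_r; [left; apply exp_pos | lra].
Qed.

Lemma is_derive_sint3_s f s q t :
  exp_lip eps f -> - eps < s -> is_derive (fun s => sint3 f s q t) s (f s q t).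
Proof.
  intros Hf Hs; pose proof (exp_lip_tame eps f t Hf) as Tf.
  apply (is_derive_RInt (fun s => f s q t) (fun s => sint3 f s q t) 0 s).
  - apply (filter_imp (fun s' => - eps < s')); [| apply locally_future; assumption].
    intros s' Hs'; apply (RInt_correct (fun s => f s q t)).
    apply (tame_ex_RInt_s eps Heps (fun s q => f s q t)); assumption.
  - apply (tame_continuous_s eps (fun s q => f s q t)); assumption.
Qed.

Lemma is_derive_qint3_q f s q t :
  exp_lip eps f -> - eps < s -> is_derive (fun q => qint3 f s q t) q (- f s q t).
Proof.
  intros Hf Hs; pose proof (exp_lip_tame eps f t Hf) as Tf.
  apply (is_derive_RInt' (fun q => f s q t) (fun q => qint3 f s q t) q r).
  - apply filter_forall; intros q'; apply (RInt_correct (fun q => f s q t)).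
    apply (tame_ex_RInt_q eps (fun s q => f s q t)); assumption.
  - apply (tame_continuous_q eps (fun s q => f s q t)); assumption.
Qed.

Lemma is_derive_sint3_q f f2 s q t :
  exp_lip eps f -> exp_lip eps f2 ->
  (forall s q t, - eps < s -> is_derive (fun q => f s q t) q (f2 s q t)) ->
  - eps < s -> is_derive (fun q => sint3 f s q t) q (sint3 f2 s q t).
Proof.
  intros Hf Hf2 D Hs.
  destruct (exp_lip_bounds eps f2 Hf2) as [C [HC H]].
  apply (is_derive_RInt_of_quadratic (fun q u => f u q t) (fun u => f2 u q t) 0 s q
    (C * exp (C * (Rabs s + Rabs s))) 1); [lra | | |].
  - intros h _; apply (tame_ex_RInt_s eps Heps (fun s q => f s q t));
      [apply exp_lip_tame, Hf | exact Hs].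
  - apply (tame_ex_RInt_s eps Heps (fun s q => f2 s q t));
      [apply exp_lip_tame, Hf2 | exact Hs].
  - intros h u _ Hu; destruct (between_0 eps Heps s u Hs Hu) as [u1 u2].
    apply (quadratic_of_lipschitz_derive (fun q => f u q t) (fun q => f2 u q t)).
    intros y _; split; [apply D, u1 |].
    destruct (H u y t u q t u1 u1) as [_ a].
    rewrite !Rminus_diag, Rabs_R0, Rplus_0_l, Rplus_0_r in a.
    eapply Rle_trans; [apply a |]; apply Rmult_le_compat_r; [apply Rabs_pos |].
    apply Rmult_le_compat_l; [exact HC |]; apply exp_le, Rmult_le_compat_l; lra.
Qed.

Lemma is_derive_sint3_t f f3 s q t :
  exp_lip eps f -> exp_lip eps f3 ->
  (forall s q t, - eps < s -> is_derive (fun t => f s q t) t (f3 s q t)) ->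
  - eps < s -> is_derive (fun t => sint3 f s q t) t (sint3 f3 s q t).
Proof.
  intros Hf Hf3 D Hs.
  destruct (exp_lip_bounds eps f3 Hf3) as [C [HC H]].
  apply (is_derive_RInt_of_quadratic (fun t u => f u q t) (fun u => f3 u q t) 0 s t
    (C * exp (C * (Rabs s + Rabs s))) 1); [lra | | |].
  - intros h _; apply (tame_ex_RInt_s eps Heps (fun s q => f s q (t + h)));
      [apply exp_lip_tame, Hf | exact Hs].
  - apply (tame_ex_RInt_s eps Heps (fun s q => f3 s q t));
      [apply exp_lip_tame, Hf3 | exact Hs].
  - intros h u _ Hu; destruct (between_0 eps Heps s u Hs Hu) as [u1 u2].
    apply (quadratic_of_lipschitz_derive (fun t => f u q t) (fun t => f3 u q t)).
    intros y _; split; [apply D, u1 |].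
    destruct (H u q y u q t u1 u1) as [_ a].
    rewrite !Rminus_diag, Rabs_R0, !Rplus_0_l in a.
    eapply Rle_trans; [apply a |]; apply Rmult_le_compat_r; [apply Rabs_pos |].
    apply Rmult_le_compat_l; [exact HC |]; apply exp_le, Rmult_le_compat_l; lra.
Qed.

Lemma is_derive_qint3_t f f3 s q t :
  exp_lip eps f -> exp_lip eps f3 ->
  (forall s q t, - eps < s -> is_derive (fun t => f s q t) t (f3 s q t)) ->
  - eps < s -> is_derive (fun t => qint3 f s q t) t (qint3 f3 s q t).
Proof.
  intros Hf Hf3 D Hs.
  destruct (exp_lip_bounds eps f3 Hf3) as [C [HC H]].
  apply (is_derive_RInt_of_quadratic (fun t u => f s u t) (fun u => f3 s u t) q r t
    (C * exp (C * (Rabs s + Rabs s))) 1); [lra | | |].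
  - intros h _; apply (tame_ex_RInt_q eps (fun s q => f s q (t + h)));
      [apply exp_lip_tame, Hf | exact Hs].
  - apply (tame_ex_RInt_q eps (fun s q => f3 s q t));
      [apply exp_lip_tame, Hf3 | exact Hs].
  - intros h u _ Hu.
    apply (quadratic_of_lipschitz_derive (fun t => f s u t) (fun t => f3 s u t)).
    intros y _; split; [apply D, Hs |].
    destruct (H s u y s u t Hs Hs) as [_ a].
    rewrite !Rminus_diag, Rabs_R0, !Rplus_0_l in a; exact a.
Qed.

Lemma is_derive_qint3_s f f1 s q t :
  exp_lip eps f -> exp_lip eps f1 ->
  (forall s q t, - eps < s -> is_derive (fun s => f s q t) s (f1 s q t)) ->
  - eps < s -> is_derive (fun s => qint3 f s q t) s (qint3 f1 s q t).
Proof.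
  intros Hf Hf1 D Hs.
  destruct (exp_lip_bounds eps f1 Hf1) as [C [HC H]].
  apply (is_derive_RInt_of_quadratic (fun s u => f s u t) (fun u => f1 s u t) q r s
    (C * exp (C * (2 * Rabs s + 1))) (Rmin 1 (eps + s))).
  - apply Rmin_pos; lra.
  - intros h Hh; apply (tame_ex_RInt_q eps (fun s q => f s q t));
      [apply exp_lip_tame, Hf |].
    apply (near_time eps s h (s + h) Hh); replace (s + h - s) with h by ring; apply Rle_refl.
  - apply (tame_ex_RInt_q eps (fun s q => f1 s q t));
      [apply exp_lip_tame, Hf1 | exact Hs].
  - intros h u Hh Hu.
    apply (quadratic_of_lipschitz_derive (fun s => f s u t) (fun s => f1 s u t)).
    intros y Hy; destruct (near_time eps s h y Hh Hy) as [y1 y2]; split; [apply D, y1 |].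
    destruct (H y u t s u t y1 Hs) as [_ a].
    rewrite !Rminus_diag, Rabs_R0, !Rplus_0_r in a.
    eapply Rle_trans; [apply a |]; apply Rmult_le_compat_r; [apply Rabs_pos |].
    apply Rmult_le_compat_l; [exact HC |]; apply exp_le, Rmult_le_compat_l; lra.
Qed.

Lemma exp_smooth_sint3 n f : exp_smooth eps n f -> exp_smooth eps n (sint3 f).
Proof.
  revert f; induction n; intros f Hf;
    (split; [apply exp_lip_sint3; apply Hf |]); [exact I |].
  pose proof (exp_smooth_pred _ n f Hf) as Pf.
  destruct Hf as [f0 [f1 [f2 [f3 [D [H1 [H2 H3]]]]]]].
  exists f, (sint3 f2), (sint3 f3).
  split; [| split; [exact Pf | split; apply IHn; assumption]].
  intros s q t Hs; split; [| split].
  - apply is_derive_sint3_s; assumption.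
  - apply is_derive_sint3_q; auto; [apply (exp_smooth_lip eps n), H2 |].
    intros; apply D; assumption.
  - apply is_derive_sint3_t; auto; [apply (exp_smooth_lip eps n), H3 |].
    intros; apply D; assumption.
Qed.

(** The conditions s > -eps and |q| > r are open, so every partial derivative there sees only zeros.
    Differentiated integrands may thus again be integrated from q to infinity. *)
Lemma supported3_derive f f1 f2 f3 :
  supported3 f ->
  (forall s q t, - eps < s ->
    is_derive (fun s => f s q t) s (f1 s q t) /\
    is_derive (fun q => f s q t) q (f2 s q t) /\
    is_derive (fun t => f s q t) t (f3 s q t)) ->
  supported3 f1 /\ supported3 f2 /\ supported3 f3.
Proof.
  intros HS D.
  assert (Z : forall (u : R -> R) x l, locally x (fun y => u y = 0) ->
    is_derive u x l -> l = 0).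
  { intros u x l H Hu.
    rewrite <- (is_derive_unique u x l Hu).
    rewrite (Derive_ext_loc u (fun _ => 0) x H); apply Derive_const. }
  repeat split; intros s q t Hs Hq; destruct (D s q t Hs) as [a [b c]].
  - apply (Z _ _ _) with (2 := a).
    apply (filter_imp (fun s' => - eps < s')); [| apply locally_future; assumption].
    intros; apply HS; assumption.
  - apply (Z _ _ _) with (2 := b).
    apply (filter_imp (fun q' => r < Rabs q')); [intros; apply HS; assumption |].
    apply (continuous_Rabs q (fun y => r < y)).
    apply (open_gt r (Rabs q) Hq).
  - apply (Z _ _ _) with (2 := c).
    apply filter_forall; intros; apply HS; assumption.
Qed.

Lemma exp_smooth_qint3 n f :
  exp_smooth eps n f -> supported3 f -> exp_smooth eps n (qint3 f).
Proof.
  revert f; induction n; intros f Hf HS;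
    (split; [apply exp_lip_qint3; [apply Hf | exact HS] |]); [exact I |].
  pose proof (exp_smooth_pred _ n f Hf) as Pf.
  destruct Hf as [f0 [f1 [f2 [f3 [D [H1 [H2 H3]]]]]]].
  destruct (supported3_derive f f1 f2 f3 HS D) as [S1 [S2 S3]].
  exists (qint3 f1), (fun s q t => -1 * f s q t), (qint3 f3).
  split; [| split; [apply IHn; assumption | split; [| apply IHn; assumption]]].
  2:{ apply (exp_smooth_mult eps n (fun _ _ _ => -1));
        [apply exp_smooth_const | exact Pf]. }
  intros s q t Hs; split; [| split].
  - apply is_derive_qint3_s; auto; [apply (exp_smooth_lip eps n), H1 |].
    intros; apply D; assumption.
  - replace (-1 * f s q t) with (- f s q t) by ring.
    apply is_derive_qint3_q; assumption.
  - apply is_derive_qint3_t; auto; [apply (exp_smooth_lip eps n), H3 |].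
    intros; apply D; assumption.
Qed.

End Integrals.

(** * The linear Goursat problem *)

Section Gronwall.

Variables eps r : R.
Hypothesis Heps : 0 < eps.
Hypothesis Hr : 0 < r.

(** One pass through the double integral turns the bound N exp(lam|s|) into (kappa N + 2rc)/lam
    times the same weight, which is at most N/2 + 2rc there. Starting from the finite bound that
    [tame] gives on bounded times, the coefficients descend to the fixed point 4rc of N -> N/2 +
    2rc. *)
Lemma gronwall (D Z k : R -> R -> R) kappa c lam :
  tame eps D -> tame eps Z -> supported eps r Z ->
  (forall s q, - eps < s -> D s q = sint (qint r Z) s q) ->
  (forall s q, - eps < s -> 0 <= k s q) ->
  (forall s, - eps < s -> ex_RInt (k s) (- r) r /\ RInt (k s) (- r) r <= kappa) ->
  0 <= c -> 0 <= kappa -> 1 + 2 * kappa <= lam ->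
  (forall s q, - eps < s ->
    Rabs (Z s q) <= k s q * Rabs (D s q) + c * exp (lam * Rabs s)) ->
  forall s q, - eps < s -> Rabs (D s q) <= 4 * r * c * exp (lam * Rabs s).
Proof.
  intros TD TZ SZ E Hk Hi Hc Hkap Hlam HZ s q Hs.
  destruct (TD (Rabs s)) as [B [HB HD]].
  assert (Hrc : 0 <= r * c) by (apply Rmult_le_pos; lra).
  assert (Main : forall n t x, - eps < t -> Rabs t <= Rabs s ->
    Rabs (D t x) <= (B * (1 / 2) ^ n + 4 * r * c) * exp (lam * Rabs t)).
  { induction n; intros t x Ht Hts.
    - destruct (HD t t x x Ht Ht Hts Hts) as [H _].
      assert (1 <= exp (lam * Rabs t)).
      { apply exp_ge_1, Rmult_le_pos; [lra | apply Rabs_pos]. }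
      assert (B * 1 <= B * exp (lam * Rabs t)) by (apply Rmult_le_compat_l; lra).
      assert (0 <= 4 * r * c * exp (lam * Rabs t))
        by (apply Rmult_le_pos; lra).
      simpl; lra.
    - set (N := B * (1 / 2) ^ n + 4 * r * c) in *.
      assert (HN : 0 <= N).
      { unfold N; apply Rplus_le_le_0_compat; [| lra].
        apply Rmult_le_pos; [exact HB | apply pow_le; lra]. }
      assert (HkN : 0 <= kappa * N) by (apply Rmult_le_pos; assumption).
      rewrite E by exact Ht.
      eapply Rle_trans;
        [apply (sint_exp_bound eps _ t x (kappa * N + 2 * r * c) lam); auto; try lra |].
      + apply tame_qint; assumption.
      + intros u Hu Hut; destruct (Hi u Hu) as [Ek Ik].
        set (e := exp (lam * Rabs u)).
        assert (He : 0 < e) by apply exp_pos.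
        assert (E1 : ex_RInt (fun x => N * e * k u x) (- r) r)
          by exact (ex_RInt_scal (k u) (- r) r (N * e) Ek).
        assert (E2 : ex_RInt (fun _ : R => c * e) (- r) r)
          by apply (ex_RInt_const (- r) r (c * e)).
        apply (tail_RInt_bound (Z u) (fun x => N * e * k u x + c * e)); auto.
        * intros y; apply (tame_continuous_q eps); assumption.
        * exact (ex_RInt_plus _ _ (- r) r E1 E2).
        * intros y _; eapply Rle_trans; [apply HZ, Hu |]; fold e.
          apply Rplus_le_compat_r; rewrite (Rmult_comm (N * e)).
          apply Rmult_le_compat_l; [apply Hk, Hu | apply IHn; lra].
        * assert (Ip : RInt (fun x => N * e * k u x + c * e) (- r) r
            = N * e * RInt (k u) (- r) r + 2 * r * (c * e)).
          { transitivity (RInt (fun x => N * e * k u x) (- r) r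
              + RInt (fun _ => c * e) (- r) r).
            - exact (RInt_plus (V := R_CompleteNormedModule) _ _ (- r) r E1 E2).
            - rewrite RInt_scal_l by exact Ek; rewrite RInt_cst.
              replace (r - - r) with (2 * r) by ring; f_equal; apply Rmult_comm. }
          rewrite Ip.
          assert (N * e * RInt (k u) (- r) r <= N * e * kappa).
          { apply Rmult_le_compat_l; [apply Rmult_le_pos; lra | exact Ik]. }
          lra.
      + apply Rmult_le_compat_r; [left; apply exp_pos |].
        apply Rmult_le_reg_r with lam; [lra |].
        unfold Rdiv; rewrite Rmult_assoc, Rinv_l by lra.
        replace (B * (1 * / 2) ^ S n + 4 * r * c) with (N / 2 + 2 * (r * c))
          by (unfold N, Rdiv; simpl; field).
        assert ((N / 2 + 2 * (r * c)) * (1 + 2 * kappa)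
          <= (N / 2 + 2 * (r * c)) * lam) by (apply Rmult_le_compat_l; lra).
        assert (0 <= r * c * kappa) by (apply Rmult_le_pos; lra).
        lra. }
  apply (le_of_half_pow _ (B * exp (lam * Rabs s))); intros n.
  pose proof (Main n s q Hs (Rle_refl _)); lra.
Qed.

(** The index is an angle or a pair (t, h), and [d] is the size of the source: 1 for values, |h| for
    increments, h^2 for first-order remainders. The constant obtained is uniform in the index. *)
Lemma gronwall_family {T : Type} (D Z k : T -> R -> R -> R) (d : T -> R) kappa :
  (forall t, 0 <= d t) -> 0 <= kappa ->
  (forall t, tame eps (D t)) -> (forall t, tame eps (Z t)) ->
  (forall t, supported eps r (Z t)) ->
  (forall t s q, - eps < s -> D t s q = sint (qint r (Z t)) s q) ->
  (forall t s q, - eps < s -> 0 <= k t s q) ->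
  (forall t s, - eps < s -> ex_RInt (k t s) (- r) r /\ RInt (k t s) (- r) r <= kappa) ->
  (exists C, 0 <= C /\ forall t s q, - eps < s ->
    Rabs (Z t s q) <= k t s q * Rabs (D t s q) + C * exp (C * Rabs s) * d t) ->
  exists C, 0 <= C /\ forall t s q, - eps < s ->
    Rabs (D t s q) <= C * exp (C * Rabs s) * d t.
Proof.
  intros Hd Hkap TD TZ SZ E Hk Hi [C [HC H]].
  assert (HrC : 0 <= r * C) by (apply Rmult_le_pos; lra).
  (* [1 + 2 * kappa] is the rate demanded by [gronwall]; adding [C] lets the weight dominate the
     growth of the source. *)
  set (lam := 1 + 2 * kappa + C).
  exists (4 * (r * C) + lam); split; [unfold lam; lra |]; intros t s q Hs.
  pose proof (Rabs_pos s) as Ps.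
  apply Rle_trans with (4 * r * (C * d t) * exp (lam * Rabs s)).
  - apply (gronwall (D t) (Z t) (k t) kappa); auto; try (unfold lam; lra).
    + apply Rmult_le_pos; [exact HC | apply Hd].
    + intros u x Hu; eapply Rle_trans; [apply H, Hu |].
      apply Rplus_le_compat_l; rewrite (Rmult_assoc C (exp _)), (Rmult_comm (exp _)).
      rewrite <- Rmult_assoc; apply Rmult_le_compat_l;
        [apply Rmult_le_pos; [exact HC | apply Hd] |].
      apply exp_le, Rmult_le_compat_r; [apply Rabs_pos | unfold lam; lra].
  - replace (4 * r * (C * d t) * exp (lam * Rabs s))
      with (4 * (r * C) * exp (lam * Rabs s) * d t) by ring.
    apply Rmult_le_compat_r; [apply Hd |].
    apply Rmult_le_compat; [lra | left; apply exp_pos | unfold lam; lra |].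
    apply exp_le, Rmult_le_compat_r; lra.
Qed.

End Gronwall.

(** * Increments in the angle, and existence for the linear problem *)

Section Linear_problem.

Variables eps r : R.
Hypothesis Heps : 0 < eps.
Hypothesis Hr : 0 < r.

(* A tuple [(s, q, t, h)] indexes increments in the angle from [t] to [t + h]. *)
Definition inc_ok (x : R * R * R * R) : Prop := - eps < fst (fst (fst x)).

Definition inc_age (x : R * R * R * R) : R := Rabs (fst (fst (fst x))).

Definition inc_base (f : R -> R -> R -> R) (x : R * R * R * R) : R :=
  f (fst (fst (fst x))) (snd (fst (fst x))) (snd (fst x)).

Definition inc_shift (f : R -> R -> R -> R) (x : R * R * R * R) : R :=
  f (fst (fst (fst x))) (snd (fst (fst x))) (snd (fst x) + snd x).

Lemma edom_inc_base f :
  exp_bounded eps f -> edom inc_ok inc_age (fun _ => 1) (inc_base f).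
Proof.
  intros H; apply (edom_pull _ _ _ _ inc_ok inc_age fst H).
  intros [[[s q] t] h] Hs; pose proof (Rabs_pos s).
  unfold inc_age, age; simpl; split; [exact Hs | lra].
Qed.

Lemma edom_inc_shift f :
  exp_bounded eps f -> edom inc_ok inc_age (fun _ => 1) (inc_shift f).
Proof.
  intros H; apply (edom_pull _ _ _ _ inc_ok inc_age
    (fun x => (fst (fst x), snd (fst x) + snd x)) H).
  intros [[[s q] t] h] Hs; pose proof (Rabs_pos s).
  unfold inc_age, age; simpl; split; [exact Hs | lra].
Qed.

Lemma edom_inc f :
  exp_lip eps f ->
  edom inc_ok inc_age (fun x => Rabs (snd x)) (fun x => inc_shift f x - inc_base f x).
Proof.
  intros Hf; destruct (exp_lip_bounds eps f Hf) as [C [HC H]].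
  exists (2 * C); split; [lra |]; intros [[[s q] t] h] Hs.
  unfold inc_age, inc_base, inc_shift; unfold inc_ok in Hs; simpl in *.
  pose proof (Rabs_pos s); split; [lra | split; [apply Rabs_pos |]].
  destruct (H s q (t + h) s q t Hs Hs) as [_ a].
  rewrite !Rminus_diag, Rabs_R0, !Rplus_0_l, Rplus_minus_l in a.
  eapply Rle_trans; [apply a |]; apply Rmult_le_compat_r; [apply Rabs_pos |].
  apply Rmult_le_compat; [lra | left; apply exp_pos | lra |].
  apply exp_le; lra.
Qed.

Lemma edom_inc_taylor f f3 :
  exp_lip eps f3 ->
  (forall s q t, - eps < s -> is_derive (fun t => f s q t) t (f3 s q t)) ->
  edom inc_ok inc_age (fun x => snd x ^ 2)
    (fun x => inc_shift f x - inc_base f x - snd x * inc_base f3 x).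
Proof.
  intros Hf D; destruct (exp_lip_bounds eps f3 Hf) as [C [HC H]].
  exists (2 * C); split; [lra |]; intros [[[s q] t] h] Hs.
  unfold inc_age, inc_base, inc_shift; unfold inc_ok in Hs; cbn [fst snd] in *.
  pose proof (Rabs_pos s); split; [lra | split; [apply pow2_ge_0 |]].
  apply Rle_trans with (C * exp (C * (Rabs s + Rabs s)) * h ^ 2).
  - apply (quadratic_of_lipschitz_derive (f s q) (f3 s q)).
    intros y _; split; [apply D, Hs |].
    destruct (H s q y s q t Hs Hs) as [_ a].
    rewrite !Rminus_diag, Rabs_R0, !Rplus_0_l in a; exact a.
  - apply Rmult_le_compat_r; [apply pow2_ge_0 |].
    apply Rmult_le_compat; [lra | left; apply exp_pos | lra |].
    apply exp_le; lra.
Qed.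

Lemma edom_inc_square g :
  edom inc_ok inc_age (fun x => Rabs (snd x) * Rabs (snd x)) g ->
  edom inc_ok inc_age (fun x => snd x ^ 2) g.
Proof.
  intros H; apply (edom_le _ _ _ _ _ _ H); intros x _; split; [apply Rle_refl |].
  rewrite <- (pow2_abs (snd x)); simpl; lra.
Qed.

Lemma edom_inc_curry d g :
  edom inc_ok inc_age d g -> exists C, 0 <= C /\ forall (p : R * R) s q, - eps < s ->
    Rabs (g (s, q, fst p, snd p)) <= C * exp (C * Rabs s) * d (s, q, fst p, snd p).
Proof.
  intros [C [HC H]]; exists C; split; [exact HC |].
  intros p s q Hs; apply (H (s, q, fst p, snd p) Hs).
Qed.

Lemma exp_bounded_intro f :
  (exists C, 0 <= C /\ forall s q t, - eps < s -> Rabs (f s q t) <= C * exp (C * Rabs s)) ->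
  exp_bounded eps f.
Proof.
  intros [C [HC H]]; exists C; split; [exact HC |]; intros [[s q] t] Hs.
  rewrite Rmult_1_r; split; [apply age_pos | split; [lra |]]; apply H, Hs.
Qed.

(** In s and q a double integral of a bounded function is Lipschitz because moving an endpoint costs
    only the bound on [W]. What remains to be supplied is the estimate of increments in the
    angle. *)
Lemma exp_lip_double_integral W X :
  (forall t, tame eps (fun s q => W s q t)) -> supported3 eps r W ->
  exp_bounded eps W ->
  (forall s q t, - eps < s -> X s q t = sint3 (qint3 r W) s q t) ->
  exp_bounded eps X ->
  (exists C, 0 <= C /\ forall (p : R * R) s q, - eps < s ->
    Rabs (X s q (fst p + snd p) - X s q (fst p)) <= C * exp (C * Rabs s) * Rabs (snd p)) ->
  exp_lip eps X.
Proof.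
  intros TW SW [C [HC HW]] E [D [HD HX]] [L [HL HLip]].
  assert (SWt : forall t, supported eps r (fun s q => W s q t)) by (intros t s q; apply SW).
  assert (TQ : forall t, tame eps (fun s q => qint3 r W s q t)).
  { intros t; apply tame_qint; auto. }
  assert (HW' : forall s q t, - eps < s -> Rabs (W s q t) <= C * exp (C * Rabs s)).
  { intros s q t Hs; destruct (HW (s, q, t) Hs) as [_ [_ a]].
    rewrite Rmult_1_r in a; exact a. }
  assert (P : 0 <= (2 * r + 1) * C) by (apply Rmult_le_pos; lra).
  apply exp_lip_intro.
  - exists D; split; [exact HD |]; intros s q t Hs.
    destruct (HX (s, q, t) Hs) as [_ [_ a]]; rewrite Rmult_1_r in a; exact a.
  - exists ((2 * r + 1) * C); split; [exact P |]; intros s s' q t Hs Hs'.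
    rewrite !E by assumption; apply (sint_diff_s eps); auto.
    intros u Hu Hus; pose proof (Rabs_pos u); pose proof (Rabs_pos s);
      pose proof (Rabs_pos s').
    apply Rle_trans with (2 * r * (C * exp (C * Rabs u))).
    + apply (qint_bound eps); auto; intros x _; apply HW', Hu.
    + eapply Rle_trans; [apply Cexp_scal; lra |].
      apply Rmult_le_compat_l; [lra |]; apply exp_le, Rmult_le_compat_l; [lra |].
      eapply Rle_trans; [apply Hus |]; apply Rmax_lub; lra.
  - exists (C + 1); split; [lra |]; intros s q q' t Hs.
    rewrite !E by assumption; pose proof (Rabs_pos s); pose proof (Rabs_pos (q - q')).
    apply Rle_trans with (C * exp (C * Rabs s) * Rabs (q - q') * Rabs s).
    + apply (sint_difference eps); auto.
      intros u Hu Hus; unfold qint3, qint.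
      rewrite (RInt_split (fun q => W u q t) q q' r)
        by (apply (tame_ex_RInt_q eps (fun s q => W s q t)); auto).
      rewrite Rplus_minus_r, (Rabs_minus_sym q q'); apply RInt_bound_const.
      * apply (tame_ex_RInt_q eps (fun s q => W s q t)); auto.
      * intros x _; eapply Rle_trans; [apply HW', Hu |].
        apply Rmult_le_compat_l; [exact HC |]; apply exp_le, Rmult_le_compat_l; lra.
    + rewrite (Rmult_assoc _ (Rabs (q - q'))), (Rmult_comm (Rabs (q - q'))).
      rewrite <- Rmult_assoc; apply Rmult_le_compat_r; [assumption |].
      apply Cexp_time; lra.
  - exists L; split; [exact HL |]; intros s q t t' Hs.
    pose proof (HLip (t', t - t') s q Hs) as a; simpl in a.
    replace (t' + (t - t')) with t in a by ring; exact a.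
Qed.

(** X_s and X_q are the single integrals of W in q and of -W in s, both of the order of [W]. So one
    order is gained as soon as an angular derivative [Y] of order n is known. *)
Lemma exp_smooth_double_integral n W X Y :
  exp_smooth eps n W -> supported3 eps r W ->
  (forall s q t, - eps < s -> X s q t = sint3 (qint3 r W) s q t) ->
  exp_lip eps X -> exp_smooth eps n Y ->
  (forall s q t, - eps < s -> is_derive (fun t => X s q t) t (Y s q t)) ->
  exp_smooth eps (S n) X.
Proof.
  intros HW SW E HX HY DY.
  assert (HQ : exp_smooth eps n (qint3 r W)) by (apply exp_smooth_qint3; assumption).
  assert (HW' : exp_smooth eps n (fun s q t => -1 * W s q t)).
  { apply (exp_smooth_mult eps n (fun _ _ _ => -1)); [apply exp_smooth_const | exact HW]. }
  split; [exact HX |].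
  exists (qint3 r W), (sint3 (fun s q t => -1 * W s q t)), Y.
  split; [| split; [exact HQ | split; [apply exp_smooth_sint3; assumption | exact HY]]].
  pose proof (exp_smooth_lip eps n _ HW) as LW.
  pose proof (exp_smooth_lip eps n _ HQ) as LQ.
  pose proof (exp_smooth_lip eps n _ HW') as LW'.
  intros s q t Hs; split; [| split; [| apply DY, Hs]].
  - refine (is_derive_ext_loc (fun s => sint3 (qint3 r W) s q t) _ s _ _ _).
    + apply (filter_imp (fun s' => - eps < s')); [| apply locally_future; assumption].
      intros s' Hs'; symmetry; apply E, Hs'.
    + apply (is_derive_sint3_s eps); assumption.
  - apply (is_derive_ext (fun q => sint3 (qint3 r W) s q t)).
    + intros q'; symmetry; apply E, Hs.
    + apply (is_derive_sint3_q eps); auto.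
      intros u x y Hu; replace (-1 * W u x y) with (- W u x y) by ring.
      apply (is_derive_qint3_q eps); assumption.
Qed.

Lemma sint3_qint3_minus Y Z s q :
  tame eps Y -> tame eps Z -> supported eps r Y -> supported eps r Z -> - eps < s ->
  sint (qint r (fun s q => Y s q - Z s q)) s q = sint (qint r Y) s q - sint (qint r Z) s q.
Proof.
  intros TY TZ SY SZ Hs.
  rewrite <- (sint_minus eps) by (try apply tame_qint; assumption).
  apply RInt_ext; intros t Ht.
  destruct (between_0 eps Heps s t Hs) as [h1 _]; [lra |].
  apply (qint_minus eps); assumption.
Qed.

(** By linearity the first-order remainder of X is the double integral of that of W, which is the
    form [gronwall_family] asks for. *)
Lemma sint3_qint3_taylor W X Z Y p s q :
  (forall t, tame eps (fun s q => W s q t)) -> (forall t, tame eps (fun s q => Z s q t)) ->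
  supported3 eps r W -> supported3 eps r Z ->
  (forall s q t, - eps < s -> X s q t = sint3 (qint3 r W) s q t) ->
  (forall s q t, - eps < s -> Y s q t = sint3 (qint3 r Z) s q t) ->
  - eps < s ->
  X s q (fst p + snd p) - X s q (fst p) - snd p * Y s q (fst p)
  = sint (qint r (fun s q => W s q (fst p + snd p) - W s q (fst p)
      - snd p * Z s q (fst p))) s q.
Proof.
  intros TW TZ SW SZ EX EY Hs.
  rewrite (sint3_qint3_minus (fun s q => W s q (fst p + snd p) - W s q (fst p))
    (fun s q => snd p * Z s q (fst p))).
  - rewrite (sint3_qint3_minus (fun s q => W s q (fst p + snd p))
      (fun s q => W s q (fst p)));
      [| apply TW | apply TW | intros u x; apply SW | intros u x; apply SW | exact Hs].
    f_equal; [f_equal; [| f_equal]; apply EX, Hs | f_equal].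
    transitivity (snd p * sint (qint r (fun s q => Z s q (fst p))) s q);
      [f_equal; apply EY, Hs |].
    unfold sint at 1; rewrite <- RInt_scal_l.
    + apply RInt_ext; intros u Hu.
      destruct (between_0 eps Heps s u Hs) as [h1 _]; [lra |].
      symmetry; apply RInt_scal_l.
      apply (tame_ex_RInt_q eps (fun s q => Z s q (fst p))); [apply TZ | exact h1].
    + apply (tame_ex_RInt_s eps Heps (qint r (fun s q => Z s q (fst p)))); [| exact Hs].
      apply tame_qint; [exact Hr | apply TZ | intros u x; apply SZ].
  - apply (tame_minus eps (fun s q => W s q (fst p + snd p))); apply TW.
  - apply tame_scal, TZ.
  - intros u x Hu Hx; rewrite !SW by assumption; ring.
  - intros u x Hu Hx; rewrite SZ by assumption; ring.
  - exact Hs.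
Qed.

Definition affine (K H X : R -> R -> R -> R) (s q t : R) : R :=
  K s q t * X s q t + H s q t.

Definition linear_solution (K H X : R -> R -> R -> R) : Prop :=
  (forall t, tame eps (fun s q => X s q t)) /\
  forall s q t, - eps < s -> X s q t = sint3 (qint3 r (affine K H X)) s q t.

Definition kernel_bound (kappa : R) (K : R -> R -> R -> R) : Prop :=
  forall s t, - eps < s -> RInt (fun q => Rabs (K s q t)) (- r) r <= kappa.

(** Picard iteration with c the identity, for each angle separately; nothing is claimed yet about
    the dependence on t. *)
Lemma linear_solution_exists K H :
  exp_lip eps K -> exp_lip eps H -> supported3 eps r K -> supported3 eps r H ->
  exists X, linear_solution K H X.
Proof.
  intros LK LH SK SH.
  destruct (exp_lip_bounds eps K LK) as [C [HC BK]].
  destruct (exp_lip_bounds eps H LH) as [D [HD BH]].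
  set (F := fun t s q x => K s q t * x + H s q t).
  assert (F_lip : forall t S, exists B, 0 <= B /\
    forall s s' q q' x x', - eps < s -> - eps < s' -> Rabs s <= S -> Rabs s' <= S ->
    Rabs (F t s q 0) <= B /\
    Rabs (F t s q x - F t s' q' x')
      <= B * (1 + Rabs x) * (Rabs (s - s') + Rabs (q - q')) + B * Rabs (x - x')).
  { intros t S.
    set (B1 := C * exp (C * (2 * S))); set (B2 := D * exp (D * (2 * S))).
    pose proof (Cexp_pos C (2 * S) HC) as P1; fold B1 in P1.
    pose proof (Cexp_pos D (2 * S) HD) as P2; fold B2 in P2.
    exists (B1 + B2); split; [lra |]; intros s s' q q' x x' Hs Hs' HS HS'.
    unfold F.
    pose proof (Rabs_pos s); pose proof (Rabs_pos s').
    destruct (BK s q t s' q' t Hs Hs') as [_ k2].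
    destruct (BK s' q' t s' q' t Hs' Hs') as [k1 _].
    destruct (BH s q t s' q' t Hs Hs') as [h1 h2].
    rewrite Rminus_diag, Rabs_R0, Rplus_0_r in k2, h2.
    set (d := Rabs (s - s') + Rabs (q - q')) in *.
    assert (Pd : 0 <= d)
      by (unfold d; pose proof (Rabs_pos (s - s')); pose proof (Rabs_pos (q - q')); lra).
    assert (k1' : Rabs (K s' q' t) <= B1).
    { eapply Rle_trans; [apply k1 |]; apply Rmult_le_compat_l; [exact HC |].
      apply exp_le, Rmult_le_compat_l; lra. }
    assert (h1' : Rabs (H s q t) <= B2).
    { eapply Rle_trans; [apply h1 |]; apply Rmult_le_compat_l; [exact HD |].
      apply exp_le, Rmult_le_compat_l; lra. }
    assert (k2' : Rabs (K s q t - K s' q' t) <= B1 * d).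
    { eapply Rle_trans; [apply k2 |]; apply Rmult_le_compat_r; [exact Pd |].
      apply Rmult_le_compat_l; [exact HC |]; apply exp_le, Rmult_le_compat_l; lra. }
    assert (h2' : Rabs (H s q t - H s' q' t) <= B2 * d).
    { eapply Rle_trans; [apply h2 |]; apply Rmult_le_compat_r; [exact Pd |].
      apply Rmult_le_compat_l; [exact HD |]; apply exp_le, Rmult_le_compat_l; lra. }
    split; [rewrite Rmult_0_r, Rplus_0_l; lra |].
    replace (K s q t * x + H s q t - (K s' q' t * x' + H s' q' t))
      with ((K s q t - K s' q' t) * x + (H s q t - H s' q' t) + K s' q' t * (x - x'))
      by ring.
    pose proof (Rabs_pos x) as Px; pose proof (Rabs_pos (x - x')) as Pxx.
    eapply Rle_trans; [apply Rabs_triang |]; apply Rplus_le_compat.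
    - eapply Rle_trans; [apply Rabs_triang |]; rewrite Rabs_mult.
      pose proof (Rmult_le_compat_r _ _ _ Px k2') as m1.
      assert (0 <= B2 * d * Rabs x) by (apply Rmult_le_pos; [apply Rmult_le_pos |]; assumption).
      assert (0 <= B1 * d) by (apply Rmult_le_pos; assumption).
      lra.
    - rewrite Rabs_mult; apply Rmult_le_compat_r; [exact Pxx | lra]. }
  assert (F_supp : forall t s q x, - eps < s -> r < Rabs q -> F t s q x = 0).
  { intros t s q x Hs Hq; unfold F; rewrite SK, SH by assumption; ring. }
  assert (I0 : forall x y : R, Rabs (x - y) <= Rabs (x - y)) by (intros; apply Rle_refl).
  exists (fun s q t => picard_sol r (fun x => x) (F t) s q); split.
  - intros t; apply (tame_picard_sol eps r (fun x => x) (F t)); auto.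
  - intros s q t Hs.
    exact (picard_sol_fixed eps r (fun x => x) (F t) Heps Hr eq_refl I0 (F_lip t)
      (F_supp t) s q Hs).
Qed.

(** * Regularity in the angle of solutions of the linear problem *)

Section Solution.

Variables (kappa : R) (K H X : R -> R -> R -> R).
Hypothesis Hkappa : 0 <= kappa.
Hypothesis LK : exp_lip eps K.
Hypothesis LH : exp_lip eps H.
Hypothesis SK : supported3 eps r K.
Hypothesis SH : supported3 eps r H.
Hypothesis BK : kernel_bound kappa K.
Hypothesis HX : linear_solution K H X.

Lemma supported_affine : supported3 eps r (affine K H X).
Proof.
  intros s q t Hs Hq; unfold affine; rewrite SK, SH by assumption; ring.
Qed.

Lemma tame_affine t : tame eps (fun s q => affine K H X s q t).
Proof.
  apply (tame_plus eps (fun s q => K s q t * X s q t)); [| apply exp_lip_tame, LH].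
  apply (tame_mult eps (fun s q => K s q t)); [apply exp_lip_tame, LK | apply HX].
Qed.

Lemma ex_RInt_kernel s t : - eps < s -> ex_RInt (fun q => Rabs (K s q t)) (- r) r.
Proof.
  intros Hs; apply (ex_RInt_norm (fun q => K s q t)).
  apply (tame_ex_RInt_q eps (fun s q => K s q t)); [apply exp_lip_tame, LK | exact Hs].
Qed.

Lemma linear_solution_bounded : exp_bounded eps X.
Proof.
  apply exp_bounded_intro.
  destruct (exp_lip_bounds eps H LH) as [C [HC HB]].
  destruct (gronwall_family eps r Heps Hr (fun t s q => X s q t)
    (fun t s q => affine K H X s q t) (fun t s q => Rabs (K s q t)) (fun _ => 1) kappa)
    as [D [HD HE]]; auto.
  - intros; lra.
  - apply HX.
  - apply tame_affine.
  - intros t s q; apply supported_affine.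
  - intros t s q; apply HX.
  - intros; apply Rabs_pos.
  - intros t s Hs; split; [apply ex_RInt_kernel, Hs | apply BK, Hs].
  - exists C; split; [exact HC |]; intros t s q Hs; unfold affine.
    eapply Rle_trans; [apply Rabs_triang |]; rewrite Rabs_mult, Rmult_1_r.
    apply Rplus_le_compat_l; apply (HB s q t s q t Hs Hs).
  - exists D; split; [exact HD |]; intros s q t Hs.
    pose proof (HE t s q Hs) as a; rewrite Rmult_1_r in a; exact a.
Qed.

Lemma exp_bounded_affine : exp_bounded eps (affine K H X).
Proof.
  apply edom_plus; [| apply LH].
  apply exp_bounded_mult; [apply LK | apply linear_solution_bounded].
Qed.

(** With primes for values at t + h, K'X' - KX = K(X' - X) + (K' - K)X'. So the increment solves a
    linear problem with the kernel at the base angle and a source that is O(|h|), since X' is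
    already bounded. *)
Lemma linear_solution_lip : exp_lip eps X.
Proof.
  pose proof linear_solution_bounded as BX.
  apply (exp_lip_double_integral (affine K H X)); auto.
  - apply tame_affine.
  - apply supported_affine.
  - apply exp_bounded_affine.
  - apply HX.
  - assert (R1 : edom inc_ok inc_age (fun x => Rabs (snd x))
      (fun x => (inc_shift K x - inc_base K x) * inc_shift X x
        + (inc_shift H x - inc_base H x))).
    { apply edom_plus; [| apply edom_inc, LH].
      apply (edom_le _ _ (fun x => Rabs (snd x) * 1) _
        (fun x => (inc_shift K x - inc_base K x) * inc_shift X x)).
      - apply edom_mult; [apply edom_inc, LK | apply edom_inc_shift, BX].
      - intros; split; [apply Rle_refl | rewrite Rmult_1_r; apply Rle_refl]. }
    apply edom_inc_curry in R1; destruct R1 as [C [HC HR]].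
    apply (gronwall_family eps r Heps Hr
      (fun p s q => X s q (fst p + snd p) - X s q (fst p))
      (fun p s q => affine K H X s q (fst p + snd p) - affine K H X s q (fst p))
      (fun p s q => Rabs (K s q (fst p))) (fun p => Rabs (snd p)) kappa); auto.
    + intros; apply Rabs_pos.
    + intros p; apply (tame_minus eps (fun s q => X s q (fst p + snd p))); apply HX.
    + intros p; apply (tame_minus eps (fun s q => affine K H X s q (fst p + snd p)));
        apply tame_affine.
    + intros p s q Hs Hq; rewrite !supported_affine by assumption; ring.
    + intros p s q Hs.
      rewrite (sint3_qint3_minus (fun s q => affine K H X s q (fst p + snd p))
        (fun s q => affine K H X s q (fst p)));
        [| apply tame_affine | apply tame_affine
         | intros u x; apply supported_affine | intros u x; apply supported_affine
         | exact Hs].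
      f_equal; [apply HX, Hs | f_equal; apply HX, Hs].
    + intros; apply Rabs_pos.
    + intros p s Hs; split; [apply ex_RInt_kernel, Hs | apply BK, Hs].
    + exists C; split; [exact HC |]; intros p s q Hs.
      eapply Rle_trans; [| apply Rplus_le_compat_l, (HR p s q Hs)].
      rewrite <- Rabs_mult; eapply Rle_trans; [| apply Rabs_triang].
      right; f_equal; unfold affine, inc_shift, inc_base; simpl; ring.
Qed.

(** The formally differentiated equation has the same kernel. The remainder X' - X - hY solves it
    with the source (K' - K)(X' - X) + (K' - K - h K3)X + (H' - H - h H3), primes denoting values at
    t + h. This is O(h^2): increments of K and X are O(|h|), and K, H have Lipschitz angular
    derivatives. *)
Lemma linear_solution_derive K3 H3 Y :
  exp_lip eps K3 -> exp_lip eps H3 -> supported3 eps r K3 -> supported3 eps r H3 ->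
  (forall s q t, - eps < s -> is_derive (fun t => K s q t) t (K3 s q t)) ->
  (forall s q t, - eps < s -> is_derive (fun t => H s q t) t (H3 s q t)) ->
  linear_solution K (fun s q t => K3 s q t * X s q t + H3 s q t) Y ->
  forall s q t, - eps < s -> is_derive (fun t => X s q t) t (Y s q t).
Proof.
  intros LK3 LH3 SK3 SH3 DK DH HY.
  pose proof linear_solution_lip as LX.
  set (H' := fun s q t => K3 s q t * X s q t + H3 s q t) in *.
  assert (LH' : exp_lip eps H').
  { apply (exp_lip_plus eps (fun s q t => K3 s q t * X s q t)); [| exact LH3].
    apply exp_lip_mult; assumption. }
  assert (SH' : supported3 eps r H').
  { intros s q t Hs Hq; unfold H'; rewrite SK3, SH3 by assumption; ring. }
  assert (TY : forall t, tame eps (fun s q => affine K H' Y s q t)).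
  { intros t.
    apply (tame_plus eps (fun s q => K s q t * Y s q t)); [| apply exp_lip_tame, LH'].
    apply (tame_mult eps (fun s q => K s q t)); [apply exp_lip_tame, LK | apply HY]. }
  assert (SY : supported3 eps r (affine K H' Y)).
  { intros s q t Hs Hq; unfold affine; rewrite SK, SH' by assumption; ring. }
  assert (R1 : edom inc_ok inc_age (fun x => snd x ^ 2)
    (fun x => ((inc_shift K x - inc_base K x) * (inc_shift X x - inc_base X x)
      + (inc_shift K x - inc_base K x - snd x * inc_base K3 x) * inc_base X x)
      + (inc_shift H x - inc_base H x - snd x * inc_base H3 x))).
  { apply edom_plus; [apply edom_plus |].
    - apply edom_inc_square, edom_mult; apply edom_inc; assumption.
    - apply (edom_le _ _ (fun x => snd x ^ 2 * 1) _
        (fun x => (inc_shift K x - inc_base K x - snd x * inc_base K3 x) * inc_base X x)).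
      + apply edom_mult; [apply edom_inc_taylor; assumption | apply edom_inc_base, LX].
      + intros; split; [apply Rle_refl | rewrite Rmult_1_r; apply Rle_refl].
    - apply edom_inc_taylor; assumption. }
  apply edom_inc_curry in R1; destruct R1 as [C [HC HR]].
  assert (G : exists C, 0 <= C /\ forall (p : R * R) s q, - eps < s ->
    Rabs (X s q (fst p + snd p) - X s q (fst p) - snd p * Y s q (fst p))
      <= C * exp (C * Rabs s) * snd p ^ 2).
  { apply (gronwall_family eps r Heps Hr
      (fun p s q => X s q (fst p + snd p) - X s q (fst p) - snd p * Y s q (fst p))
      (fun p s q => affine K H X s q (fst p + snd p) - affine K H X s q (fst p)
        - snd p * affine K H' Y s q (fst p))
      (fun p s q => Rabs (K s q (fst p))) (fun p => snd p ^ 2) kappa); auto.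
    + intros; apply pow2_ge_0.
    + intros p.
      apply (tame_minus eps (fun s q => X s q (fst p + snd p) - X s q (fst p))).
      * apply (tame_minus eps (fun s q => X s q (fst p + snd p))); apply HX.
      * apply tame_scal, HY.
    + intros p.
      apply (tame_minus eps
        (fun s q => affine K H X s q (fst p + snd p) - affine K H X s q (fst p))).
      * apply (tame_minus eps (fun s q => affine K H X s q (fst p + snd p)));
          apply tame_affine.
      * apply tame_scal, TY.
    + intros p s q Hs Hq; rewrite !supported_affine, SY by assumption; ring.
    + intros p s q Hs; apply sint3_qint3_taylor; auto.
      * apply tame_affine.
      * apply supported_affine.
      * apply HX.
      * apply HY.
    + intros; apply Rabs_pos.
    + intros p s Hs; split; [apply ex_RInt_kernel, Hs | apply BK, Hs].
    + exists C; split; [exact HC |]; intros p s q Hs.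
      eapply Rle_trans; [| apply Rplus_le_compat_l, (HR p s q Hs)].
      rewrite <- Rabs_mult; eapply Rle_trans; [| apply Rabs_triang].
      right; f_equal; unfold affine, H', inc_shift, inc_base; cbn [fst snd]; ring. }
  destruct G as [L [HL HG]]; intros s q t Hs.
  apply (is_derive_of_quadratic _ _ _ (L * exp (L * Rabs s)) 1); [lra |].
  intros h _; exact (HG (t, h) s q Hs).
Qed.

End Solution.

(** The angular derivative solves a problem with the same kernel, hence the same [kappa], and a
    source involving [X] itself at order n. The induction hypothesis is therefore used twice, first
    for [X] and then for [Y]. *)
Lemma linear_solution_smooth n kappa K H X :
  0 <= kappa -> exp_smooth eps n K -> exp_smooth eps n H ->
  supported3 eps r K -> supported3 eps r H -> kernel_bound kappa K ->
  linear_solution K H X -> exp_smooth eps n X.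
Proof.
  intros Hkap; revert K H X; induction n; intros K H X HK HH SK SH BK HX.
  - split; [| exact I].
    apply (linear_solution_lip kappa K H X); auto; [apply HK | apply HH].
  - pose proof (exp_smooth_lip eps _ _ HK) as LK.
    pose proof (exp_smooth_lip eps _ _ HH) as LH.
    pose proof (exp_smooth_pred _ _ _ HK) as PK.
    pose proof (exp_smooth_pred _ _ _ HH) as PH.
    pose proof (IHn K H X PK PH SK SH BK HX) as PX.
    destruct HK as [_ [K1 [K2 [K3 [DK [_ [_ SmK3]]]]]]].
    destruct HH as [_ [H1 [H2 [H3 [DH [_ [_ SmH3]]]]]]].
    destruct (supported3_derive eps r K K1 K2 K3 SK DK) as [_ [_ SK3]].
    destruct (supported3_derive eps r H H1 H2 H3 SH DH) as [_ [_ SH3]].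
    set (H' := fun s q t => K3 s q t * X s q t + H3 s q t).
    assert (PH' : exp_smooth eps n H').
    { apply exp_smooth_plus; [apply exp_smooth_mult |]; assumption. }
    assert (SH' : supported3 eps r H').
    { intros s q t Hs Hq; unfold H'; rewrite SK3, SH3 by assumption; ring. }
    destruct (linear_solution_exists K H') as [Y HY]; auto;
      [apply (exp_smooth_lip eps n), PH' |].
    apply (exp_smooth_double_integral n (affine K H X) X Y).
    + apply exp_smooth_plus; [apply exp_smooth_mult |]; assumption.
    + apply supported_affine; assumption.
    + apply HX.
    + apply (linear_solution_lip kappa K H X); assumption.
    + apply (IHn K H' Y); assumption.
    + apply (linear_solution_derive kappa K H X) with (K3 := K3) (H3 := H3); auto;
        try (apply (exp_smooth_lip eps n); assumption).
      * intros; apply DK; assumption.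
      * intros; apply DH; assumption.
Qed.

End Linear_problem.

(** * The solution at a fixed angle *)

Definition clip (m x : R) : R := Rmax (- m) (Rmin m x).

Lemma clip_id m x : Rabs x <= m -> clip m x = x.
Proof.
  intros H; apply Rabs_le_between in H; unfold clip.
  rewrite Rmin_right, Rmax_right; lra.
Qed.

Lemma clip_bound m x : 0 <= m -> Rabs (clip m x) <= m.
Proof.
  intros H; apply Rabs_le; unfold clip, Rmin, Rmax.
  destruct (Rle_dec m x); destruct (Rle_dec (- m) _); lra.
Qed.

(** The threshold varies too, because the inner clip in [potential] has threshold proportional to
    |s|. *)
Lemma clip_lip m m' x x' : Rabs (clip m x - clip m' x') <= Rabs (m - m') + Rabs (x - x').
Proof.
  unfold clip, Rmin.
  destruct (Rle_dec m x), (Rle_dec m' x'); unfold Rmax;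
    repeat match goal with |- context [Rle_dec ?a ?b] => destruct (Rle_dec a b) end;
    unfold Rabs;
    repeat match goal with |- context [Rcase_abs ?a] => destruct (Rcase_abs a) end;
    lra.
Qed.

Lemma clip_lip_r m x x' : Rabs (clip m x - clip m x') <= Rabs (x - x').
Proof.
  pose proof (clip_lip m m x x') as H; rewrite Rminus_diag, Rabs_R0, Rplus_0_l in H.
  exact H.
Qed.

Lemma continuous_clip m x : continuous (clip m) x.
Proof.
  apply (continuous_of_lipschitz _ x 1 1); [lra |]; intros y _.
  rewrite Rmult_1_l; apply clip_lip_r.
Qed.

(** [clip m x] has the sign of [x]. This primitive takes the place of U^2/2 in the conservation law
    for the clipped equation. *)
Lemma clip_primitive_nonneg m u : 0 <= m -> 0 <= RInt (clip m) 0 u.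
Proof.
  intros Hm.
  assert (E : forall a b, ex_RInt (clip m) a b).
  { intros; apply (ex_RInt_continuous (clip m)); intros; apply continuous_clip. }
  destruct (Rle_dec 0 u) as [Hu | Hu].
  - apply RInt_ge_0; [exact Hu | apply E |].
    intros x Hx; unfold clip, Rmin, Rmax.
    destruct (Rle_dec m x); destruct (Rle_dec (- m) _); lra.
  - rewrite <- (opp_RInt_swap (clip m) u 0) by apply E.
    rewrite <- RInt_opp by apply E.
    apply RInt_ge_0; [lra | |].
    + apply (ex_RInt_opp (clip m)), E.
    + intros x Hx; unfold opp; simpl; unfold clip, Rmin, Rmax.
      destruct (Rle_dec m x); destruct (Rle_dec (- m) _); lra.
Qed.

Lemma tame_exp eps f : tame eps f -> tame eps (fun s q => exp (f s q)).
Proof.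
  intros Hf S; destruct (Hf S) as [B [HB H]].
  pose proof (exp_pos B) as PB.
  assert (0 <= exp B * B) by (apply Rmult_le_pos; lra).
  exists (exp B + 2 * (exp B * B)); split; [lra |].
  intros s s' q q' h1 h2 h3 h4.
  assert (Hb : forall u x, - eps < u -> Rabs u <= S -> exp (f u x) <= exp B).
  { intros u x Hu HuS; apply exp_le; destruct (H u u x x Hu Hu HuS HuS) as [a _].
    eapply Rle_trans; [apply Rle_abs | exact a]. }
  split.
  - rewrite Rabs_right by (apply Rle_ge; left; apply exp_pos).
    pose proof (Hb s q h1 h3); lra.
  - destruct (H s s' q q' h1 h2 h3 h4) as [_ b].
    eapply Rle_trans; [apply exp_diff_bound |].
    pose proof (Hb s q h1 h3); pose proof (Hb s' q' h2 h4).
    pose proof (exp_pos (f s q)); pose proof (exp_pos (f s' q')).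
    pose proof (Rabs_pos (s - s')); pose proof (Rabs_pos (q - q')).
    apply Rle_trans with (2 * exp B * (B * (Rabs (s - s') + Rabs (q - q')))).
    + apply Rmult_le_compat; [lra | apply Rabs_pos | lra | exact b].
    + replace (2 * exp B * (B * (Rabs (s - s') + Rabs (q - q'))))
        with (2 * (exp B * B) * (Rabs (s - s') + Rabs (q - q'))) by ring.
      apply Rmult_le_compat_r; lra.
Qed.

(** The mass bound 4r times the bound [a0] on the data; the added 1 keeps the cap positive when
    [a0 = 0]. *)
Definition speed_cap (r a0 : R) : R := 4 * r * a0 + 1.

(* For [- past_time < s <= 0] the factor [exp (G a V)] is at most 2. *)
Definition past_time (r a0 g0 : R) : R := / (2 * (g0 * a0 * speed_cap r a0 + 1)).

(* [potential] is the time integral of [U]. Its rate is clipped at [m], and the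
   inner clip, inactive on solutions, makes the nonlinearity Lipschitz on
   bounded times. *)
Definition potential (r m G : R) (a : R -> R) : R -> R -> R :=
  picard_sol r (clip m)
    (fun s q x => - a q * exp (G * a q * clip (m * Rabs s) x)).

Section Profile.

Variables (r a0 La g0 G : R) (a : R -> R).
Hypothesis Hr : 0 < r.
Hypothesis Ha0 : 0 <= a0.
Hypothesis HLa : 0 <= La.
Hypothesis HG : 0 <= G <= g0.
Hypothesis a_bound : forall q, Rabs (a q) <= a0.
Hypothesis a_lip : forall q q', Rabs (a q - a q') <= La * Rabs (q - q').
Hypothesis a_supp : forall q, r < Rabs q -> a q = 0.

Let M := speed_cap r a0.
Let eps := past_time r a0 g0.
Let V := potential r M G a.
Let P (s q : R) : R := exp (G * a q * V s q).
Let W (s q : R) : R := - a q * P s q.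

Lemma speed_cap_pos : 0 < M.
Proof.
  assert (0 <= r * a0) by (apply Rmult_le_pos; lra); unfold M, speed_cap; lra.
Qed.

Lemma coef_nonneg : 0 <= g0 * a0 * M.
Proof.
  pose proof speed_cap_pos; repeat apply Rmult_le_pos; lra.
Qed.

Lemma past_time_pos : 0 < eps.
Proof.
  pose proof coef_nonneg; apply Rinv_0_lt_compat; unfold M in *; lra.
Qed.

Lemma past_time_spec : g0 * a0 * M * eps <= 1 / 2.
Proof.
  pose proof coef_nonneg as H; unfold eps, past_time; fold M.
  apply Rmult_le_reg_r with (2 * (g0 * a0 * M + 1)); [lra |].
  rewrite Rmult_assoc, Rinv_l by lra; lra.
Qed.

Lemma coef_bound q : Rabs (G * a q) <= g0 * a0.
Proof.
  rewrite Rabs_mult, (Rabs_right G) by lra.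
  apply Rmult_le_compat; [lra | apply Rabs_pos | lra | apply a_bound].
Qed.

Lemma rate_lip S : exists K, 0 <= K /\
  forall s s' q q' x x', - eps < s -> - eps < s' -> Rabs s <= S -> Rabs s' <= S ->
    Rabs (- a q * exp (G * a q * clip (M * Rabs s) 0)) <= K /\
    Rabs (- a q * exp (G * a q * clip (M * Rabs s) x)
          - - a q' * exp (G * a q' * clip (M * Rabs s') x'))
      <= K * (1 + Rabs x) * (Rabs (s - s') + Rabs (q - q')) + K * Rabs (x - x').
Proof.
  pose proof speed_cap_pos as HM.
  set (b0 := g0 * a0).
  assert (Hb0 : 0 <= b0) by (apply Rmult_le_pos; lra).
  set (Y := b0 * (M * Rabs S)).
  assert (HMS : 0 <= M * Rabs S) by (apply Rmult_le_pos; [lra | apply Rabs_pos]).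
  set (e := exp Y); assert (He : 1 <= e) by (apply exp_ge_1, Rmult_le_pos; assumption).
  (* Lipschitz constant of the exponent: the three terms come from varying [a], from the threshold
     moving with |s|, and from varying x. *)
  set (L := g0 * La * (M * Rabs S) + b0 * M + b0).
  assert (H1 : 0 <= g0 * La * (M * Rabs S))
    by (apply Rmult_le_pos; [apply Rmult_le_pos; lra | assumption]).
  assert (H2 : 0 <= b0 * M) by (apply Rmult_le_pos; lra).
  assert (HL : 0 <= L) by (unfold L; lra).
  assert (HLe : 0 <= La * e) by (apply Rmult_le_pos; lra).
  assert (HaeL : 0 <= a0 * (2 * e * L)).
  { apply Rmult_le_pos; [lra |]; apply Rmult_le_pos; lra. }
  exists (a0 + La * e + a0 * (2 * e * L)); split; [lra |].
  intros s s' q q' x x' _ _ HS HS'.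
  pose proof (Rle_abs S) as HSa.
  assert (Hc : forall s x, Rabs s <= S -> Rabs (clip (M * Rabs s) x) <= M * Rabs S).
  { intros u y Hu; eapply Rle_trans; [apply clip_bound |].
    - apply Rmult_le_pos; [lra | apply Rabs_pos].
    - apply Rmult_le_compat_l; lra. }
  assert (Hy : forall s q x, Rabs s <= S -> exp (G * a q * clip (M * Rabs s) x) <= e).
  { intros u z y Hu; apply exp_le.
    eapply Rle_trans; [apply Rle_abs |]; rewrite Rabs_mult.
    apply Rmult_le_compat; try apply Rabs_pos; [apply coef_bound | apply Hc, Hu]. }
  split.
  - rewrite (clip_id _ 0), Rmult_0_r, exp_0, Rmult_1_r, Rabs_Ropp.
    + pose proof (a_bound q); lra.
    + rewrite Rabs_R0; apply Rmult_le_pos; [lra | apply Rabs_pos].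
  - set (y := G * a q * clip (M * Rabs s) x).
    set (y' := G * a q' * clip (M * Rabs s') x').
    pose proof (Rabs_pos (s - s')) as Ps; pose proof (Rabs_pos (q - q')) as Pq.
    pose proof (Rabs_pos (x - x')) as Px; pose proof (Rabs_pos x) as Px0.
    set (d := Rabs (s - s') + Rabs (q - q') + Rabs (x - x')).
    assert (Hyy : Rabs (y - y') <= L * d).
    { unfold y, y'.
      replace (G * a q * clip (M * Rabs s) x - G * a q' * clip (M * Rabs s') x')
        with (G * (a q - a q') * clip (M * Rabs s) x
          + G * a q' * (clip (M * Rabs s) x - clip (M * Rabs s') x')) by ring.
      eapply Rle_trans; [apply Rabs_triang |]; rewrite !(Rabs_mult _ (clip _ _)).
      rewrite (Rabs_mult (G * a q')).
      assert (T1 : Rabs (G * (a q - a q')) * Rabs (clip (M * Rabs s) x)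
        <= g0 * (La * Rabs (q - q')) * (M * Rabs S)).
      { apply Rmult_le_compat; try apply Rabs_pos; [| apply Hc, HS].
        rewrite Rabs_mult, (Rabs_right G) by lra.
        apply Rmult_le_compat; [lra | apply Rabs_pos | lra | apply a_lip]. }
      assert (T2 : Rabs (G * a q') * Rabs (clip (M * Rabs s) x - clip (M * Rabs s') x')
        <= b0 * (M * Rabs (s - s') + Rabs (x - x'))).
      { apply Rmult_le_compat; try apply Rabs_pos; [apply coef_bound |].
        eapply Rle_trans; [apply clip_lip |]; apply Rplus_le_compat_r.
        rewrite <- Rmult_minus_distr_l, Rabs_mult, (Rabs_right M) by lra.
        apply Rmult_le_compat_l; [lra | apply Rabs_triang_inv2]. }
      assert (0 <= g0 * La * (M * Rabs S) * Rabs (s - s')) by (apply Rmult_le_pos; lra).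
      assert (0 <= g0 * La * (M * Rabs S) * Rabs (x - x')) by (apply Rmult_le_pos; lra).
      assert (0 <= b0 * M * Rabs (q - q')) by (apply Rmult_le_pos; lra).
      assert (0 <= b0 * M * Rabs (x - x')) by (apply Rmult_le_pos; lra).
      assert (0 <= b0 * Rabs (s - s')) by (apply Rmult_le_pos; lra).
      assert (0 <= b0 * Rabs (q - q')) by (apply Rmult_le_pos; lra).
      unfold L, d; lra. }
    replace (- a q * exp y - - a q' * exp y')
      with (- ((a q - a q') * exp y + a q' * (exp y - exp y'))) by ring.
    rewrite Rabs_Ropp; eapply Rle_trans; [apply Rabs_triang |].
    assert (T1 : Rabs ((a q - a q') * exp y) <= La * Rabs (q - q') * e).
    { rewrite Rabs_mult, (Rabs_right (exp y)) by (apply Rle_ge; left; apply exp_pos).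
      apply Rmult_le_compat; [apply Rabs_pos | left; apply exp_pos | apply a_lip |].
      apply Hy, HS. }
    assert (T2 : Rabs (a q' * (exp y - exp y')) <= a0 * (2 * e * L) * d).
    { rewrite Rabs_mult.
      replace (a0 * (2 * e * L) * d) with (a0 * (2 * e * (L * d))) by ring.
      apply Rmult_le_compat; try apply Rabs_pos; [apply a_bound |].
      eapply Rle_trans; [apply exp_diff_bound |].
      pose proof (Hy s q x HS) as e1; pose proof (Hy s' q' x' HS') as e2.
      fold y in e1; fold y' in e2; pose proof (exp_pos y); pose proof (exp_pos y').
      apply Rmult_le_compat; [lra | apply Rabs_pos | lra | exact Hyy]. }
    set (K := a0 + La * e + a0 * (2 * e * L)).
    set (p := Rabs (s - s') + Rabs (q - q')) in *.
    assert (0 <= K * Rabs x * p).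
    { apply Rmult_le_pos; [apply Rmult_le_pos |]; unfold K, p; lra. }
    assert (0 <= a0 * (p + Rabs (x - x'))) by (apply Rmult_le_pos; unfold p; lra).
    assert (0 <= La * e * Rabs (s - s')) by (apply Rmult_le_pos; lra).
    assert (0 <= La * e * Rabs (x - x')) by (apply Rmult_le_pos; lra).
    unfold d in T2; fold p in T2.
    replace (K * (1 + Rabs x) * p) with (K * p + K * Rabs x * p) by ring.
    unfold K in *; unfold p in *; lra.
Qed.

Lemma rate_supp s q x :
  - eps < s -> r < Rabs q -> - a q * exp (G * a q * clip (M * Rabs s) x) = 0.
Proof. intros _ Hq; rewrite a_supp by exact Hq; ring. Qed.

Lemma clip_0 : clip M 0 = 0.
Proof. apply clip_id; rewrite Rabs_R0; left; apply speed_cap_pos. Qed.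

Lemma tame_potential : tame eps V.
Proof.
  apply (tame_picard_sol eps r (clip M));
    [apply past_time_pos | exact Hr | exact clip_0 | intros; apply clip_lip_r
    | apply rate_lip | apply rate_supp].
Qed.

Lemma tame_profile : tame eps (fun _ q => a q).
Proof.
  intros S; exists (a0 + La); split; [lra |]; intros s s' q q' _ _ _ _.
  pose proof (Rabs_pos (s - s')); pose proof (Rabs_pos (q - q')).
  split; [pose proof (a_bound q); lra |].
  eapply Rle_trans; [apply a_lip |].
  assert (0 <= La * Rabs (s - s')) by (apply Rmult_le_pos; lra).
  assert (0 <= a0 * (Rabs (s - s') + Rabs (q - q'))) by (apply Rmult_le_pos; lra).
  lra.
Qed.

Lemma tame_P : tame eps P.
Proof.
  apply tame_exp, (tame_mult eps (fun s q => G * a q)); [| apply tame_potential].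
  apply (tame_scal eps G (fun _ q => a q)), tame_profile.
Qed.

Lemma tame_W : tame eps W.
Proof.
  apply (tame_mult eps (fun s q => - a q)); [| apply tame_P].
  intros S; destruct (tame_scal eps (-1) _ tame_profile S) as [B [HB H]].
  exists B; split; [exact HB |]; intros s s' q q' h1 h2 h3 h4.
  replace (- a q) with (-1 * a q) by ring; replace (- a q') with (-1 * a q') by ring.
  exact (H s s' q q' h1 h2 h3 h4).
Qed.

Lemma supported_W : supported eps r W.
Proof. intros s q _ Hq; unfold W; rewrite a_supp by exact Hq; ring. Qed.

Let F (s q x : R) : R := - a q * exp (G * a q * clip (M * Rabs s) x).

Lemma potential_fixed s q : - eps < s -> V s q = picard_step r (clip M) F V s q.
Proof.
  exact (picard_sol_fixed eps r (clip M) F past_time_pos Hr clip_0 (clip_lip_r M)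
    rate_lip rate_supp s q).
Qed.

(** The outer clip caps the rate at [M] by construction, so the inner clip at [M * Rabs s] never
    acts on the solution. *)
Lemma potential_abs s q : - eps < s -> Rabs (V s q) <= M * Rabs s.
Proof.
  intros Hs; rewrite potential_fixed by exact Hs.
  apply (sint_bound eps past_time_pos); [| exact Hs |].
  - exact (tame_rate eps r (clip M) F Hr clip_0 (clip_lip_r M) rate_lip rate_supp V
      tame_potential).
  - intros; apply clip_bound; left; apply speed_cap_pos.
Qed.

Lemma potential_clipped s q :
  - eps < s -> V s q = sint (fun s q => clip M (qint r W s q)) s q.
Proof.
  intros Hs; pose proof past_time_pos as Heps.
  rewrite potential_fixed by exact Hs.
  apply RInt_ext; intros t Ht; f_equal; apply RInt_ext; intros x _.
  destruct (between_0 eps Heps s t Hs) as [h1 _]; [lra |].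
  unfold F, W, P; rewrite clip_id; [reflexivity | apply potential_abs, h1].
Qed.

Lemma tame_clipped_rate : tame eps (fun s q => clip M (qint r W s q)).
Proof.
  apply tame_comp; [exact clip_0 | intros; apply clip_lip_r |].
  apply tame_qint; [exact Hr | apply tame_W | apply supported_W].
Qed.

Lemma is_derive_potential_s s q :
  - eps < s -> is_derive (fun s => V s q) s (clip M (qint r W s q)).
Proof.
  intros Hs; pose proof past_time_pos as Heps.
  refine (is_derive_ext_loc (fun s => sint (fun s q => clip M (qint r W s q)) s q)
    _ s _ _ _).
  - apply (filter_imp (fun s' => - eps < s')); [| apply (open_gt (- eps) s Hs)].
    intros s' Hs'; symmetry; apply potential_clipped, Hs'.
  - apply (is_derive_RInt (fun s => clip M (qint r W s q))
      (fun s => sint (fun s q => clip M (qint r W s q)) s q) 0 s).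
    + apply (filter_imp (fun s' => - eps < s')); [| apply (open_gt (- eps) s Hs)].
      intros s' Hs'; apply (RInt_correct (fun s => clip M (qint r W s q))).
      apply (tame_ex_RInt_s eps Heps (fun s q => clip M (qint r W s q)));
        [apply tame_clipped_rate | exact Hs'].
    + apply (tame_continuous_s eps (fun s q => clip M (qint r W s q)));
        [apply tame_clipped_rate | exact Hs].
Qed.

(** The quantity behind all global estimates: times [a0] it bounds |U|, and times a constant it
    bounds the integral of the kernel of the linearised equation. *)
Let mass (s : R) : R := RInt (P s) (- r) r.
Let Ps (s q : R) : R := G * a q * clip M (qint r W s q) * P s q.

Lemma tame_Ps : tame eps Ps.
Proof.
  apply (tame_mult eps (fun s q => G * a q * clip M (qint r W s q))); [| apply tame_P].
  apply (tame_mult eps (fun s q => G * a q)); [| apply tame_clipped_rate].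
  apply (tame_scal eps G (fun _ q => a q)), tame_profile.
Qed.

Lemma is_derive_P_s s q : - eps < s -> is_derive (fun s => P s q) s (Ps s q).
Proof.
  intros Hs; pose proof (is_derive_potential_s s q Hs) as D.
  unfold Ps, P.
  apply (is_derive_comp exp (fun s => G * a q * V s q) s
    (exp (G * a q * V s q)) (G * a q * clip M (qint r W s q))).
  - apply is_derive_Reals, derivable_pt_lim_exp.
  - apply (is_derive_scal (fun s => V s q) s (G * a q)), D.
Qed.

Lemma is_derive_mass s : - eps < s -> is_derive mass s (RInt (Ps s) (- r) r).
Proof.
  intros Hs.
  destruct (tame_Ps (Rabs s + 1)) as [B [HB H]].
  apply (is_derive_RInt_of_quadratic P (Ps s) (- r) r s B (Rmin 1 (eps + s))).
  - apply Rmin_pos; lra.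
  - intros h Hh; apply (tame_ex_RInt_q eps); [apply tame_P |].
    apply (near_time eps s h (s + h) Hh); replace (s + h - s) with h by ring; apply Rle_refl.
  - apply (tame_ex_RInt_q eps); [apply tame_Ps | exact Hs].
  - intros h u Hh _.
    apply (quadratic_of_lipschitz_derive (fun s => P s u) (fun s => Ps s u)).
    intros y Hy; destruct (near_time eps s h y Hh Hy) as [y1 y2].
    split; [apply is_derive_P_s, y1 |].
    destruct (H y s u u y1 Hs) as [_ b]; [exact y2 | lra |].
    rewrite Rminus_diag, Rabs_R0, Rplus_0_r in b; exact b.
Qed.

(* [G a P = G U_q] for [U = qint r W], so the time derivative of the mass is
   [G] times the boundary values of a primitive of [clip M] at [U]. *)
Lemma mass_derivative_nonpos s : - eps < s -> RInt (Ps s) (- r) r <= 0.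
Proof.
  intros Hs; pose proof speed_cap_pos as HM.
  set (U := qint r W s).
  assert (Ec : forall x y, ex_RInt (clip M) x y).
  { intros; apply (ex_RInt_continuous (clip M)); intros; apply continuous_clip. }
  assert (DU : forall q, is_derive U q (a q * P s q)).
  { intros q; replace (a q * P s q) with (opp (W s q))
      by (unfold W, opp; simpl; ring).
    apply (is_derive_RInt' (W s) U q r).
    - apply filter_forall; intros q'; apply (RInt_correct (W s)).
      apply (tame_ex_RInt_q eps); [apply tame_W | exact Hs].
    - apply (tame_continuous_q eps); [apply tame_W | exact Hs]. }
  set (Phi := fun q => G * RInt (clip M) 0 (U q)).
  assert (DPhi : forall q, is_derive Phi q (Ps s q)).
  { intros q; unfold Phi, Ps.
    replace (G * a q * clip M (qint r W s q) * P s q)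
      with (G * (a q * P s q * clip M (U q))) by (unfold U; ring).
    apply (is_derive_scal (fun q => RInt (clip M) 0 (U q))).
    apply (is_derive_comp (fun u => RInt (clip M) 0 u) U q (clip M (U q)) (a q * P s q));
      [| apply DU].
    apply (is_derive_RInt (clip M) (fun u => RInt (clip M) 0 u) 0);
      [| apply continuous_clip].
    apply filter_forall; intros u; apply (RInt_correct (clip M)), Ec. }
  assert (I : is_RInt (Ps s) (- r) r (Phi r - Phi (- r))).
  { apply (is_RInt_derive Phi (Ps s)); intros; [apply DPhi |].
    apply (tame_continuous_q eps); [apply tame_Ps | exact Hs]. }
  rewrite (is_RInt_unique _ _ _ _ I).
  assert (U0 : U r = 0) by (apply (RInt_point r (W s))).
  unfold Phi; rewrite U0, (RInt_point 0 (clip M)).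
  change (@zero R_CompleteNormedModule) with 0.
  pose proof (clip_primitive_nonneg M (U (- r)) (Rlt_le _ _ HM)) as H1.
  assert (0 <= G * RInt (clip M) 0 (U (- r))) by (apply Rmult_le_pos; [lra | exact H1]).
  lra.
Qed.

Lemma potential_0 q : V 0 q = 0.
Proof.
  pose proof past_time_pos.
  rewrite potential_clipped by lra.
  apply (RInt_point 0 (fun s => clip M (qint r W s q))).
Qed.

Lemma mass_0 : mass 0 = 2 * r.
Proof.
  unfold mass; rewrite (RInt_ext (P 0) (fun _ => 1)).
  - rewrite RInt_cst; ring.
  - intros; unfold P; rewrite potential_0, Rmult_0_r, exp_0; reflexivity.
Qed.

Lemma mass_future s : 0 <= s -> mass s <= 2 * r.
Proof.
  intros Hs; pose proof past_time_pos as Heps.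
  destruct (MVT_gen mass 0 s (fun s => RInt (Ps s) (- r) r)) as [c [Hc E]].
  - intros x; rewrite Rmin_left, Rmax_right by exact Hs; intros Hx.
    apply is_derive_mass; lra.
  - intros x; rewrite Rmin_left, Rmax_right by exact Hs; intros Hx.
    apply continuity_pt_filterlim, (ex_derive_continuous mass).
    exists (RInt (Ps x) (- r) r); apply is_derive_mass; lra.
  - rewrite Rmin_left, Rmax_right in Hc by exact Hs.
    assert (N : RInt (Ps c) (- r) r <= 0) by (apply mass_derivative_nonpos; lra).
    rewrite mass_0 in E.
    assert (0 <= - RInt (Ps c) (- r) r * (s - 0)) by (apply Rmult_le_pos; lra).
    lra.
Qed.

Lemma P_past s q : - eps < s -> s <= 0 -> P s q <= 2.
Proof.
  intros Hs Hs0; pose proof past_time_spec as H.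
  apply Rle_trans with (exp (1 / 2)).
  - apply exp_le; eapply Rle_trans; [apply Rle_abs |]; rewrite Rabs_mult.
    eapply Rle_trans; [| apply H].
    rewrite (Rmult_assoc (g0 * a0)); apply Rmult_le_compat; try apply Rabs_pos.
    + apply coef_bound.
    + eapply Rle_trans; [apply potential_abs, Hs |].
      apply Rmult_le_compat_l; [left; apply speed_cap_pos |].
      rewrite Rabs_left1 by exact Hs0; lra.
  - pose proof (exp_pos (1 / 2)) as H0.
    assert (E : exp (1 / 2) * exp (1 / 2) = exp 1) by (rewrite <- exp_plus; f_equal; lra).
    (* The square of exp(1/2) is e, which is at most 3 and so less than 4. *)
    pose proof exp_le_3 as H3.
    destruct (Rle_dec (exp (1 / 2)) 2) as [h | h]; [exact h |].
    assert (2 * 2 <= exp (1 / 2) * exp (1 / 2)) by (apply Rmult_le_compat; lra).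
    lra.
Qed.

(** For s >= 0 the mass never exceeds its initial value 2r; in the short past the integrand is at
    most 2 on an interval of length 2r. *)
Lemma mass_bound s : - eps < s -> mass s <= 4 * r.
Proof.
  intros Hs; destruct (Rle_dec 0 s) as [H | H].
  - pose proof (mass_future s H); lra.
  - apply Rle_trans with (RInt (fun _ => 2) (- r) r).
    + apply RInt_le; [lra | | apply (ex_RInt_const (- r) r 2) |].
      * apply (tame_ex_RInt_q eps); [apply tame_P | exact Hs].
      * intros; apply P_past; lra.
    + rewrite RInt_cst; lra.
Qed.

(** Here the outer clip is seen to be inactive. The mass bound was obtained for the clipped
    equation, so there is no circularity. *)
Lemma rate_bound s q : - eps < s -> Rabs (qint r W s q) <= M.
Proof.
  intros Hs.
  assert (E : ex_RInt (P s) (- r) r)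
    by (apply (tame_ex_RInt_q eps); [apply tame_P | exact Hs]).
  apply (tail_RInt_bound (W s) (fun x => a0 * P s x)); [exact Hr | | | | |].
  - intros; apply (tame_continuous_q eps); [apply tame_W | exact Hs].
  - intros; apply supported_W; assumption.
  - exact (ex_RInt_scal (P s) (- r) r a0 E).
  - intros x _; unfold W; rewrite Rabs_mult, Rabs_Ropp.
    rewrite (Rabs_right (P s x)) by (apply Rle_ge; left; apply exp_pos).
    apply Rmult_le_compat_r; [left; apply exp_pos | apply a_bound].
  - rewrite RInt_scal_l by exact E.
    pose proof (mass_bound s Hs) as Hm; unfold mass in Hm.
    pose proof (Rmult_le_compat_l a0 _ _ Ha0 Hm); unfold M, speed_cap; lra.
Qed.

Lemma potential_eq s q : - eps < s -> V s q = sint (qint r W) s q.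
Proof.
  intros Hs; pose proof past_time_pos as Heps.
  rewrite potential_clipped by exact Hs.
  apply RInt_ext; intros t Ht; apply clip_id, rate_bound.
  destruct (between_0 eps Heps s t Hs) as [h1 _]; [lra | exact h1].
Qed.

End Profile.

(** * Dependence on the angle *)

Section Angular_family.

Variables (r a0 La g0 : R) (A : R -> R -> R) (Gt : R -> R).
Hypothesis Hr : 0 < r.
Hypothesis Ha0 : 0 <= a0.
Hypothesis HLa : 0 <= La.
Hypothesis HG : forall t, 0 <= Gt t <= g0.
Hypothesis A_bound : forall q t, Rabs (A q t) <= a0.
Hypothesis A_lip : forall q q' t, Rabs (A q t - A q' t) <= La * Rabs (q - q').
Hypothesis A_supp : forall q t, r < Rabs q -> A q t = 0.

Let M := speed_cap r a0.
Let eps := past_time r a0 g0.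
Let A3 (s q t : R) : R := A q t.
Let B (s q t : R) : R := Gt t * A q t.
Let V (s q t : R) : R := potential r M (Gt t) (fun q => A q t) s q.
Let P (s q t : R) : R := exp (B s q t * V s q t).
Let W (s q t : R) : R := - A q t * P s q t.

Hypothesis A_smooth : forall n, exp_smooth eps n A3.
Hypothesis B_smooth : forall n, exp_smooth eps n B.

Let Hg0 : 0 <= g0.
Proof. pose proof (HG 0); lra. Qed.

Let Heps : 0 < eps.
Proof. apply (past_time_pos r a0 g0 (Gt 0)); auto. Qed.

Let HM : 0 < M.
Proof. apply speed_cap_pos; assumption. Qed.

Let tame_V t : tame eps (fun s q => V s q t).
Proof. exact (tame_potential r a0 La g0 (Gt t) (fun q => A q t) Hr Ha0 HLa (HG t)
  (fun q => A_bound q t) (fun q q' => A_lip q q' t) (fun q => A_supp q t)). Qed.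

Let tame_W3 t : tame eps (fun s q => W s q t).
Proof. exact (tame_W r a0 La g0 (Gt t) (fun q => A q t) Hr Ha0 HLa (HG t)
  (fun q => A_bound q t) (fun q q' => A_lip q q' t) (fun q => A_supp q t)). Qed.

Let tame_P3 t : tame eps (fun s q => P s q t).
Proof. exact (tame_P r a0 La g0 (Gt t) (fun q => A q t) Hr Ha0 HLa (HG t)
  (fun q => A_bound q t) (fun q q' => A_lip q q' t) (fun q => A_supp q t)). Qed.

Let V_abs s q t : - eps < s -> Rabs (V s q t) <= M * Rabs s.
Proof. exact (potential_abs r a0 La g0 (Gt t) (fun q => A q t) Hr Ha0 HLa (HG t)
  (fun q => A_bound q t) (fun q q' => A_lip q q' t) (fun q => A_supp q t) s q). Qed.

Let V_eq s q t : - eps < s -> V s q t = sint3 (qint3 r W) s q t.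
Proof. exact (potential_eq r a0 La g0 (Gt t) (fun q => A q t) Hr Ha0 HLa (HG t)
  (fun q => A_bound q t) (fun q q' => A_lip q q' t) (fun q => A_supp q t) s q). Qed.

Let P_mass s t : - eps < s -> RInt (fun q => P s q t) (- r) r <= 4 * r.
Proof. exact (mass_bound r a0 La g0 (Gt t) (fun q => A q t) Hr Ha0 HLa (HG t)
  (fun q => A_bound q t) (fun q q' => A_lip q q' t) (fun q => A_supp q t) s). Qed.

Let supported_W3 : supported3 eps r W.
Proof. intros s q t _ Hq; unfold W; rewrite A_supp by exact Hq; ring. Qed.

Let b0 := g0 * a0.

Let Hb0 : 0 <= b0.
Proof. apply Rmult_le_pos; assumption. Qed.

Let B_bound s q t : Rabs (B s q t) <= b0.
Proof. apply coef_bound; auto. Qed.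

Let P_pos s q t : 0 < P s q t.
Proof. apply exp_pos. Qed.

(** The exponent is at most a constant times |s| because |V| <= M|s|. The case k = 1 serves U_q and
    the reciprocal of mu, and k = -1 serves mu. *)
Lemma exp_bounded_exp_potential k :
  Rabs k <= 1 -> exp_bounded eps (fun s q t => exp (k * (B s q t * V s q t))).
Proof.
  intros Hk; apply exp_bounded_intro.
  assert (HbM : 0 <= b0 * M) by (apply Rmult_le_pos; lra).
  exists (1 + b0 * M); split; [lra |]; intros s q t Hs.
  rewrite Rabs_right by (apply Rle_ge; left; apply exp_pos).
  pose proof (Rabs_pos s) as Ps.
  apply Rle_trans with (1 * exp ((1 + b0 * M) * Rabs s)).
  - rewrite Rmult_1_l; apply exp_le.
    eapply Rle_trans; [apply Rle_abs |]; rewrite !Rabs_mult.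
    assert (H : Rabs (B s q t) * Rabs (V s q t) <= b0 * (M * Rabs s)).
    { apply Rmult_le_compat; try apply Rabs_pos; [apply B_bound | apply V_abs, Hs]. }
    assert (0 <= Rabs (B s q t) * Rabs (V s q t))
      by (apply Rmult_le_pos; apply Rabs_pos).
    pose proof (Rmult_le_compat_r _ _ _ H0 Hk); lra.
  - apply Rmult_le_compat_r; [left; apply exp_pos | lra].
Qed.

Let P_bounded : exp_bounded eps P.
Proof.
  apply (edom_ext _ _ _ _ _ (exp_bounded_exp_potential 1
    (Req_le _ _ (Rabs_right 1 (Rle_ge _ _ Rle_0_1))))).
  intros p _; unfold at3, P; rewrite Rmult_1_l; reflexivity.
Qed.

Let V_bounded : exp_bounded eps V.
Proof.
  apply exp_bounded_intro; exists (M + 1); split; [lra |]; intros s q t Hs.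
  pose proof (Rabs_pos s) as Ps; eapply Rle_trans; [apply V_abs, Hs |].
  pose proof (exp_ineq1_le ((M + 1) * Rabs s)).
  assert (0 <= M * Rabs s) by (apply Rmult_le_pos; lra).
  apply Rmult_le_compat; lra.
Qed.

Let A_elip : exp_lip eps A3.
Proof. exact (exp_smooth_lip eps 0 _ (A_smooth 0)). Qed.

Let B_elip : exp_lip eps B.
Proof. exact (exp_smooth_lip eps 0 _ (B_smooth 0)). Qed.

Let W_bounded : exp_bounded eps W.
Proof.
  apply (edom_ext _ _ _ _ _ (edom_scal _ _ _ _ (-1)
    (exp_bounded_mult eps A3 P (proj1 A_elip) P_bounded))).
  intros p _; unfold at3, A3, W; ring.
Qed.

Let ex_RInt_P s t : - eps < s -> ex_RInt (fun q => P s q t) (- r) r.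
Proof.
  intros Hs; apply (tame_ex_RInt_q eps (fun s q => P s q t)); auto.
Qed.

(** [a0 * b0] bounds |A B|, and P at the two angles t and t + h has mass at most 4r each. *)
Let kappa := 8 * r * (a0 * b0).

Let Hkappa : 0 <= kappa.
Proof.
  assert (0 <= r * (a0 * b0)).
  { apply Rmult_le_pos; [lra | apply Rmult_le_pos; assumption]. }
  unfold kappa; lra.
Qed.

(** The equation is nonlinear in V, so the increment is handled by [exp_diff_bound]: the kernel
    contains P at both angles, and its $q$-integral is bounded by two mass bounds. *)
Lemma exp_lip_potential : exp_lip eps V.
Proof.
  apply (exp_lip_double_integral eps r Heps Hr W); auto.
  assert (R1 : edom (inc_ok eps) inc_age (fun x => Rabs (snd x))
    (fun x => Rabs ((inc_shift A3 x - inc_base A3 x) * inc_shift P x)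
      + Rabs ((inc_shift B x - inc_base B x)
          * (inc_base A3 x * (inc_base P x + inc_shift P x) * inc_shift V x)))).
  { apply edom_plus; apply edom_abs, edom_unit_r, edom_mult.
    - apply edom_inc, A_elip.
    - apply edom_inc_shift, P_bounded.
    - apply edom_inc, B_elip.
    - apply edom_unit, edom_mult; [| apply edom_inc_shift, V_bounded].
      apply edom_unit, edom_mult; [apply edom_inc_base, A_elip |].
      apply edom_plus; [apply edom_inc_base | apply edom_inc_shift]; apply P_bounded. }
  apply edom_inc_curry in R1; destruct R1 as [C [HC HR]].
  apply (gronwall_family eps r Heps Hr
    (fun p s q => V s q (fst p + snd p) - V s q (fst p))
    (fun p s q => W s q (fst p + snd p) - W s q (fst p))
    (fun p s q => a0 * b0 * (P s q (fst p) + P s q (fst p + snd p)))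
    (fun p => Rabs (snd p)) kappa); auto.
  - intros; apply Rabs_pos.
  - intros p; apply (tame_minus eps (fun s q => V s q (fst p + snd p))); apply tame_V.
  - intros p; apply (tame_minus eps (fun s q => W s q (fst p + snd p))); apply tame_W3.
  - intros p s q Hs Hq; rewrite !supported_W3 by assumption; ring.
  - intros p s q Hs.
    rewrite (sint3_qint3_minus eps r Heps Hr (fun s q => W s q (fst p + snd p))
      (fun s q => W s q (fst p)));
      [| apply tame_W3 | apply tame_W3 | intros u x; apply supported_W3
       | intros u x; apply supported_W3 | exact Hs].
    f_equal; [apply V_eq, Hs | f_equal; apply V_eq, Hs].
  - intros p s q Hs; pose proof (P_pos s q (fst p)); pose proof (P_pos s q (fst p + snd p)).
    apply Rmult_le_pos; [apply Rmult_le_pos; assumption | lra].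
  - intros p s Hs.
    pose proof (ex_RInt_P s (fst p) Hs) as E1.
    pose proof (ex_RInt_P s (fst p + snd p) Hs) as E2.
    assert (E3 : ex_RInt (fun q => P s q (fst p) + P s q (fst p + snd p)) (- r) r)
      by exact (ex_RInt_plus _ _ (- r) r E1 E2).
    split; [exact (ex_RInt_scal _ (- r) r (a0 * b0) E3) |].
    rewrite RInt_scal_l by exact E3.
    assert (Ip : RInt (fun q => P s q (fst p) + P s q (fst p + snd p)) (- r) r
      = RInt (fun q => P s q (fst p)) (- r) r
        + RInt (fun q => P s q (fst p + snd p)) (- r) r)
      by exact (RInt_plus (V := R_CompleteNormedModule) _ _ (- r) r E1 E2).
    rewrite Ip; pose proof (P_mass s (fst p) Hs); pose proof (P_mass s (fst p + snd p) Hs).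
    unfold kappa; replace (8 * r * (a0 * b0)) with (a0 * b0 * (8 * r)) by ring.
    apply Rmult_le_compat_l; [apply Rmult_le_pos; assumption | lra].
  - exists C; split; [exact HC |]; intros [t h] s q Hs.
    pose proof (HR (t, h) s q Hs) as HRp.
    unfold inc_shift, inc_base, A3 in HRp; cbn [fst snd] in *.
    (* [e1] carries the increment of the factor A, and [e2] that of the coefficient B in the
       exponent; both are O(|h|). The rest of the increment of W is controlled by that of V. *)
    set (e1 := (A q (t + h) - A q t) * P s q (t + h)) in *.
    set (e2 := (B s q (t + h) - B s q t)
      * (A q t * (P s q t + P s q (t + h)) * V s q (t + h))) in *.
    apply Rle_trans with
      (a0 * b0 * (P s q t + P s q (t + h)) * Rabs (V s q (t + h) - V s q t)
        + (Rabs e1 + Rabs e2)).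
    2:{ apply Rplus_le_compat_l; eapply Rle_trans; [apply Rle_abs | exact HRp]. }
    unfold W.
    replace (- A q (t + h) * P s q (t + h) - - A q t * P s q t)
      with (- e1 + - (A q t * (P s q (t + h) - P s q t))) by (unfold e1; ring).
    eapply Rle_trans; [apply Rabs_triang |]; rewrite !Rabs_Ropp.
    enough (Rabs (A q t * (P s q (t + h) - P s q t))
      <= a0 * b0 * (P s q t + P s q (t + h)) * Rabs (V s q (t + h) - V s q t)
        + Rabs e2) by lra.
    pose proof (P_pos s q t) as p1; pose proof (P_pos s q (t + h)) as p2.
    set (x := B s q t * V s q t); set (x' := B s q (t + h) * V s q (t + h)).
    apply Rle_trans with (Rabs (A q t * (P s q t + P s q (t + h)) * (x' - x))).
    + rewrite !Rabs_mult, Rmult_assoc; apply Rmult_le_compat_l; [apply Rabs_pos |].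
      rewrite (Rabs_right (P s q t + P s q (t + h))) by lra.
      rewrite (Rplus_comm (P s q t)); apply exp_diff_bound.
    + replace (A q t * (P s q t + P s q (t + h)) * (x' - x))
        with (A q t * B s q t * (P s q t + P s q (t + h)) * (V s q (t + h) - V s q t)
          + e2) by (unfold e2, x, x'; ring).
      eapply Rle_trans; [apply Rabs_triang |]; apply Rplus_le_compat_r.
      rewrite !Rabs_mult, (Rabs_right (P s q t + P s q (t + h))) by lra.
      apply Rmult_le_compat_r; [apply Rabs_pos |].
      apply Rmult_le_compat_r; [lra |].
      apply Rmult_le_compat; try apply Rabs_pos; [apply A_bound | apply B_bound].
Qed.

Let P_elip : exp_lip eps P.
Proof.
  apply exp_lip_exp; [exact P_bounded |].
  apply exp_lip_mult; [exact B_elip | apply exp_lip_potential].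
Qed.

(** The partial derivative of W with respect to V. *)
Let K (s q t : R) : R := -1 * (A3 s q t * (B s q t * P s q t)).

Lemma kernel_bound_potential : kernel_bound eps r kappa K.
Proof.
  intros s t Hs; pose proof (ex_RInt_P s t Hs) as E.
  apply Rle_trans with (RInt (fun q => a0 * b0 * P s q t) (- r) r).
  - apply RInt_le; [lra | | exact (ex_RInt_scal _ (- r) r (a0 * b0) E) |].
    + apply (ex_RInt_norm (fun q => K s q t)).
      apply (tame_ex_RInt_q eps (fun s q => K s q t)); [| exact Hs].
      apply tame_scal, (tame_mult eps (fun s q => A3 s q t));
        [apply exp_lip_tame, A_elip |].
      apply (tame_mult eps (fun s q => B s q t)); [apply exp_lip_tame, B_elip | auto].
    + intros q _; unfold K, A3; rewrite !Rabs_mult, Rabs_m1, Rmult_1_l.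
      rewrite (Rabs_right (P s q t)) by (pose proof (P_pos s q t); lra).
      rewrite <- Rmult_assoc; apply Rmult_le_compat_r; [left; apply P_pos |].
      apply Rmult_le_compat; try apply Rabs_pos; [apply A_bound | apply B_bound].
  - rewrite RInt_scal_l by exact E; pose proof (P_mass s t Hs).
    unfold kappa; replace (8 * r * (a0 * b0)) with (a0 * b0 * (8 * r)) by ring.
    apply Rmult_le_compat_l; [apply Rmult_le_pos; assumption | lra].
Qed.

(** [Y] solves the formally differentiated equation. The remainder of V then solves a linear problem
    with kernel [K], whose source consists of Taylor remainders of A, B and exp and of products of
    two increments, all O(h^2) by [exp_lip_potential]. *)
Lemma potential_derive At Bt Y :
  exp_lip eps At -> exp_lip eps Bt -> supported3 eps r At ->
  (forall s q t, - eps < s -> is_derive (fun t => A3 s q t) t (At s q t)) ->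
  (forall s q t, - eps < s -> is_derive (fun t => B s q t) t (Bt s q t)) ->
  linear_solution eps r K
    (fun s q t => -1 * (At s q t * P s q t + A3 s q t * (Bt s q t * (V s q t * P s q t))))
    Y ->
  forall s q t, - eps < s -> is_derive (fun t => V s q t) t (Y s q t).
Proof.
  intros LAt LBt SAt DA DB HY.
  pose proof exp_lip_potential as LV.
  set (H := fun s q t =>
    -1 * (At s q t * P s q t + A3 s q t * (Bt s q t * (V s q t * P s q t)))) in *.
  assert (LK : exp_lip eps K).
  { apply (exp_lip_mult eps (fun _ _ _ => -1)); [apply exp_lip_const |].
    apply exp_lip_mult; [exact A_elip | apply exp_lip_mult; assumption]. }
  assert (LH : exp_lip eps H).
  { apply (exp_lip_mult eps (fun _ _ _ => -1)); [apply exp_lip_const |].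
    apply (exp_lip_plus eps (fun s q t => At s q t * P s q t));
      repeat apply exp_lip_mult; assumption. }
  assert (SY : supported3 eps r (affine K H Y)).
  { intros s q t Hs Hq; unfold affine, K, H, A3.
    rewrite SAt, A_supp by assumption; ring. }
  assert (TY : forall t, tame eps (fun s q => affine K H Y s q t)).
  { intros t.
    apply (tame_plus eps (fun s q => K s q t * Y s q t)); [| apply exp_lip_tame, LH].
    apply (tame_mult eps (fun s q => K s q t)); [apply exp_lip_tame, LK | apply HY]. }
  (* The remainder of exp at second order in its exponent [B V], which is quadratic in h because the
     exponent is Lipschitz in the angle. *)
  set (rho := fun x => inc_shift P x - inc_base P x
    - inc_base P x * (inc_shift (fun s q t => B s q t * V s q t) x
                      - inc_base (fun s q t => B s q t * V s q t) x)).
  assert (Rrho : edom (inc_ok eps) inc_age (fun x => snd x ^ 2) rho).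
  { apply (edom_le _ _ (fun x => snd x ^ 2) _ (fun x =>
      (inc_shift P x + inc_base P x)
      * (inc_shift (fun s q t => B s q t * V s q t) x
         - inc_base (fun s q t => B s q t * V s q t) x) ^ 2)).
    - apply edom_unit, edom_mult.
      + apply edom_plus; [apply edom_inc_shift | apply edom_inc_base]; apply P_bounded.
      + apply edom_inc_square; simpl pow.
        assert (E : edom (inc_ok eps) inc_age (fun x => Rabs (snd x))
          (fun x => inc_shift (fun s q t => B s q t * V s q t) x
            - inc_base (fun s q t => B s q t * V s q t) x)).
        { apply edom_inc, exp_lip_mult; assumption. }
        apply (edom_ext _ _ _ _ _ (edom_mult _ _ _ _ _ _ E E)).
        intros; ring.
    - intros x _; split; [| apply Rle_refl].
      rewrite Rabs_mult, (Rabs_right (_ + _)), (Rabs_right (_ ^ 2)).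
      + apply exp_taylor2_bound.
      + apply Rle_ge, pow2_ge_0.
      + unfold inc_shift, inc_base; apply Rle_ge, Rplus_le_le_0_compat; left; apply P_pos. }
  assert (R1 : edom (inc_ok eps) inc_age (fun x => snd x ^ 2)
    (fun x => -1 * ((inc_shift A3 x - inc_base A3 x - snd x * inc_base At x) * inc_base P x
      + (inc_shift A3 x - inc_base A3 x) * (inc_shift P x - inc_base P x)
      + inc_base A3 x * rho x
      + (inc_shift B x - inc_base B x - snd x * inc_base Bt x)
        * (inc_base A3 x * (inc_base P x * inc_base V x))
      + (inc_shift B x - inc_base B x) * (inc_shift V x - inc_base V x)
        * (inc_base A3 x * inc_base P x)))).
  { apply edom_scal; repeat apply edom_plus.
    - apply edom_unit_r, edom_mult; [apply edom_inc_taylor; assumption |].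
      apply edom_inc_base, P_bounded.
    - apply edom_inc_square, edom_mult; apply edom_inc; assumption.
    - apply edom_unit, edom_mult; [apply edom_inc_base, A_elip | exact Rrho].
    - apply edom_unit_r, edom_mult; [apply edom_inc_taylor; assumption |].
      apply edom_unit, edom_mult; [apply edom_inc_base, A_elip |].
      apply edom_unit, edom_mult; apply edom_inc_base; assumption.
    - apply edom_unit_r, edom_mult.
      + apply edom_inc_square, edom_mult; apply edom_inc; assumption.
      + apply edom_unit, edom_mult; apply edom_inc_base; [apply A_elip | assumption]. }
  apply edom_inc_curry in R1; destruct R1 as [C [HC HR]].
  assert (G : exists C, 0 <= C /\ forall (p : R * R) s q, - eps < s ->
    Rabs (V s q (fst p + snd p) - V s q (fst p) - snd p * Y s q (fst p))
      <= C * exp (C * Rabs s) * snd p ^ 2).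
  { apply (gronwall_family eps r Heps Hr
      (fun p s q => V s q (fst p + snd p) - V s q (fst p) - snd p * Y s q (fst p))
      (fun p s q => W s q (fst p + snd p) - W s q (fst p)
        - snd p * affine K H Y s q (fst p))
      (fun p s q => Rabs (K s q (fst p))) (fun p => snd p ^ 2) kappa); auto.
    + intros; apply pow2_ge_0.
    + intros p.
      apply (tame_minus eps (fun s q => V s q (fst p + snd p) - V s q (fst p))).
      * apply (tame_minus eps (fun s q => V s q (fst p + snd p))); apply tame_V.
      * apply tame_scal, HY.
    + intros p.
      apply (tame_minus eps (fun s q => W s q (fst p + snd p) - W s q (fst p))).
      * apply (tame_minus eps (fun s q => W s q (fst p + snd p))); apply tame_W3.
      * apply tame_scal, TY.
    + intros p s q Hs Hq; rewrite !supported_W3, SY by assumption; ring.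
    + intros p s q Hs; apply (sint3_qint3_taylor eps r Heps Hr); auto.
      apply HY.
    + intros; apply Rabs_pos.
    + intros p s Hs; split; [| apply kernel_bound_potential, Hs].
      apply (ex_RInt_kernel eps r K LK); exact Hs.
    + exists C; split; [exact HC |]; intros p s q Hs.
      eapply Rle_trans; [| apply Rplus_le_compat_l, (HR p s q Hs)].
      rewrite <- Rabs_mult; eapply Rle_trans; [| apply Rabs_triang].
      right; f_equal; unfold affine, H, K, W, A3, rho, inc_shift, inc_base;
        cbn [fst snd]; ring. }
  destruct G as [L [HL HGL]]; intros s q t Hs.
  apply (is_derive_of_quadratic _ _ _ (L * exp (L * Rabs s)) 1); [lra |].
  intros h _; exact (HGL (t, h) s q Hs).
Qed.

(** V at order n makes P, and with it the kernel and source of the equation for [Y], of order n. The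
    linear theory gives [Y] order n, and the double integral of W then raises V to order n+1. *)
Lemma exp_smooth_potential n : exp_smooth eps n V.
Proof.
  induction n; [split; [apply exp_lip_potential | exact I] |].
  pose proof (A_smooth n) as PA; pose proof (B_smooth n) as PB.
  assert (PP : exp_smooth eps n P).
  { apply exp_smooth_exp; [exact P_bounded |]; apply exp_smooth_mult; assumption. }
  destruct (A_smooth (S n)) as [_ [A1 [A2 [At [DA [_ [_ SAt]]]]]]].
  destruct (B_smooth (S n)) as [_ [B1 [B2 [Bt [DB [_ [_ SBt]]]]]]].
  assert (SuppA : supported3 eps r A3) by (intros s q t _; apply A_supp).
  destruct (supported3_derive eps r A3 A1 A2 At SuppA DA) as [_ [_ SuppAt]].
  set (H := fun s q t =>
    -1 * (At s q t * P s q t + A3 s q t * (Bt s q t * (V s q t * P s q t)))).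
  assert (PK : exp_smooth eps n K).
  { apply (exp_smooth_mult eps n (fun _ _ _ => -1)); [apply exp_smooth_const |].
    apply exp_smooth_mult; [exact PA | apply exp_smooth_mult; assumption]. }
  assert (PH : exp_smooth eps n H).
  { apply (exp_smooth_mult eps n (fun _ _ _ => -1)); [apply exp_smooth_const |].
    apply (exp_smooth_plus eps n (fun s q t => At s q t * P s q t));
      repeat apply exp_smooth_mult; assumption. }
  assert (SK : supported3 eps r K).
  { intros s q t Hs Hq; unfold K, A3; rewrite A_supp by exact Hq; ring. }
  assert (SH : supported3 eps r H).
  { intros s q t Hs Hq; unfold H, A3; rewrite SuppAt, A_supp by assumption; ring. }
  destruct (linear_solution_exists eps r Heps Hr K H) as [Y HY]; auto;
    try (apply (exp_smooth_lip eps n); assumption).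
  apply (exp_smooth_double_integral eps r Heps Hr n W V Y); auto.
  - apply (exp_smooth_ext eps n (fun s q t => -1 * (A3 s q t * P s q t))).
    + intros; unfold W, A3; ring.
    + apply (exp_smooth_mult eps n (fun _ _ _ => -1)); [apply exp_smooth_const |].
      apply exp_smooth_mult; assumption.
  - apply exp_lip_potential.
  - apply (linear_solution_smooth eps r Heps Hr n kappa K H); auto.
    apply kernel_bound_potential.
  - apply (potential_derive At Bt Y); auto; try (apply (exp_smooth_lip eps n); assumption).
    + intros; apply DA; assumption.
    + intros; apply DB; assumption.
Qed.

End Angular_family.

(** * Descent to the circle *)

Definition ang (t : R) : R * R := (cos t, sin t).

Definition lift (f : R -> R -> R * R -> R) (s q t : R) : R := f s q (ang t).

Lemma circle_ang t : circle (ang t).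
Proof.
  unfold circle, ang; simpl.
  pose proof (sin2_cos2 t) as H; unfold Rsqr in H; lra.
Qed.

Lemma rot_ang h t : rot h (ang t) = ang (t + h).
Proof.
  unfold rot, ang; simpl; rewrite cos_plus, sin_plus; f_equal; ring.
Qed.

(** The bounded range of angles provides the compact parameter interval on which the data are
    bounded. *)
Lemma circle_ang_inv w : circle w -> exists t, - PI <= t <= PI /\ w = ang t.
Proof.
  destruct w as [x y]; unfold circle, ang; simpl; intros H.
  assert (Hx : -1 <= x <= 1).
  { split; apply Rnot_lt_le; intros Hn.
    - assert (0 < (- x - 1) * (- x + 1)) by (apply Rmult_lt_0_compat; lra).
      pose proof (Rle_0_sqr y) as Hy; unfold Rsqr in Hy; lra.
    - assert (0 < (x - 1) * (x + 1)) by (apply Rmult_lt_0_compat; lra).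
      pose proof (Rle_0_sqr y) as Hy; unfold Rsqr in Hy; lra. }
  pose proof (acos_bound x) as Hb; pose proof PI_RGT_0 as HPI.
  assert (Es : sin (acos x) = Rabs y).
  { rewrite sin_acos by exact Hx; rewrite <- sqrt_Rsqr_abs; f_equal.
    unfold Rsqr; lra. }
  destruct (Rle_dec 0 y) as [Hy | Hy].
  - exists (acos x); split; [lra |].
    rewrite cos_acos, Es, Rabs_right by lra; reflexivity.
  - exists (- acos x); split; [lra |].
    rewrite cos_neg, sin_neg, cos_acos, Es, Rabs_left by lra; f_equal; lra.
Qed.

(** Rotations act on [ang] by translating the angle, so the derivative along the rotation flow at 0
    is the ordinary derivative of the lift at t. *)
Lemma is_derive_lift f s q t l :
  is_derive (lift f s q) t l <-> is_derive (fun h => f s q (rot h (ang t))) 0 l.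
Proof.
  split; intros H.
  - apply (is_derive_ext (fun h => lift f s q (t + h))).
    + intros h; rewrite rot_ang; reflexivity.
    + replace l with (scal 1 l) by (unfold scal; simpl; unfold mult; simpl; ring).
      apply (is_derive_comp (lift f s q) (fun h => t + h) 0 l 1).
      * rewrite Rplus_0_r; exact H.
      * auto_derive; [exact I | ring].
  - apply (is_derive_ext (fun u => f s q (rot (u - t) (ang t)))).
    + intros u; rewrite rot_ang; unfold lift; f_equal; f_equal; ring.
    + replace l with (scal 1 l) by (unfold scal; simpl; unfold mult; simpl; ring).
      apply (is_derive_comp (fun h => f s q (rot h (ang t))) (fun u => u - t) t l 1).
      * rewrite Rminus_diag; exact H.
      * auto_derive; [exact I | ring].
Qed.

Lemma atan_abs_le x : Rabs (atan x) <= Rabs x.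
Proof.
  pose proof (lipschitz_of_derive atan (fun x => / (1 + x ^ 2)) 1) as L.
  specialize (L (fun y => proj2 (is_derive_Reals _ _ _) (derivable_pt_lim_atan y))).
  assert (B : forall y, Rabs (/ (1 + y ^ 2)) <= 1).
  { intros y; pose proof (pow2_ge_0 y).
    rewrite Rabs_right by (apply Rle_ge; left; apply Rinv_0_lt_compat; lra).
    rewrite <- Rinv_1; apply Rinv_le_contravar; lra. }
  pose proof (L B x 0) as H; rewrite atan_0, !Rminus_0_r, Rmult_1_l in H; exact H.
Qed.

(** Joint continuity refers to the topology of the plane, while estimates on lifts are in the angle;
    this converts closeness of points into closeness of angles, with a Lipschitz constant. *)
Lemma circle_near w0 w :
  circle w0 -> circle w ->
  Rabs (fst w - fst w0) <= 1 / 4 -> Rabs (snd w - snd w0) <= 1 / 4 ->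
  exists h, w = rot h w0 /\
    Rabs h <= 2 * (Rabs (fst w - fst w0) + Rabs (snd w - snd w0)).
Proof.
  destruct w0 as [a b], w as [x y]; unfold circle, rot; cbn [fst snd]; intros H0 H Hx Hy.
  assert (Hle : forall u v, u ^ 2 + v ^ 2 = 1 -> Rabs u <= 1).
  { intros u v Huv; apply Rabs_le; pose proof (pow2_ge_0 v).
    split; apply Rnot_lt_le; intros Hn.
    - assert (0 < (- u - 1) * (- u + 1)) by (apply Rmult_lt_0_compat; lra); lra.
    - assert (0 < (u - 1) * (u + 1)) by (apply Rmult_lt_0_compat; lra); lra. }
  pose proof (Hle a b H0) as Ha.
  assert (Hb : Rabs b <= 1) by (apply (Hle b a); lra).
  (* Sine and cosine of the angle from [w0] to [w]. Closeness within 1/4 in each coordinate gives d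
     >= 1/2, so the angle is atan(c/d). *)
  set (c := a * y - b * x); set (d := a * x + b * y).
  assert (Ecd : d ^ 2 + c ^ 2 = 1).
  { transitivity ((a ^ 2 + b ^ 2) * (x ^ 2 + y ^ 2)); [unfold c, d; ring |].
    rewrite H0, H; ring. }
  assert (Hm : forall u v, Rabs u <= 1 -> Rabs (u * v) <= Rabs v).
  { intros u v Hu; rewrite Rabs_mult; pose proof (Rabs_pos v).
    rewrite <- (Rmult_1_l (Rabs v)) at 2; apply Rmult_le_compat_r; assumption. }
  assert (Hd : 1 / 2 <= d).
  { assert (E : d = 1 + (a * (x - a) + b * (y - b))) by (unfold d; rewrite <- H0; ring).
    pose proof (Hm a (x - a) Ha) as m1; pose proof (Hm b (y - b) Hb) as m2.
    apply Rabs_le_between in m1; apply Rabs_le_between in m2; lra. }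
  assert (Hc : Rabs c <= Rabs (x - a) + Rabs (y - b)).
  { replace c with (a * (y - b) + - (b * (x - a))) by (unfold c; ring).
    eapply Rle_trans; [apply Rabs_triang |]; rewrite Rabs_Ropp.
    pose proof (Hm a (y - b) Ha); pose proof (Hm b (x - a) Hb); lra. }
  exists (atan (c / d)).
  assert (Es : sqrt (1 + (c / d)²) = / d).
  { replace (1 + (c / d)²) with ((/ d)²).
    - apply sqrt_Rsqr; left; apply Rinv_0_lt_compat; lra.
    - replace ((/ d)²) with ((d ^ 2 + c ^ 2) * / d ^ 2)
        by (rewrite Ecd; unfold Rsqr; field; lra).
      unfold Rsqr; field; lra. }
  split.
  - rewrite cos_atan, sin_atan, Es.
    replace (1 / / d) with d by (field; lra).
    replace (c / d / / d) with c by (field; lra).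
    f_equal; [transitivity ((a ^ 2 + b ^ 2) * x) | transitivity ((a ^ 2 + b ^ 2) * y)];
      solve [rewrite H0; ring | unfold c, d; ring].
  - eapply Rle_trans; [apply atan_abs_le |].
    unfold Rdiv; rewrite Rabs_mult, Rabs_inv, (Rabs_right d) by lra.
    assert (Hd2 : / d <= 2).
    { replace 2 with (/ (1 / 2)) by field; apply Rinv_le_contravar; lra. }
    rewrite Rmult_comm; apply Rmult_le_compat; try apply Rabs_pos; try assumption.
    left; apply Rinv_0_lt_compat; lra.
Qed.

Section Descent.

Variable eps : R.
Hypothesis Heps : 0 < eps.

Let J (s : R) : Prop := - eps < s.

Lemma jointly_continuous_of_lift f : exp_lip eps (lift f) -> jointly_continuous J f.
Proof.
  intros Hf; destruct (exp_lip_bounds eps _ Hf) as [C [HC H]].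
  enough (Main0 : forall (s0 q0 : R) (w0 : R * R), J s0 -> circle w0 ->
    filterlim (fun p : R * R * (R * R) => f (fst (fst p)) (snd (fst p)) (snd p))
      (within (fun p : R * R * (R * R) => J (fst (fst p)) /\ circle (snd p))
        (locally (s0, q0, w0))) (locally (f s0 q0 w0))).
  { intros [[s0 q0] w0] [Hs0 Hw0]; exact (Main0 s0 q0 w0 Hs0 Hw0). }
  intros s0 q0 w0 Hs0 Hw0.
  set (K := C * exp (C * (Rabs s0 + (Rabs s0 + 1)))).
  assert (HK : 0 <= K) by (apply Cexp_pos, HC).
  apply filterlim_locally; intros e.
  (* The bound 1/4 is for [circle_near]. The 6 counts |s - s0| < d, |q - q0| < d and |h| <= 2(d +
     d); [K + 1] avoids division by zero. *)
  assert (Hd : 0 < Rmin (1 / 4) (e / (6 * (K + 1)))).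
  { apply Rmin_pos; [lra | apply Rdiv_lt_0_compat; [apply cond_pos | lra]]. }
  set (d := Rmin (1 / 4) (e / (6 * (K + 1)))) in *.
  pose proof (Rmin_l (1 / 4) (e / (6 * (K + 1)))) as d1.
  pose proof (Rmin_r (1 / 4) (e / (6 * (K + 1)))) as d2; fold d in d1, d2.
  assert (Main : forall (s q : R) (w : R * R), J s -> circle w ->
    Rabs (s - s0) < d -> Rabs (q - q0) < d ->
    Rabs (fst w - fst w0) < d -> Rabs (snd w - snd w0) < d ->
    Rabs (f s q w - f s0 q0 w0) < e).
  { intros s q w Hs Hw Bs Bq Bx By.
    destruct (circle_near w0 w) as [h [Ew Hh]]; auto; try lra.
    destruct (circle_ang_inv w0 Hw0) as [t [_ Et]].
    rewrite Ew, Et, rot_ang.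
    destruct (H s q (t + h) s0 q0 t Hs Hs0) as [_ a]; unfold lift in a.
    rewrite Rplus_minus_l in a.
    assert (Hsa : Rabs s <= Rabs s0 + 1).
    { replace s with (s0 + (s - s0)) by ring.
      eapply Rle_trans; [apply Rabs_triang |]; lra. }
    eapply Rle_lt_trans; [apply a |].
    pose proof (Rabs_pos h); pose proof (Rabs_pos (s - s0)); pose proof (Rabs_pos (q - q0)).
    apply Rle_lt_trans with (K * (6 * d)).
    - apply Rmult_le_compat; [apply Cexp_pos, HC | lra | | lra].
      apply Rmult_le_compat_l; [exact HC |]; apply exp_le, Rmult_le_compat_l; lra.
    - apply Rlt_le_trans with ((K + 1) * (6 * d)); [apply Rmult_lt_compat_r; lra |].
      apply Rle_trans with ((K + 1) * (6 * (e / (6 * (K + 1))))).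
      + apply Rmult_le_compat_l; lra.
      + right; field; lra. }
  exists (mkposreal d Hd); intros [[s q] w] [[Bs Bq] [Bx By]] [Hs Hw].
  exact (Main s q w Hs Hw Bs Bq Bx By).
Qed.

Lemma exp_smooth_lift_derivatives n f :
  exp_smooth eps (S n) (lift f) ->
  has_partials J f /\ exp_smooth eps n (lift (ds f)) /\ exp_smooth eps n (lift (dq f)) /\
  exp_smooth eps n (lift (dw f)).
Proof.
  intros [_ [f1 [f2 [f3 [D [H1 [H2 H3]]]]]]].
  split; [| split; [| split]].
  - intros s q w Hs Hw; destruct (circle_ang_inv w Hw) as [t [_ E]]; rewrite E.
    destruct (D s q t Hs) as [d1 [d2 d3]]; split; [| split].
    + exists (f1 s q t); exact d1.
    + exists (f2 s q t); exact d2.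
    + exists (f3 s q t); exact (proj1 (is_derive_lift f s q t (f3 s q t)) d3).
  - apply (exp_smooth_ext eps n f1); [| exact H1]; intros s q t Hs.
    exact (is_derive_unique _ _ _ (proj1 (D s q t Hs))).
  - apply (exp_smooth_ext eps n f2); [| exact H2]; intros s q t Hs.
    exact (is_derive_unique _ _ _ (proj1 (proj2 (D s q t Hs)))).
  - apply (exp_smooth_ext eps n f3); [| exact H3]; intros s q t Hs.
    exact (is_derive_unique _ _ _ (proj1 (is_derive_lift f s q t (f3 s q t))
      (proj2 (proj2 (D s q t Hs))))).
Qed.

Lemma Ck_of_lift n f : exp_smooth eps n (lift f) -> Ck J n f.
Proof.
  revert f; induction n; intros f Hf; pose proof (exp_smooth_lip eps _ _ Hf) as L;
    (split; [apply jointly_continuous_of_lift, L |]); [exact I |].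
  destruct (exp_smooth_lift_derivatives n f Hf) as [P [H1 [H2 H3]]]; auto.
Qed.

Lemma exp_smooth_lift_iter (D : (R -> R -> R * R -> R) -> R -> R -> R * R -> R) :
  (forall n f, exp_smooth eps (S n) (lift f) -> exp_smooth eps n (lift (D f))) ->
  forall k n f, exp_smooth eps (k + n) (lift f) -> exp_smooth eps n (lift (Nat.iter k D f)).
Proof.
  intros HD; induction k; intros n f Hf; [exact Hf |].
  simpl; apply HD, IHk; rewrite Nat.add_succ_r; exact Hf.
Qed.

Lemma exp_bounded_dmix a b c f :
  (forall n, exp_smooth eps n (lift f)) -> exp_bounded eps (lift (dmix a b c f)).
Proof.
  intros H; unfold dmix.
  refine (proj1 (exp_smooth_lip eps 0 _ (exp_smooth_lift_iter ds _ a 0 _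
    (exp_smooth_lift_iter dq _ b (a + 0) _ (exp_smooth_lift_iter dw _ c (b + (a + 0)) _
      (H _)))))); intros n h Hn; apply (exp_smooth_lift_derivatives n h Hn).
Qed.

Definition future_circle (x : R * R * (R * R)) : Prop :=
  0 <= fst (fst x) /\ circle (snd x).

Definition time (x : R * R * (R * R)) : R := fst (fst x).

Definition at_circle (f : R -> R -> R * R -> R) (x : R * R * (R * R)) : R :=
  f (fst (fst x)) (snd (fst x)) (snd x).

Lemma edom_of_lift f :
  exp_bounded eps (lift f) -> edom future_circle time (fun _ => 1) (at_circle f).
Proof.
  intros [C [HC H]]; exists C; split; [exact HC |].
  intros [[s q] w] [Hs Hw]; unfold time, at_circle; cbn [fst snd] in *.
  destruct (circle_ang_inv w Hw) as [t [_ E]]; rewrite E.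
  assert (Hs' : - eps < s) by lra.
  destruct (H (s, q, t) Hs') as [_ [_ a]].
  unfold age, at3 in a; cbn [fst snd] in a; rewrite (Rabs_right s) in a by lra.
  split; [exact Hs | split; [lra | exact a]].
Qed.

End Descent.

Lemma edom_sum (F : nat -> R * R * (R * R) -> R) n :
  (forall k, edom future_circle time (fun _ => 1) (F k)) ->
  edom future_circle time (fun _ => 1) (fun x => sum_f_R0 (fun k => F k x) n).
Proof.
  intros H; induction n; simpl; [apply H | apply edom_plus; [exact IHn | apply H]].
Qed.

Lemma edom_sum_orders lo hi (F : nat -> nat -> nat -> R * R * (R * R) -> R) :
  (forall a b c, edom future_circle time (fun _ => 1) (F a b c)) ->
  edom future_circle time (fun _ => 1) (fun x => sum_orders lo hi (fun a b c => F a b c x)).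
Proof.
  intros H; unfold sum_orders.
  apply edom_sum; intros a; apply edom_sum; intros b; apply edom_sum; intros c.
  destruct (andb _ _); [apply H |].
  apply edom_const; intros x [Hx _]; exact Hx.
Qed.

(** * The data *)

(* By uniform continuity [f] varies by less than 1 over each of [N] equal steps
   along the segment from the corner [(a, c)]. *)
Lemma bounded_continuity_2d (f : R -> R -> R) a b c d :
  a <= b -> c <= d ->
  (forall x y, a <= x <= b -> c <= y <= d -> continuity_2d_pt f x y) ->
  exists C, forall x y, a <= x <= b -> c <= y <= d -> Rabs (f x y) <= C.
Proof.
  intros Hab Hcd Hf.
  destruct (uniform_continuity_2d f a b c d Hf (mkposreal 1 Rlt_0_1)) as [e He].
  simpl in He; pose proof (cond_pos e) as Pe.
  destruct (INR_unbounded ((b - a + (d - c)) / e)) as [N HN].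
  assert (HN0 : 0 < INR N).
  { eapply Rle_lt_trans; [| apply HN]; apply Rdiv_le_0_compat; lra. }
  assert (HNe : b - a + (d - c) < INR N * e).
  { apply Rmult_lt_reg_r with (/ e); [apply Rinv_0_lt_compat, Pe |].
    rewrite Rmult_assoc, Rinv_r, Rmult_1_r by lra; exact HN. }
  exists (Rabs (f a c) + INR N); intros x y Hx Hy.
  assert (Hfr : forall k, (k <= N)%nat -> 0 <= INR k / INR N <= 1).
  { intros k Hk; apply le_INR in Hk; split.
    - apply Rdiv_le_0_compat; [apply pos_INR | exact HN0].
    - apply Rmult_le_reg_r with (INR N); [exact HN0 |].
      unfold Rdiv; rewrite Rmult_assoc, Rinv_l by lra; lra. }
  assert (Hin : forall p q z t, p <= z <= q -> 0 <= t <= 1 -> p <= p + (z - p) * t <= q).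
  { intros p q z t Hz Ht.
    assert (0 <= (z - p) * t) by (apply Rmult_le_pos; lra).
    assert ((z - p) * t <= (z - p) * 1) by (apply Rmult_le_compat_l; lra); lra. }
  assert (Hst : forall p z k, 0 <= z - p <= b - a + (d - c) ->
    Rabs (p + (z - p) * (INR (S k) / INR N) - (p + (z - p) * (INR k / INR N))) < e).
  { intros p z k Hz; rewrite S_INR.
    replace (p + (z - p) * ((INR k + 1) / INR N) - (p + (z - p) * (INR k / INR N)))
      with ((z - p) / INR N) by (field; lra).
    rewrite Rabs_right by (apply Rle_ge, Rdiv_le_0_compat; lra).
    apply Rmult_lt_reg_r with (INR N); [exact HN0 |].
    unfold Rdiv; rewrite Rmult_assoc, Rinv_l by lra; lra. }
  assert (Main : forall k, (k <= N)%nat ->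
    Rabs (f (a + (x - a) * (INR k / INR N)) (c + (y - c) * (INR k / INR N)))
      <= Rabs (f a c) + INR k).
  { induction k; intros Hk.
    - simpl; unfold Rdiv; rewrite Rmult_0_l, !Rmult_0_r, !Rplus_0_r; lra.
    - assert (Hk' : (k <= N)%nat) by lia; specialize (IHk Hk').
      pose proof (Hfr k Hk') as F1; pose proof (Hfr (S k) Hk) as F2.
      pose proof (He _ _ _ _ (Hin a b x _ Hx F1) (Hin c d y _ Hy F1)
        (Hin a b x _ Hx F2) (Hin c d y _ Hy F2)) as H.
      rewrite S_INR at 3.
      set (u := f (a + (x - a) * (INR (S k) / INR N)) (c + (y - c) * (INR (S k) / INR N)))
        in *.
      set (v := f (a + (x - a) * (INR k / INR N)) (c + (y - c) * (INR k / INR N))) in *.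
      replace u with (v + (u - v)) by ring.
      assert (Rabs (u - v) < 1) by (apply H; apply Hst; lra).
      eapply Rle_trans; [apply Rabs_triang |]; lra. }
  pose proof (Main N (Nat.le_refl N)) as H.
  unfold Rdiv in H; rewrite Rinv_r, !Rmult_1_r in H by lra.
  replace (a + (x - a)) with x in H by ring; replace (c + (y - c)) with y in H by ring.
  exact H.
Qed.

Lemma continuity_2d_ang (A : R -> R * R -> R) q t :
  jointly_continuous (fun _ => True) (fun _ => A) ->
  continuity_2d_pt (fun q t => A q (ang t)) q t.
Proof.
  intros HA e.
  pose proof (HA ((0, q), ang t) (conj I (circle_ang t))) as H.
  apply (proj1 (filterlim_locally _ _)) with (eps := e) in H.
  destruct H as [d Hd].
  assert (Ls : forall x y, Rabs (sin x - sin y) <= 1 * Rabs (x - y)).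
  { apply (lipschitz_of_derive sin cos).
    - intros x; apply is_derive_Reals, derivable_pt_lim_sin.
    - intros x; apply Rabs_le, COS_bound. }
  assert (Lc : forall x y, Rabs (cos x - cos y) <= 1 * Rabs (x - y)).
  { apply (lipschitz_of_derive cos (fun x => - sin x)).
    - intros x; apply is_derive_Reals, derivable_pt_lim_cos.
    - intros x; rewrite Rabs_Ropp; apply Rabs_le, SIN_bound. }
  exists d; intros u v Hu Hv.
  refine (Hd ((0, u), ang v) _ (conj I (circle_ang v))).
  split; split; simpl.
  - apply ball_center.
  - exact Hu.
  - eapply Rle_lt_trans; [apply Lc | rewrite Rmult_1_l; exact Hv].
  - eapply Rle_lt_trans; [apply Ls | rewrite Rmult_1_l; exact Hv].
Qed.

Section Data.

Variables eps r : R.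
Hypothesis Hr : 0 < r.

Definition data_supported (A : R -> R * R -> R) : Prop :=
  forall q w, circle w -> r < Rabs q -> A q w = 0.

(** Compactness: |q| <= r and an angle in [-PI, PI] suffice, since A vanishes for larger |q| and any
    angle has a representative in that interval. *)
Lemma data_bounded A :
  jointly_continuous (fun _ => True) (fun _ => A) -> data_supported A ->
  exists C, 0 <= C /\ forall q t, Rabs (A q (ang t)) <= C.
Proof.
  intros HA HS.
  destruct (bounded_continuity_2d (fun q t => A q (ang t)) (- r) r (- PI) PI) as [C HC].
  - lra.
  - pose proof PI_RGT_0; lra.
  - intros; apply continuity_2d_ang, HA.
  - exists (Rabs C); split; [apply Rabs_pos |]; intros q t.
    destruct (Rlt_dec r (Rabs q)) as [Hq | Hq].
    + rewrite HS, Rabs_R0 by (try apply circle_ang; exact Hq); apply Rabs_pos.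
    + destruct (circle_ang_inv (ang t) (circle_ang t)) as [t' [Ht' E]]; rewrite E.
      eapply Rle_trans; [| apply Rle_abs]; apply HC; [| exact Ht'].
      apply Rabs_le_between; lra.
Qed.

Let Aq (A : R -> R * R -> R) : R -> R * R -> R := dq (fun _ => A) 0.
Let Aw (A : R -> R * R -> R) : R -> R * R -> R := dw (fun _ => A) 0.

Lemma data_supported_dq A : data_supported A -> data_supported (Aq A).
Proof.
  intros HS q w Hw Hq; unfold Aq, dq.
  rewrite (Derive_ext_loc _ (fun _ => 0)); [apply Derive_const |].
  apply (filter_imp (fun q' => r < Rabs q')); [intros; apply HS; assumption |].
  apply (continuous_Rabs q (fun y => r < y)); apply (open_gt r (Rabs q) Hq).
Qed.

Lemma data_supported_dw A : data_supported A -> data_supported (Aw A).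
Proof.
  intros HS q w Hw Hq; unfold Aw, dw.
  rewrite (Derive_ext _ (fun _ => 0)); [apply Derive_const |].
  intros t; apply HS; [apply circle_rot, Hw | exact Hq].
Qed.

(** One order is lost because the Lipschitz bounds at each level come from bounds on the next
    derivatives. These derivatives are again supported in |q| <= r, hence bounded. *)
Lemma exp_smooth_data n A :
  Ck (fun _ => True) (S n) (fun _ => A) -> data_supported A ->
  exp_smooth eps n (lift (fun _ => A)).
Proof.
  assert (Dq : forall A, has_partials (fun _ => True) (fun _ => A) ->
    forall q t, is_derive (fun q => A q (ang t)) q (Aq A q (ang t))).
  { intros B P q t; destruct (P 0 q (ang t) I (circle_ang t)) as [_ [h _]].
    apply (Derive_correct (fun q => B q (ang t))), h. }
  assert (Dw : forall A, has_partials (fun _ => True) (fun _ => A) ->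
    forall q t, is_derive (fun t => A q (ang t)) t (Aw A q (ang t))).
  { intros B P q t; destruct (P 0 q (ang t) I (circle_ang t)) as [_ [_ h]].
    apply (is_derive_lift (fun _ => B) 0 q t), Derive_correct, h. }
  assert (L : forall A, Ck (fun _ => True) 1 (fun _ => A) -> data_supported A ->
    exp_lip eps (lift (fun _ => A))).
  { intros B [J0 [P [_ [Hq Hw]]]] HS.
    destruct (data_bounded B J0 HS) as [C [C0 Bd]].
    destruct (data_bounded (Aq B) (proj1 Hq) (data_supported_dq B HS)) as [D [D0 Bq]].
    destruct (data_bounded (Aw B) (proj1 Hw) (data_supported_dw B HS)) as [F [F0 Bw]].
    apply exp_lip_intro.
    - exists C; split; [exact C0 |]; intros s q t Hs.
      eapply Rle_trans; [apply Bd | apply le_Cexp; [exact C0 | apply Rabs_pos]].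
    - exists 0; split; [lra |]; intros s s' q t _ _; unfold lift.
      rewrite Rminus_diag, Rabs_R0; lra.
    - exists D; split; [exact D0 |]; intros s q q' t Hs.
      eapply Rle_trans; [apply (lipschitz_of_derive _ _ D (fun q => Dq B P q t) (fun q => Bq q t)) |].
      apply Rmult_le_compat_r; [apply Rabs_pos | apply le_Cexp; [exact D0 | apply Rabs_pos]].
    - exists F; split; [exact F0 |]; intros s q t t' Hs.
      eapply Rle_trans; [apply (lipschitz_of_derive _ _ F (fun t => Dw B P q t) (fun t => Bw q t)) |].
      apply Rmult_le_compat_r; [apply Rabs_pos | apply le_Cexp; [exact F0 | apply Rabs_pos]]. }
  assert (M : forall n f, Ck (fun _ => True) (S n) f -> Ck (fun _ => True) 1 f).
  { assert (M0 : forall n f, Ck (fun _ => True) n f -> Ck (fun _ => True) 0 f).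
    { intros k f Hf; split; [destruct k; apply Hf | exact I]. }
    intros k f [H0 [H1 [H2 [H3 H4]]]]; split; [exact H0 | split; [exact H1 |]].
    split; [| split]; apply (M0 k); assumption. }
  revert A; induction n; intros A HA HS; (split; [apply L; [apply (M _ _ HA) | exact HS] |]);
    [exact I |].
  destruct HA as [J0 [P [_ [Hq Hw]]]].
  exists (fun _ _ _ => 0), (lift (fun _ => Aq A)), (lift (fun _ => Aw A)).
  split; [| split; [apply exp_smooth_const | split; apply IHn]].
  - intros s q t Hs; split; [| split].
    + apply (is_derive_const (V := R_NormedModule) (A q (ang t))).
    + apply (Dq A P).
    + apply (Dw A P).
  - exact Hq.
  - apply data_supported_dq, HS.
  - exact Hw.
  - apply data_supported_dw, HS.
Qed.

(** Proved as a pair, since differentiation exchanges the two functions up to sign. *)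
Lemma exp_smooth_trig n :
  exp_smooth eps n (fun _ _ t => cos t) /\ exp_smooth eps n (fun _ _ t => sin t).
Proof.
  assert (Lip : forall (u u' : R -> R), (forall x, is_derive u x (u' x)) ->
    (forall x, -1 <= u x <= 1) -> (forall x, -1 <= u' x <= 1) ->
    exp_lip eps (fun _ _ t => u t)).
  { intros u u' D B B'; apply exp_lip_intro.
    - exists 1; split; [lra |]; intros s q t _.
      eapply Rle_trans; [apply Rabs_le, B | apply le_Cexp; [lra | apply Rabs_pos]].
    - exists 0; split; [lra |]; intros; rewrite Rminus_diag, Rabs_R0; lra.
    - exists 0; split; [lra |]; intros; rewrite Rminus_diag, Rabs_R0; lra.
    - exists 1; split; [lra |]; intros s q t t' _.
      eapply Rle_trans;
        [apply (lipschitz_of_derive u u' 1 D); intros; apply Rabs_le, B' |].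
      apply Rmult_le_compat_r; [apply Rabs_pos |].
      apply le_Cexp; [lra | apply Rabs_pos]. }
  assert (Dc : forall x, is_derive cos x (-1 * sin x)).
  { intros x; replace (-1 * sin x) with (- sin x) by ring.
    apply is_derive_Reals, derivable_pt_lim_cos. }
  assert (Ds : forall x, is_derive sin x (cos x)).
  { intros x; apply is_derive_Reals, derivable_pt_lim_sin. }
  assert (Lc : exp_lip eps (fun _ _ t => cos t)).
  { apply (Lip cos (fun x => -1 * sin x)); [exact Dc | apply COS_bound |].
    intros x; pose proof (SIN_bound x); lra. }
  assert (Ls : exp_lip eps (fun _ _ t => sin t)).
  { apply (Lip sin cos); [exact Ds | apply SIN_bound | apply COS_bound]. }
  assert (D0 : forall k x : R, is_derive (fun _ : R => k) x 0).
  { intros k x; apply (is_derive_const (V := R_NormedModule) k). }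
  induction n; [split; (split; [assumption | exact I]) |].
  destruct IHn as [IHc IHs]; split; (split; [assumption |]).
  - exists (fun _ _ _ => 0), (fun _ _ _ => 0), (fun _ _ t => -1 * sin t).
    split; [intros; split; [| split]; auto |].
    split; [apply exp_smooth_const | split; [apply exp_smooth_const |]].
    apply (exp_smooth_mult eps n (fun _ _ _ => -1)); [apply exp_smooth_const | exact IHs].
  - exists (fun _ _ _ => 0), (fun _ _ _ => 0), (fun _ _ t => cos t).
    split; [intros; split; [| split]; auto |].
    split; [apply exp_smooth_const | split; [apply exp_smooth_const | exact IHc]].
Qed.

Lemma exp_smooth_G n E : exp_smooth eps n (fun _ _ t => G E (ang t)).
Proof.
  destruct (exp_smooth_trig n) as [Hc Hs].
  assert (Hw : forall a, exp_smooth eps n (fun _ _ t => what (ang t) a)).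
  { intros [| [| a]]; simpl; [apply exp_smooth_const | exact Hc | exact Hs]. }
  assert (Hsum : forall (F : nat -> R -> R -> R -> R) m,
    (forall k, exp_smooth eps n (F k)) ->
    exp_smooth eps n (fun s q t => sum_f_R0 (fun k => F k s q t) m)).
  { intros F m HF; induction m; simpl; [apply HF | apply exp_smooth_plus; auto]. }
  unfold G.
  apply (Hsum (fun a _ _ t =>
    sum_f_R0 (fun b => g0 E a b * what (ang t) a * what (ang t) b) 2)); intros a.
  apply (Hsum (fun b _ _ t => g0 E a b * what (ang t) a * what (ang t) b)); intros b.
  apply (exp_smooth_mult eps n (fun _ _ t => g0 E a b * what (ang t) a)); [| apply Hw].
  apply (exp_smooth_mult eps n (fun _ _ _ => g0 E a b)); [apply exp_smooth_const | apply Hw].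
Qed.

End Data.

(** * Conclusion *)

Section Reduced_system.

Variables (E : wave_equation) (A : R -> R * R -> R) (r a0 La g0 : R).
Hypothesis Hr : 0 < r.
Hypothesis Ha0 : 0 <= a0.
Hypothesis HLa : 0 <= La.
Hypothesis HG : forall w, circle w -> 0 <= G E w <= g0.
Hypothesis A_bound : forall q w, circle w -> Rabs (A q w) <= a0.
Hypothesis A_lip : forall q q' w, circle w -> Rabs (A q w - A q' w) <= La * Rabs (q - q').
Hypothesis A_supp : data_supported r A.

Let M := speed_cap r a0.
Let eps := past_time r a0 g0.

Definition sol_V (s q : R) (w : R * R) : R :=
  potential r (speed_cap r a0) (G E w) (fun q => A q w) s q.

Definition sol_Uq (s q : R) (w : R * R) : R :=
  A q w * exp (G E w * A q w * sol_V s q w).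

Definition sol_U (s q : R) (w : R * R) : R :=
  qint r (fun s q => - A q w * exp (G E w * A q w * sol_V s q w)) s q.

(** Inserting mu U_q = -2A into the second equation leaves the linear equation mu_s = -G A U mu, and
    V_s = U; this is its solution with value -2 at s = 0. *)
Definition sol_mu (s q : R) (w : R * R) : R :=
  -2 * exp (-1 * (G E w * A q w * sol_V s q w)).

Lemma sol_life_pos : 0 < eps.
Proof.
  apply (past_time_pos r a0 g0 (G E (ang 0))); auto; apply HG, circle_ang.
Qed.

Lemma is_derive_sol_V s q w :
  - eps < s -> circle w -> is_derive (fun s => sol_V s q w) s (sol_U s q w).
Proof.
  intros Hs Hw.
  pose proof (is_derive_potential_s r a0 La g0 (G E w) (fun q => A q w) Hr Ha0 HLa (HG w Hw)
    (fun q => A_bound q w Hw) (fun q q' => A_lip q q' w Hw) (fun q => A_supp q w Hw)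
    s q Hs) as D.
  rewrite clip_id in D; [exact D |].
  apply (rate_bound r a0 La g0 (G E w) (fun q => A q w)); auto.
Qed.

Lemma is_derive_sol_U s q w :
  - eps < s -> circle w -> is_derive (fun q => sol_U s q w) q (sol_Uq s q w).
Proof.
  intros Hs Hw.
  pose proof (tame_W r a0 La g0 (G E w) (fun q => A q w) Hr Ha0 HLa (HG w Hw)
    (fun q => A_bound q w Hw) (fun q q' => A_lip q q' w Hw) (fun q => A_supp q w Hw)) as T.
  set (W := fun s q => - A q w * exp (G E w * A q w * sol_V s q w)).
  change (tame eps W) in T.
  replace (sol_Uq s q w) with (opp (W s q)) by (unfold W, sol_Uq, opp; simpl; ring).
  apply (is_derive_RInt' (W s) (fun q => sol_U s q w) q r).
  - apply filter_forall; intros q'; apply (RInt_correct (W s)).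
    apply (tame_ex_RInt_q eps); assumption.
  - apply (tame_continuous_q eps); assumption.
Qed.

Lemma sol_reduced_system : reduced_system E sol_mu sol_U.
Proof.
  intros s q w Hs Hw; pose proof sol_life_pos as Heps.
  assert (Hs' : - eps < s) by lra.
  assert (DU : forall s, - eps < s -> dq sol_U s q w = sol_Uq s q w).
  { intros u Hu; apply is_derive_unique, is_derive_sol_U; assumption. }
  split.
  - unfold ds.
    rewrite (Derive_ext_loc _ (fun _ => -2 * A q w)); [apply Derive_const |].
    apply (filter_imp (fun s' => - eps < s')); [| apply (locally_future eps); exact Hs'].
    intros u Hu; rewrite DU by exact Hu; unfold sol_mu, sol_Uq.
    set (x := G E w * A q w * sol_V u q w).
    transitivity (-2 * A q w * (exp (-1 * x) * exp x)); [ring |].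
    rewrite <- exp_plus; replace (-1 * x + x) with 0 by ring; rewrite exp_0; ring.
  - rewrite DU by exact Hs'.
    pose proof (is_derive_sol_V s q w Hs' Hw) as DV.
    set (x := G E w * A q w * sol_V s q w).
    assert (D : is_derive (fun s => sol_mu s q w) s
      (-2 * (-1 * (G E w * A q w * sol_U s q w) * exp (-1 * x)))).
    { unfold sol_mu; apply (is_derive_scal (fun s => exp (-1 * (G E w * A q w * sol_V s q w)))).
      apply (is_derive_comp exp (fun s => -1 * (G E w * A q w * sol_V s q w)) s
        (exp (-1 * x)) (-1 * (G E w * A q w * sol_U s q w))).
      - apply is_derive_Reals, derivable_pt_lim_exp.
      - apply (is_derive_scal (fun s => G E w * A q w * sol_V s q w)).
        apply (is_derive_scal (fun s => sol_V s q w)), DV. }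
    transitivity (-2 * (-1 * (G E w * A q w * sol_U s q w) * exp (-1 * x)));
      [exact (is_derive_unique _ _ _ D) |].
    unfold sol_mu, sol_Uq; fold x.
    transitivity (2 * G E w * A q w * sol_U s q w * exp (-1 * x)
      * (exp (-1 * x) * exp x)); [| field].
    rewrite <- exp_plus; replace (-1 * x + x) with 0 by ring; rewrite exp_0; ring.
Qed.

Lemma sol_U_limit s w : 0 <= s -> circle w -> is_lim (fun q => sol_U s q w) p_infty 0.
Proof.
  intros Hs Hw; apply (is_lim_ext_loc (fun _ => 0)); [| apply is_lim_const].
  exists r; intros q Hq; symmetry; apply RInt_null.
  intros x; unfold Rmin, Rmax; destruct (Rle_dec q r); intros Hx; [lra |].
  rewrite A_supp; [ring | exact Hw | rewrite Rabs_right; lra].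
Qed.

Lemma sol_initial q w : circle w -> sol_mu 0 q w = -2 /\ dq sol_U 0 q w = A q w.
Proof.
  intros Hw; pose proof sol_life_pos as Heps.
  assert (V0 : forall q, sol_V 0 q w = 0).
  { intros x; apply (potential_0 r a0 La g0 (G E w) (fun q => A q w)); auto. }
  split.
  - unfold sol_mu; rewrite V0, !Rmult_0_r, exp_0; ring.
  - transitivity (sol_Uq 0 q w).
    + apply is_derive_unique, is_derive_sol_U; [lra | exact Hw].
    + unfold sol_Uq; rewrite V0, Rmult_0_r, exp_0; ring.
Qed.

Hypothesis A_smooth : forall n, exp_smooth eps n (lift (fun _ => A)).

Let HGt (t : R) : 0 <= G E (ang t) <= g0 := HG (ang t) (circle_ang t).
Let A_bound_t (q t : R) : Rabs (A q (ang t)) <= a0 := A_bound q (ang t) (circle_ang t).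
Let A_lip_t (q q' t : R) : Rabs (A q (ang t) - A q' (ang t)) <= La * Rabs (q - q') :=
  A_lip q q' (ang t) (circle_ang t).
Let A_supp_t (q t : R) : r < Rabs q -> A q (ang t) = 0 := A_supp q (ang t) (circle_ang t).

Let B_smooth n : exp_smooth eps n (fun s q t => G E (ang t) * A q (ang t)).
Proof.
  apply (exp_smooth_mult eps n (fun _ _ t => G E (ang t))); [apply exp_smooth_G |].
  apply A_smooth.
Qed.

Lemma exp_smooth_sol_V n : exp_smooth eps n (lift sol_V).
Proof.
  exact (exp_smooth_potential r a0 La g0 (fun q t => A q (ang t)) (fun t => G E (ang t))
    Hr Ha0 HLa HGt A_bound_t A_lip_t A_supp_t A_smooth B_smooth n).
Qed.

Lemma exp_bounded_exp_sol_V k :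
  Rabs k <= 1 ->
  exp_bounded eps (fun s q t => exp (k * (G E (ang t) * A q (ang t) * sol_V s q (ang t)))).
Proof.
  exact (exp_bounded_exp_potential r a0 La g0 (fun q t => A q (ang t))
    (fun t => G E (ang t)) Hr Ha0 HLa HGt A_bound_t A_lip_t A_supp_t k).
Qed.

Lemma exp_smooth_exp_sol_V n k :
  Rabs k <= 1 ->
  exp_smooth eps n
    (fun s q t => exp (k * (G E (ang t) * A q (ang t) * sol_V s q (ang t)))).
Proof.
  intros Hk; apply exp_smooth_exp; [apply exp_bounded_exp_sol_V, Hk |].
  apply (exp_smooth_mult eps n (fun _ _ _ => k)); [apply exp_smooth_const |].
  apply (exp_smooth_mult eps n (fun s q t => G E (ang t) * A q (ang t)));
    [apply B_smooth | apply exp_smooth_sol_V].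
Qed.

Lemma exp_smooth_sol_mu n : exp_smooth eps n (lift sol_mu).
Proof.
  apply (exp_smooth_mult eps n (fun _ _ _ => -2)); [apply exp_smooth_const |].
  apply exp_smooth_exp_sol_V; rewrite Rabs_m1; lra.
Qed.

Lemma exp_smooth_sol_U n : exp_smooth eps n (lift sol_U).
Proof.
  apply (exp_smooth_qint3 eps r Hr n
    (fun s q t => - A q (ang t) * exp (G E (ang t) * A q (ang t) * sol_V s q (ang t)))).
  - apply (exp_smooth_ext eps n (fun s q t => -1 * (A q (ang t)
      * exp (1 * (G E (ang t) * A q (ang t) * sol_V s q (ang t)))))).
    + intros s q t _; rewrite Rmult_1_l; ring.
    + apply (exp_smooth_mult eps n (fun _ _ _ => -1)); [apply exp_smooth_const |].
      apply (exp_smooth_mult eps n (fun s q t => A q (ang t))); [apply A_smooth |].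
      apply exp_smooth_exp_sol_V; rewrite Rabs_R1; lra.
  - intros s q t _ Hq; rewrite A_supp_t by exact Hq; ring.
Qed.

Lemma sol_global : global_solution E sol_mu sol_U.
Proof.
  split; [| split; [| split]].
  - exists eps; split; [exact sol_life_pos |]; intros n.
    apply Ck_of_lift, exp_smooth_sol_mu.
  - exists eps; split; [exact sol_life_pos |]; intros n.
    apply Ck_of_lift, exp_smooth_sol_U.
  - exact sol_reduced_system.
  - exact sol_U_limit.
Qed.

Lemma sol_exponential_bounds : exponential_bounds sol_mu sol_U.
Proof.
  intros N _.
  assert (Hmu : forall s q w, sol_mu s q w <> 0).
  { intros s q w; unfold sol_mu.
    pose proof (exp_pos (-1 * (G E w * A q w * sol_V s q w))); lra. }
  assert (T : forall f, (forall n, exp_smooth eps n (lift f)) -> forall a b c,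
    edom future_circle time (fun _ => 1) (fun x => Rabs (at_circle (dmix a b c f) x))).
  { intros f Hf a b c; apply edom_abs, (edom_of_lift eps sol_life_pos).
    apply exp_bounded_dmix, Hf. }
  (* The term with [/ 2] is 1/|mu| written as half of exp(GAV), for which the bound with k = 1 is
     available; the identification follows below. *)
  assert (D : edom future_circle time (fun _ => 1) (fun x =>
    Rabs (at_circle sol_mu x) + / 2 * at_circle (fun s q w =>
      exp (1 * (G E w * A q w * sol_V s q w))) x
    + sum_orders 1 N (fun a b c => Rabs (at_circle (dmix a b c sol_mu) x))
    + sum_orders 0 N (fun a b c => Rabs (at_circle (dmix a b c sol_U) x)))).
  { apply edom_plus; [apply edom_plus; [apply edom_plus |] |].
    - apply (T sol_mu exp_smooth_sol_mu 0%nat 0%nat 0%nat).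
    - apply edom_scal, (edom_of_lift eps sol_life_pos), exp_bounded_exp_sol_V.
      rewrite Rabs_R1; lra.
    - apply (edom_sum_orders 1 N (fun a b c x => Rabs (at_circle (dmix a b c sol_mu) x))).
      apply T, exp_smooth_sol_mu.
    - apply (edom_sum_orders 0 N (fun a b c x => Rabs (at_circle (dmix a b c sol_U) x))).
      apply T, exp_smooth_sol_U. }
  destruct D as [C [HC HD]]; exists C, C; intros s q w Hs Hw; split; [apply Hmu |].
  destruct (HD ((s, q), w) (conj Hs Hw)) as [_ [_ H]].
  rewrite Rmult_1_r in H; unfold time in H; cbn [fst] in H.
  eapply Rle_trans; [| apply H]; eapply Rle_trans; [| apply Rle_abs].
  right; unfold at_circle; cbn [fst snd].
  f_equal; f_equal; f_equal.
  unfold sol_mu; set (x := G E w * A q w * sol_V s q w).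
  rewrite Rabs_left by (pose proof (exp_pos (-1 * x)); lra).
  rewrite Rmult_1_l.
  assert (Ex : exp (-1 * x) * exp x = 1).
  { rewrite <- exp_plus; replace (-1 * x + x) with 0 by ring; apply exp_0. }
  pose proof (exp_pos (-1 * x)).
  apply Rmult_eq_reg_l with (- (-2 * exp (-1 * x))); [| lra].
  rewrite Rinv_r by lra.
  transitivity (exp (-1 * x) * exp x); [symmetry; exact Ex | field].
Qed.

End Reduced_system.

Lemma reduced_system_solvable (E : wave_equation) (A : R -> R * R -> R) :
  (forall w, circle w -> 0 <= G E w) -> Cc_infty A ->
  exists mu U,
    global_solution E mu U /\
    (forall q w, circle w -> mu 0 q w = -2 /\ dq U 0 q w = A q w) /\
    exponential_bounds mu U.
Proof.
  intros HG [A_smooth [rho A_supp]].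
  set (r := Rabs rho + 1).
  assert (Hr : 0 < r) by (unfold r; pose proof (Rabs_pos rho); lra).
  assert (S : data_supported r A).
  { intros q w Hw Hq; apply A_supp; [exact Hw |].
    unfold r in Hq; pose proof (Rle_abs rho); lra. }
  assert (Sm : forall eps n, exp_smooth eps n (lift (fun _ => A))).
  { intros eps n; apply (exp_smooth_data eps r); auto. }
  (* The bounds on A and G are read off at s = 0, where the exponential weight is 1, using the
     sample value eps = 1. The eps of the solution depends on these bounds, so [Sm] is stated for
     every eps. *)
  assert (H1 : 0 < 1) by lra; assert (Hm : - (1) < 0) by lra.
  destruct (exp_lip_bounds 1 _ (exp_smooth_lip 1 0 _ (Sm 1 0%nat))) as [C [HC HA]].
  destruct (exp_lip_bounds 1 _ (exp_smooth_lip 1 0 _ (exp_smooth_G 1 0 E)))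
    as [D [HD HGb]].
  assert (Gb : forall w, circle w -> 0 <= G E w <= D).
  { intros w Hw; split; [apply HG, Hw |].
    destruct (circle_ang_inv w Hw) as [t [_ Et]]; rewrite Et.
    destruct (HGb 0 0 t 0 0 t Hm Hm) as [h _].
    rewrite Rabs_R0, Rmult_0_r, exp_0, Rmult_1_r in h.
    eapply Rle_trans; [apply Rle_abs | exact h]. }
  assert (Ab : forall q w, circle w -> Rabs (A q w) <= C).
  { intros q w Hw; destruct (circle_ang_inv w Hw) as [t [_ Et]]; rewrite Et.
    destruct (HA 0 q t 0 q t Hm Hm) as [h _].
    rewrite Rabs_R0, Rmult_0_r, exp_0, Rmult_1_r in h; exact h. }
  assert (Al : forall q q' w, circle w -> Rabs (A q w - A q' w) <= C * Rabs (q - q')).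
  { intros q q' w Hw; destruct (circle_ang_inv w Hw) as [t [_ Et]]; rewrite Et.
    destruct (HA 0 q t 0 q' t Hm Hm) as [_ h].
    rewrite !Rminus_diag, Rabs_R0, !Rplus_0_r, Rplus_0_l, Rmult_0_r, exp_0, Rmult_1_r in h.
    exact h. }
  exists (sol_mu E A r C), (sol_U E A r C); split; [| split].
  - apply (sol_global E A r C C D); auto.
  - intros q w Hw; apply (sol_initial E A r C C D); auto.
  - apply (sol_exponential_bounds E A r C C D); auto.
Qed.

Lemma eq_of_derive_and_limit (f g : R -> R) :
  (forall x, ex_derive f x) -> (forall x, ex_derive g x) ->
  (forall x, Derive f x = Derive g x) ->
  is_lim f p_infty 0 -> is_lim g p_infty 0 -> forall x, f x = g x.
Proof.
  intros Df Dg Efg Lf Lg x.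
  assert (Hc : forall y, f y - g y = f x - g x).
  { intros y.
    destruct (MVT_gen (fun z => f z - g z) x y (fun z => Derive f z - Derive g z))
      as [c [_ E]].
    - intros z _; apply (is_derive_minus f g); apply Derive_correct; auto.
    - intros z _; apply continuity_pt_filterlim.
      apply (continuous_minus f g); apply (ex_derive_continuous (V := R_NormedModule)); auto.
    - cbv beta in E; rewrite Efg, Rminus_diag, Rmult_0_l in E; lra. }
  assert (L : is_lim (fun y => f y - g y) p_infty (0 - 0))
    by (apply (is_lim_minus' f g p_infty 0 0); assumption).
  apply (is_lim_ext _ (fun _ => f x - g x)) in L; [| exact Hc].
  apply is_lim_unique in L; rewrite Lim_const in L; injection L; lra.
Qed.

Lemma Cc_infty_dq (U0 : R -> R * R -> R) :
  Cc_infty U0 -> Cc_infty (dq (fun _ => U0) 0).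
Proof.
  intros [Sm [r HS]]; split.
  - intros n; apply (Sm (S n)).
  - exists r; intros q w Hw Hq; apply (data_supported_dq r U0); auto.
Qed.

Theorem lemma3p6 (E : wave_equation)
    (HG : forall w, circle w -> 0 <= G E w) :
  (forall A, Cc_infty A ->
     exists mu U,
       global_solution E mu U /\
       (forall q w, circle w -> mu 0 q w = -2 /\ dq U 0 q w = A q w) /\
       exponential_bounds mu U) /\
  geometric_weak_null E.
Proof.
  split; [intros A; apply reduced_system_solvable, HG |].
  intros U0 HU0.
  (* The weak null condition prescribes U rather than U_q at s = 0. The data A = d_q U0 give the
     right derivative, and U = U0 follows because both tend to 0 as q tends to infinity. *)
  destruct (reduced_system_solvable E _ HG (Cc_infty_dq U0 HU0))
    as [mu [U [Hsol [H0 Hb]]]].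
  exists mu, U; split; [exact Hsol |]; split; [| exact Hb].
  intros q w Hw; split; [apply (H0 q w Hw) |].
  destruct Hsol as [_ [[eps [Heps SU]] [_ Hlim]]].
  destruct HU0 as [SU0 [r HS]].
  apply (eq_of_derive_and_limit (fun q => U 0 q w) (fun q => U0 q w)).
  - intros x; destruct (SU 1%nat) as [_ [P _]]; apply P; [lra | exact Hw].
  - intros x; destruct (SU0 1%nat) as [_ [P _]]; apply (P 0 x w I Hw).
  - intros x; apply (H0 x w Hw).
  - apply Hlim; [lra | exact Hw].
  - apply (is_lim_ext_loc (fun _ => 0)); [| apply is_lim_const].
    exists (Rabs r); intros x Hx; symmetry; apply HS; [exact Hw |].
    pose proof (Rle_abs r); pose proof (Rle_abs x); lra.
Qed.
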